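(* Let $\mathbf{F}$ be a symbol system of rank $2$ on a complex vector space $W$ of dimension $n$, with $F^2=\langle Q_1,\dots,Q_c\rangle\subset\operatorname{Sym}^2W^*$ of dimension $c$, and let $M(\mathbf{F})\subset\mathbb{P}V_{\mathbf{F}}$ be the associated Euler-symmetric variety, of dimension $n$. Let $\mathbf{Bs}(\mathbf F)=\{Q_1=\cdots=Q_c=0\}\subset\mathbb{P}W$. The following statements are equivalent: (1) $M(\mathbf{F})$ is a complete intersection of codimension $c$ in $\mathbb{P}V_{\mathbf{F}}$; (2) $\mathbf{Bs}(\mathbf F)\subset\mathbb{P}W$ is a set-theoretic complete intersection of codimension $c$; (3) for a general point $x\in M(\mathbf{F})$, the variety of lines $\mathcal{L}_x(M(\mathbf{F}))\subset\mathbb{P}T_xM(\mathbf{F})$ is a set-theoretic complete intersection of codimension $c$; (4) the finite sequence $(Q_1,\dots,Q_c)$ is a regular sequence in $\operatorname{Sym}(W^* )$.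
   Context: Everything is over $\mathbb{C}$; $\mathbb{P}W$ is the space of one-dimensional subspaces of $W$. Elements of $\operatorname{Sym}^kW^*$ are viewed as homogeneous polynomials of degree $k$ on $W$, so $\operatorname{Sym}(W^* )\cong\mathbb{C}[x_1,\dots,x_n]$. A symbol system of rank $2$ on $W$ is a graded subspace $\mathbf F=F^0\oplus F^1\oplus F^2\subset\operatorname{Sym}(W^* )$ with $F^0=\mathbb{C}$, $F^1=W^*$, $0\ne F^2\subset\operatorname{Sym}^2W^*$ and $F^k=0$ for $k\ge3$. Put $V_{\mathbf F}=\mathbb{C}\oplus W\oplus(F^2)^*$. $M(\mathbf F)\subset\mathbb{P}V_{\mathbf F}=\mathbb{P}^{n+c}$ is the Zariski closure of the image of the rational map $\mathbb{P}(\mathbb{C}\oplus W)\dashrightarrow\mathbb{P}V_{\mathbf F}$, $[t:w]\mapsto[t^2:tw:\iota_w^2]$, where $\iota_w^2\in(F^2)^*$ is evaluation $Q\mapsto Q(w)$; in coordinates, $[t:w]\mapsto[t^2:tw_1:\cdots:tw_n:Q_1(w):\cdots:Q_c(w)]$. For a projective variety $Z\subset\mathbb{P}^N$ and a general smooth point $x\in Z$, the variety of lines $\mathcal{L}_x(Z)=\{[l]\mid x\in l\subset Z,\ l\text{ a line in }\mathbb{P}^N\}$ is regarded as a subset of $\mathbb{P}T_xZ$ by sending a line to its tangent direction at $x$. A subvariety $Z$ of dimension $d$ in $\mathbb{P}^{d+c}$ is a complete intersection (of codimension $c$) if its homogeneous vanishing ideal can be generated by $c$ elements; it is a set-theoretic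 complete intersection (of codimension $c$) if it is the intersection of $c$ hypersurfaces, i.e. $I(Z)=\operatorname{rad}((g_1,\dots,g_c))$ for some homogeneous polynomials $g_1,\dots,g_c$. Subvarieties need not be irreducible. Convention: when $c=n$, a closed subset of an $(n-1)$-dimensional projective space (such as $\mathbb{P}W$ or $\mathbb{P}T_xM(\mathbf F)$) is called a set-theoretic complete intersection of codimension $c=n$ if it is empty (dimension $-1$, codimension $n$). A sequence $a_1,\dots,a_d$ in a commutative ring $R$ is regular if $a_i$ is not a zero-divisor on $R/(a_1,\dots,a_{i-1})$ for $i=1,\dots,d$. *)

(* Defs.v *)
From HB Require Import structures.
From mathcomp Require Import all_boot all_order all_algebra.
From mathcomp Require Import complex.
From mathcomp Require Import classical_sets reals.
From mathcomp Require Import mpoly.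

Set Implicit Arguments.
Unset Strict Implicit.
Unset Printing Implicit Defensive.

Import GRing.Theory.

Local Open Scope ring_scope.
Local Open Scope classical_set_scope.

Section CommutativeAlgebra.
Variable A : comNzRingType.

Definition gen_ideal (s : seq A) : set A :=
  [set p | exists a : 'I_(size s) -> A, p = \sum_i a i * s`_i].

Definition radical (J : set A) : set A := [set p | exists k : nat, J (p ^+ k)].

(* s`_i is not a zero divisor on A / (s`_0, ..., s`_(i-1)). *)
Definition regular_sequence (s : seq A) : Prop :=
  forall (i : nat) (b : A), (i < size s)%N ->
    gen_ideal (take i s) (s`_i * b) -> gen_ideal (take i s) b.

End CommutativeAlgebra.

Definition pspace (K : fieldType) (E : vectType K) : Type :=
  {L : {vspace E} | \dim L == 1%N}.

Section ProjectiveGeometry.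
Variables (K : fieldType) (E : vectType K).

(* Sym(E^* ): 'X_i is the i-th coordinate with respect to vbasis {:E}. *)
Local Notation SymE := {mpoly K[\dim {:E}]}.

Implicit Types (p : SymE) (v : E) (x y : pspace E) (Z : set (pspace E)).

Definition peval p v : K := p.@[fun i => coord (vbasis {:E}) i v].

(* The differential of p at u, applied to v. *)
Definition pdiff p (u v : E) : K :=
  \sum_(i < \dim {:E}) peval p^`M(i) u * coord (vbasis {:E}) i v.

Definition vanishes p x : Prop := forall v, v \in sval x -> peval p v = 0.

Definition zeros (S : set SymE) : set (pspace E) :=
  [set x | forall p, S p -> vanishes p x].

Definition zclosed Z : Prop :=
  exists2 S : set SymE, (forall p, S p -> p \is homog mdeg) & Z = zeros S.

Definition zclosure (A : set (pspace E)) : set (pspace E) :=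
  [set x | forall B, zclosed B -> A `<=` B -> B x].

(* The homogeneous vanishing ideal. Since p has to vanish at every          *)
(* representative of every point of Z, over an infinite field p lies in it  *)
(* iff all the homogeneous components of p do.                              *)
Definition vanishing_ideal Z : set SymE :=
  [set p | forall x, Z x -> vanishes p x].

Definition zirreducible Z : Prop :=
  [/\ zclosed Z, Z !=set0 &
      forall A B, zclosed A -> zclosed B ->
        Z `<=` A `|` B -> Z `<=` A \/ Z `<=` B].

Definition irr_chain Z (m : nat) (Y : nat -> set (pspace E)) : Prop :=
  (forall i, (i <= m)%N -> zirreducible (Y i) /\ Y i `<=` Z) /\
  (forall i, (i < m)%N -> Y i `<` Y i.+1).

(* Krull dimension of a closed Z; the empty set has no dimension here. *)
Definition has_dim Z (d : nat) : Prop :=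
  (exists Y, irr_chain Z d Y) /\ ~ (exists Y, irr_chain Z d.+1 Y).

(* The projective space of E has dimension \dim {:E} - 1. *)
Definition has_codim Z (c : nat) : Prop :=
  exists2 d, has_dim Z d & \dim {:E} = (d + c).+1.

Definition complete_intersection (c : nat) Z : Prop :=
  [/\ zclosed Z, has_codim Z c &
      exists g : c.-tuple SymE, vanishing_ideal Z = gen_ideal g].

(* The first disjunct is the convention for c = \dim {:E}, a case which the *)
(* second one excludes.                                                     *)
Definition set_complete_intersection (c : nat) Z : Prop :=
  (c = \dim {:E} /\ Z = set0) \/
  [/\ zclosed Z, has_codim Z c &
      exists g : c.-tuple SymE,
        (forall i, tnth g i \is homog mdeg) /\
        vanishing_ideal Z = radical (gen_ideal g)].

(* T is the affine cone in E over the embedded projective tangent space. *)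
Definition affine_tangent Z x (T : {vspace E}) : Prop :=
  forall v, v \in T <->
    forall p u, vanishing_ideal Z p -> u \in sval x -> pdiff p u v = 0.

(* The notion of smoothness valid for an equidimensional Z: the local        *)
(* dimension at x is taken to be the dimension of Z.                        *)
Definition smooth_point Z x (T : {vspace E}) : Prop :=
  [/\ Z x, affine_tangent Z x T & has_dim Z (\dim T).-1].

(* T_x Z is T / x tensored with the dual of the line x, hence isomorphic to *)
(* T / x up to a scalar; T / x is represented by the complement T :\: x of  *)
(* x in T.                                                                  *)
Definition tangent_space x (T : {vspace E}) : vectType K :=
  subvs_of (T :\: sval x)%VS.

Definition is_line (U : {vspace E}) : Prop := \dim U = 2%N.

(* A line U through x has tangent direction U / x. *)
Definition tangent_direction x (T U : {vspace E})
    (D : pspace (tangent_space x T)) : Prop :=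
  U = (sval x + linfun (vsval : tangent_space x T -> E) @: sval D)%VS.

Definition variety_of_lines Z x (T : {vspace E}) :
    set (pspace (tangent_space x T)) :=
  [set D | exists U, [/\ is_line U, (sval x <= U)%VS,
     forall y, (sval y <= U)%VS -> Z y & tangent_direction U D]].

(* P holds on a dense open subset of Z. *)
Definition for_general_point Z (P : pspace E -> Prop) : Prop :=
  exists A, [/\ zclosed A, Z `<=` zclosure (Z `\` A) &
                forall x, (Z `\` A) x -> P x].

End ProjectiveGeometry.

Section SymbolSystems.
Variables (K : fieldType) (W : vectType K).

Local Notation SymW := {mpoly K[\dim {:W}]}.

(* F k is the graded component of degree k. *)
Record symbol_system2 (F : nat -> set SymW) : Prop := SymbolSystem2 {
  symbol_homog : forall k p, F k p -> p \is k.-homog;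
  symbol_zero : forall k, F k 0;
  symbol_linear : forall k (a : K) p q, F k p -> F k q -> F k (a *: p + q);
  symbol_deg0 : forall p, p \is 0.-homog -> F 0%N p;
  symbol_deg1 : forall p, p \is 1.-homog -> F 1%N p;
  symbol_deg2 : exists2 p, F 2%N p & p != 0;
  symbol_deg3 : forall k p, (3 <= k)%N -> F k p -> p = 0
}.

Definition is_basis (G : set SymW) (c : nat) (Q : c.-tuple SymW) : Prop :=
  G = [set p | exists a : 'I_c -> K, p = \sum_i a i *: tnth Q i] /\
  (forall a : 'I_c -> K, \sum_i a i *: tnth Q i = 0 -> forall i, a i = 0).

(* (F^2)^* is identified with 'rV_c through xi |-> (xi Q_1, ..., xi Q_c),   *)
(* so that evaluation of quadrics at w becomes (Q_1(w), ..., Q_c(w)).       *)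
Definition VF (c : nat) : vectType K := (K^o * W * 'rV[K]_c)%type.

Variables (c : nat) (Q : c.-tuple SymW).

Definition veronese_map (t : K) (w : W) : VF c :=
  (t ^+ 2 : K^o, t *: w, \row_i peval (tnth Q i) w).

Definition euler_symmetric : set (pspace (VF c)) :=
  zclosure [set y | exists t w, sval y = <[veronese_map t w]>%VS].

Definition base_locus : set (pspace W) :=
  [set x | forall i, vanishes (tnth Q i) x].

End SymbolSystems.

(* Main.v *)
Require Import Defs.
From HB Require Import structures.
From mathcomp Require Import all_boot all_order all_algebra.
From mathcomp Require Import complex.
From mathcomp Require Import boolp classical_sets functions cardinality reals.
From mathcomp Require Import ring lra zify.
From mathcomp Require Import mpoly.

Set Implicit Arguments.
Unset Strict Implicit.
Unset Printing Implicit Defensive.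

Import Order.TTheory GRing.Theory Num.Theory.

Local Open Scope ring_scope.
Local Open Scope classical_set_scope.


(** The variety M is the closure of the graph of w |-> (Q_1(w), ..., Q_c(w)), so its
    ideal contains the c quadrics t z_i - Q_i(x), and dim M = n is the dimension that c
    equations should leave in P(V_F).  All four conditions say that the base locus is as
    small as c equations allow.  The form of this that the proof uses is
    [transversal_forms]: there are n - c linear forms on W whose only common zero with
    Q_1, ..., Q_c is the origin.  When c = n there are no linear forms, and the base locus
    is empty.

    Suppose that such linear forms exist.  Then Q_1, ..., Q_c and the squares of the linear
    forms are n quadrics in n variables with no common zero but the origin, hence a regular
    sequence [parameters_regular]; this is (4).  In the coordinate ring of P(V_F) the
    t z_i - Q_i(x), t^2, the squares of the linear forms and the z_i^2 are likewise
    regular, so that t is a nonzerodivisor modulo the t z_i - Q_i(x).  These equations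
    define the graph after inverting t, hence they generate the ideal of M, which is (1).

    Conversely, let (1) hold.  Since the Q_i are linearly independent, no nonzero linear
    form vanishes on M, so the c independent quadrics t z_i - Q_i(x) generate the ideal of
    M by Nakayama's lemma [euler_ideal_graph_forms].  Therefore M meets the hyperplane t = 0 in
    the join of the base locus and P((F^2)^ * ), which forces the base locus to have
    codimension at least c, and general hyperplanes cut it down to nothing
    [hyperplanes_cut].  The same hyperplanes follow from (2) by its very definition.
    Finally (4) bounds the dimension of the base locus from above, because a regular
    sequence extends any family of functions that is independent on its zeros
    [regular_alg_indep]; and fewer than n - c hyperplanes cannot empty a set defined by c
    forms [common_zero].  With the Nullstellensatz this gives (2).

    For (2) and (3), the points of M with t <> 0 are dense, and the tangent
    space at the point [1 : w_0 : Q(w_0)], modulo this point, is isomorphic to W through w |-> (0, w, 2 B(w_0, w)), where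
    B is the polarization of Q.  On the line through this point in that direction
    t z_i - Q_i(x) restricts to a multiple of Q_i(w), so the lines through the point are
    given by the base locus.

    Dimension, defined by chains of irreducible closed sets, is compared with algebra on
    both sides.  A chain of length m yields m + 1 functions that are algebraically
    independent on its top member [irr_chain_alg_indep], and a nonzerodivisor can be appended
    to any family that is independent modulo it [alg_indep_rcons]; counting monomials bounds
    the number of independent functions [alg_dependent].  In the other direction, the
    absence of chains of length d allows d hyperplanes to empty the set.  The regularity of
    systems of parameters comes from depth sensitivity of the Koszul complex, compared with
    powers of the variables [koszul_acyclic].  The Nullstellensatz is proved by the
    counting argument available over an uncountable field [nullstellensatz]. *)

(** * Ideals of a polynomial ring: the ascending chain condition *)

Section Ideals.
Variable A : comNzRingType.

Record ideal (I : set A) : Prop := Ideal {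
  ideal0 : I 0;
  idealD : forall x y, I x -> I y -> I (x + y);
  idealMl : forall a x, I x -> I (a * x)
}.

Lemma idealMr I a x : ideal I -> I x -> I (x * a).
Proof. by move=> hI Ix; rewrite mulrC; apply: idealMl. Qed.

Lemma idealN I x : ideal I -> I x -> I (- x).
Proof. by move=> hI Ix; rewrite -mulN1r; apply: idealMl. Qed.

Lemma idealB I x y : ideal I -> I x -> I y -> I (x - y).
Proof. by move=> hI Ix Iy; apply: idealD => //; apply: idealN. Qed.

Lemma ideal_sum I (T : Type) (r : seq T) (P : pred T) (F : T -> A) :
  ideal I -> (forall i, P i -> I (F i)) -> I (\sum_(i <- r | P i) F i).
Proof.
move=> hI hF; elim/big_ind: _ => //; [exact: ideal0 | exact: idealD].
Qed.

Definition ideal_adjoin (I : set A) (g : A) : set A :=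
  [set p | exists a b, I a /\ p = a + g * b].

Lemma ideal_adjoinP I g : ideal I -> ideal (ideal_adjoin I g).
Proof.
move=> hI; split.
- by exists 0, 0; split; [exact: ideal0 | rewrite mulr0 addr0].
- move=> _ _ [a [b [Ia ->]]] [a' [b' [Ia' ->]]]; exists (a + a'), (b + b').
  by split; [exact: idealD | rewrite mulrDr addrACA].
- move=> u _ [a [b [Ia ->]]]; exists (u * a), (u * b).
  by split; [exact: idealMl | rewrite mulrDr mulrCA].
Qed.

Lemma ideal_adjoin_sub I g : I `<=` ideal_adjoin I g.
Proof. by move=> x Ix; exists x, 0; rewrite mulr0 addr0. Qed.

Lemma ideal_adjoin_gen I g : ideal I -> ideal_adjoin I g g.
Proof. by move=> hI; exists 0, 1; rewrite mulr1 add0r; split=> //; exact: ideal0. Qed.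

Lemma gen_ideal_ideal (s : seq A) : ideal (gen_ideal s).
Proof.
split.
- by exists (fun=> 0); rewrite big1 // => i _; rewrite mul0r.
- move=> _ _ [a ->] [b ->]; exists (fun i => a i + b i).
  by rewrite -big_split; apply: eq_bigr => i _; rewrite mulrDl.
- move=> u _ [a ->]; exists (fun i => u * a i).
  by rewrite mulr_sumr; apply: eq_bigr => i _; rewrite mulrA.
Qed.

Lemma gen_ideal_nth (s : seq A) i : (i < size s)%N -> gen_ideal s s`_i.
Proof.
move=> hi; exists (fun j => (j == Ordinal hi)%:R).
rewrite (bigD1 (Ordinal hi)) //= eqxx mul1r big1 ?addr0 // => j /negPf->.
by rewrite mul0r.
Qed.

Lemma gen_ideal_min (s : seq A) I :
  ideal I -> (forall i, (i < size s)%N -> I s`_i) -> gen_ideal s `<=` I.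
Proof.
by move=> hI hs _ [a ->]; apply: ideal_sum => // i _; apply: idealMl => //; apply: hs.
Qed.

Lemma gen_ideal_nil (x : A) : gen_ideal [::] x -> x = 0.
Proof. by move=> [a ->]; rewrite big_ord0. Qed.

Lemma gen_ideal_cat (s t : seq A) : gen_ideal s `<=` gen_ideal (s ++ t).
Proof.
apply: gen_ideal_min; first exact: gen_ideal_ideal.
move=> i hi; have -> : s`_i = (s ++ t)`_i by rewrite nth_cat hi.
by apply: gen_ideal_nth; rewrite size_cat ltn_addr.
Qed.

Lemma gen_ideal_rcons (s : seq A) g :
  gen_ideal (rcons s g) = ideal_adjoin (gen_ideal s) g.
Proof.
rewrite eqEsubset; split.
  apply: gen_ideal_min => [|i]; first exact/ideal_adjoinP/gen_ideal_ideal.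
  rewrite size_rcons ltnS leq_eqVlt nth_rcons => /orP[/eqP->|hi].
    by rewrite ltnn eqxx; apply/ideal_adjoin_gen/gen_ideal_ideal.
  by rewrite hi; apply/ideal_adjoin_sub/gen_ideal_nth.
move=> _ [a [b [ha ->]]]; apply: idealD; first exact: gen_ideal_ideal.
  by rewrite -cats1; apply: gen_ideal_cat.
apply: idealMr; first exact: gen_ideal_ideal.
have {2}-> : g = (rcons s g)`_(size s) by rewrite nth_rcons ltnn eqxx.
by apply: gen_ideal_nth; rewrite size_rcons.
Qed.

End Ideals.

(** Choosing minimizers over successive tails keeps the values nondecreasing. *)
Lemma nondecreasing_subsequence (u : nat -> nat) :
  exists2 f : nat -> nat, (forall k, (f k < f k.+1)%N) &
    forall k, (u (f k) <= u (f k.+1))%N.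
Proof.
have hmin p : exists i, (p < i)%N /\ forall j, (p < j)%N -> (u i <= u j)%N.
  have hex : exists v, `[< exists2 i, (p < i)%N & u i = v >].
    by exists (u p.+1); apply/asboolP; exists p.+1.
  case: (ex_minnP hex) => v /asboolP[k pk uk] hv; exists k; split=> // j pj.
  by rewrite uk; apply: hv; apply/asboolP; exists j.
pose nxt p := projT1 (cid (hmin p)).
have nxtP p : (p < nxt p)%N /\ forall j, (p < j)%N -> (u (nxt p) <= u j)%N.
  exact: (projT2 (cid (hmin p))).
exists (fun k => iter k nxt (nxt 0%N)) => k; first by rewrite iterS; case: (nxtP (iter k nxt (nxt 0%N))).
rewrite -!iterSr iterS; have [h1 h2] := nxtP (iter k nxt 0%N).
by apply: h2; apply: ltn_trans h1 _; rewrite -iterS [iter k.+2 _ _]iterS; case: (nxtP (iter k.+1 nxt 0%N)).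
Qed.

Lemma increasing_ltn (f : nat -> nat) :
  (forall k, (f k < f k.+1)%N) -> forall i j, (i < j)%N -> (f i < f j)%N.
Proof. by move=> h; apply: (@homo_ltn _ f (fun a b => a < b)%N) => //; exact: ltn_trans. Qed.

(** Dickson's lemma, by passing to a subsequence that is nondecreasing in one variable
    after another. *)
Lemma dickson n (m : nat -> 'X_{1..n}) :
  exists i j, (i < j)%N /\ (m i <= m j)%MM.
Proof.
suff [f f_incr hf] : exists2 f : nat -> nat, (forall k, (f k < f k.+1)%N) &
    forall i, i \in enum 'I_n -> forall k, (m (f k) i <= m (f k.+1) i)%N.
  exists (f 0%N), (f 1%N); split=> //; apply/mnm_lepP => i.
  by apply: hf; rewrite mem_enum.
elim: (enum 'I_n) => [|i s [f f_incr hf]]; first by exists id.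
have [g g_incr hg] := nondecreasing_subsequence (fun k => m (f k) i).
exists (f \o g) => [k|j] /=; first exact: increasing_ltn.
rewrite inE => /orP[/eqP->//|js] k.
have h : {homo (fun k => m (f k) j) : a b / (a <= b)%N}.
  by apply: (@homo_leq _ (fun k => m (f k) j) (fun a b => a <= b)%N) => //; [exact: leq_trans | exact: hf].
exact/h/ltnW.
Qed.

Section Noetherian.
Variables (K : fieldType) (n : nat).
Local Notation S := {mpoly K[n]}.

Lemma mlead_sub_lt (p q : S) : mlead p = mlead q -> mleadc p = mleadc q ->
  p - q != 0 -> (mlead (p - q) < mlead p)%O.
Proof.
move=> hm hc hpq; rewrite lt_neqAle; apply/andP; split; last first.
  by apply: le_trans (mleadB_le _ _) _; rewrite -hm joinxx.
apply: contraNneq hpq => h; rewrite -mleadc_eq0 h mcoeffB hc hm.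
by rewrite subrr.
Qed.

(** If no member of the family were maximal there would be a strictly
    ascending sequence of ideals; pick at each step a new element of least
    leading monomial.  By Dickson's lemma one leading monomial divides a later
    one, and subtracting a multiple produces a new element with a smaller one. *)
Lemma noetherian (F : set S -> Prop) (I0 : set S) :
  (forall I, F I -> ideal I) -> F I0 ->
  exists2 I, F I & I0 `<=` I /\ forall J, F J -> I `<=` J -> J `<=` I.
Proof.
move=> idF F0; apply: contrapT => nomax.
pose T := {I | F I /\ I0 `<=` I}.
have step (t : T) : exists t' : T, sval t `<=` sval t' /\ ~ (sval t' `<=` sval t).
  case: t => I [FI I0I] /=; apply: contrapT => h; apply: nomax; exists I => //.
  split=> // J FJ IJ; apply: contrapT => nJI; apply: h.
  by exists (exist _ J (conj FJ (subset_trans I0I IJ))).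
pose nxt t := projT1 (cid (step t)).
pose I k := sval (iter k nxt (exist _ I0 (conj F0 (@subset_refl _ I0)))).
have FI k : ideal (I k) by apply: idF; rewrite /I; case: (iter _ _ _) => J [].
have Istep k : I k `<=` I k.+1 /\ ~ (I k.+1 `<=` I k).
  by rewrite /I iterS /nxt; case: cid.
have Imono : {homo I : a b / (a <= b)%N >-> a `<=` b}.
  apply: (@homo_leq _ I (fun J J' => J `<=` J')) => [J|J2 J1 J3|k].
  - exact: subset_refl.
  - exact: subset_trans.
  - by case: (Istep k).
have newP k : exists f, [/\ I k.+1 f, ~ I k f &
    forall g, I k.+1 g -> ~ I k g -> ~ (mlead g < mlead f)%O].
  have [_ /existsNP[f /not_implyP[f1 f0]]] := Istep k.
  have [m fm] : exists m, mlead f = m by exists (mlead f).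
  elim/(well_founded_ind (@ltom_wf n)): m f fm f1 f0 => m IH f fm f1 f0.
  have [[g [g1 g0 gf]]|h] := pselect (exists g, [/\ I k.+1 g, ~ I k g & (mlead g < mlead f)%O]).
    by apply: (IH (mlead g)) g1 g0 => //; rewrite -fm.
  by exists f; split=> // g g1 g0 gf; apply: h; exists g.
pose f k := projT1 (cid (newP k)).
have fP k : [/\ I k.+1 (f k), ~ I k (f k) &
    forall g, I k.+1 g -> ~ I k g -> ~ (mlead g < mlead (f k))%O].
  exact: (projT2 (cid (newP k))).
have f_neq0 k : f k != 0.
  by apply/eqP => fk0; case: (fP k) => _ + _; apply; rewrite fk0; apply: ideal0.
have [i [j [ij le_ij]]] := dickson (fun k => mlead (f k)).
case: (fP j) => fj1 fj0 fjmin.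
pose c := mleadc (f j) / mleadc (f i).
pose h := c *: 'X_[(mlead (f j) - mlead (f i))%MM] : S.
have ci : mleadc (f i) != 0 by rewrite mleadc_eq0.
have c_neq0 : c != 0 by rewrite mulf_neq0 ?invr_eq0 ?mleadc_eq0.
have hIj : I j (h * f i).
  apply: idealMl => //; apply: (Imono i.+1 j) => //; by case: (fP i).
have h_neq0 : h != 0.
  by rewrite /h -mleadc_eq0 mleadZ // mleadXm mcoeffZ mcoeffX eqxx mulr1.
have mleadh : mlead (h * f i) = mlead (f j).
  by rewrite mleadM // /h mleadZ // mleadXm submK.
have mleadch : mleadc (h * f i) = mleadc (f j).
  rewrite mleadM // mleadcM /h mleadcZE mleadXm mcoeffX eqxx mulr1.
  by rewrite /c divfK.
have new : ~ I j (f j - h * f i).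
  by move=> /(idealD (FI j) hIj); rewrite addrC subrK.
apply: (fjmin (f j - h * f i)) => //.
  by apply: idealB => //; apply: (Imono j) hIj.
apply: mlead_sub_lt => //; apply/eqP => h0; apply: new; rewrite h0; exact: ideal0.
Qed.

End Noetherian.

(** * The Nullstellensatz over an uncountable algebraically closed field *)

(** Nested intervals: the n-th interval misses the n-th term of an enumeration,
    so the supremum of the left ends is not enumerated. *)
Lemma real_uncountable (R : realType) : ~ countable [set: R].
Proof.
move=> /countable_injP[f f_inj].
pose g k : R := xget 0 [set x | f x = k].
have gf x : g (f x) = x.
  have gfx : [set y | f y = f x] (g (f x)) by apply: xgetPex; exists x.
  by apply: f_inj => //; rewrite inE.
pose step (ab : R * R) k : R * R :=
  let m := (ab.1 + ab.2) / 2%:R in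
  if g k <= m then ((m + ab.2) / 2%:R, ab.2) else (ab.1, m).
pose ab := fix ab k := if k is k'.+1 then step (ab k') k' else (0, 1).
have ab_lt k : (ab k).1 < (ab k).2.
  elim: k => [|k IH] /=; first exact: ltr01.
  by rewrite /step; case: ifP => _ /=; rewrite ?midf_lt ?(midf_lt, IH) //=; lra.
have ab_step k : (ab k).1 <= (ab k.+1).1 /\ (ab k.+1).2 <= (ab k).2.
  by rewrite /= /step; have := ab_lt k; case: ifP => _ /= ?; split; lra.
have a_mono i j : (i <= j)%N -> (ab i).1 <= (ab j).1.
  apply: (@homo_leq _ (fun k => (ab k).1) (fun x y => x <= y)) => //.
    by move=> ???; exact: le_trans.
  by move=> k; case: (ab_step k).
have b_mono i j : (i <= j)%N -> (ab j).2 <= (ab i).2.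
  apply: (@homo_leq _ (fun k => (ab k).2) (fun x y => y <= x)) => //.
    by move=> y x z yx zy; exact: le_trans zy yx.
  by move=> k; case: (ab_step k).
have a_le_b i j : (ab i).1 <= (ab j).2.
  apply: le_trans (a_mono _ _ (leq_maxl i j)) _.
  by apply: le_trans (b_mono _ _ (leq_maxr i j)); exact: ltW.
pose L := [set (ab k).1 | k in [set: nat]].
have L_ub k : ubound L (ab k).2 by move=> _ [j _ <-].
have L0 : L !=set0 by exists (ab 0%N).1, 0%N.
pose x := sup L.
have ax k : (ab k).1 <= x.
  by apply: ub_le_sup; [exists (ab 0%N).2; exact: L_ub | exists k].
have xb k : x <= (ab k).2 by apply: ge_sup.
have := ax (f x).+1; have := xb (f x).+1; have := ab_lt (f x).
by rewrite /= /step gf; case: ifP => /= h; rewrite ?(negbT h); move: h; case: leP => //; lra.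
Qed.

Lemma complex_uncountable (R : realType) : ~ countable [set: R[i]].
Proof.
move=> /countable_injP[f f_inj]; apply: (@real_uncountable R).
apply/countable_injP; exists (fun x => f (x%:C)%C) => x y _ _ e.
have xT z : z \in [set: R[i]] by rewrite inE.
by case: (f_inj _ _ (xT _) (xT _) e).
Qed.

(** An uncountable type is not a countable union of finite fibres. *)
Lemma infinite_fiber (T : choiceType) (N : T -> nat) : ~ countable [set: T] ->
  exists k, forall m, exists2 s : m.-tuple T, uniq s & forall x, x \in s -> N x = k.
Proof.
move=> ncT; apply: contrapT => nofib; apply: ncT.
have -> : [set: T] = \bigcup_(k in [set: nat]) [set x | N x = k].
  by rewrite eqEsubset; split=> // x _; exists (N x).
apply: bigcup_countable => // k _; apply/finite_set_countable.
apply: contrapT => infk; apply: nofib; exists k => m.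
have [X Xsub mX] := @infinite_set_fset _ [set x | N x = k] m infk.
have sz : size (take m (finmap.enum_fset X)) == m by rewrite size_takel.
exists (Tuple sz) => [|x] /=; first exact/take_uniq/finmap.fset_uniq.
by move=> /mem_take xX; apply: Xsub.
Qed.

Lemma linear_dependence (K : fieldType) m (J : finType) (u : 'I_m -> J -> K) :
  (#|J| < m)%N ->
  exists2 c : 'I_m -> K, (exists i, c i != 0) & forall j, \sum_i c i * u i j = 0.
Proof.
move=> ltJm; pose U : 'M[K]_(m, #|J|) := \matrix_(i, j) u i (enum_val j).
have : kermx U != 0.
  rewrite -mxrank_eq0 mxrank_ker subn_eq0 -ltnNge.
  exact: leq_ltn_trans (rank_leq_col U) ltJm.
case/rowV0Pn => c /sub_kermxP cU c0; exists (c 0).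
  by apply: contrapT => h; move/rV0Pn: c0 => [i ci]; apply: h; exists i.
move=> j; have /rowP/(_ (enum_rank j)) := cU; rewrite !mxE => e; rewrite -[RHS]e.
by apply: eq_bigr => i _; rewrite !mxE enum_rankK.
Qed.

Section Mpoly.
Variables (A : comNzRingType) (n : nat).

Lemma mpoly_alg_ind (P : {mpoly A[n]} -> Prop) :
  (forall c, P c%:MP) -> (forall i, P 'X_i) ->
  (forall p q, P p -> P q -> P (p + q)) -> (forall p q, P p -> P q -> P (p * q)) ->
  forall p, P p.
Proof.
move=> hC hX hD hM; elim/mpolyind => [|c m p _ _ IH]; first by rewrite -mpolyC0.
apply: (hD) IH; rewrite -mul_mpolyC; apply: (hM) => //; rewrite mpolyXE_id.
elim/big_ind: _ => [| |i _]; [by rewrite -mpolyC1 | exact: hM |].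
by elim: (m i) => [|k IH]; [rewrite expr0 -mpolyC1 | rewrite exprS; apply: (hM)].
Qed.

Lemma ideal_sub_eval (I : set {mpoly A[n]}) a : ideal I ->
  (forall i, I ('X_i - (a i)%:MP)) -> forall p, I (p - p.@[a]%:MP).
Proof.
move=> hI hX; elim/mpoly_alg_ind => [c|i|p q hp hq|p q hp hq].
- by rewrite mevalC subrr; apply: ideal0.
- by rewrite mevalXU.
- by rewrite mevalD mpolyCD opprD addrACA; apply: idealD.
- have -> : p * q - (p * q).@[a]%:MP =
      p * (q - q.@[a]%:MP) + q.@[a]%:MP * (p - p.@[a]%:MP).
    by rewrite mevalM mpolyCM; ring.
  by apply: idealD => //; apply: idealMl.
Qed.

End Mpoly.

Section Nullstellensatz.
Variables (K : closedFieldType) (n : nat).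
Hypothesis K_uncountable : ~ countable [set: K].
Local Notation S := {mpoly K[n]}.

Definition prime_ideal (I : set S) : Prop :=
  [/\ ideal I, ~ I 1 & forall x y, I (x * y) -> I x \/ I y].

Lemma prime_exp P x k : prime_ideal P -> P (x ^+ k) -> P x.
Proof.
move=> [_ P1 hP]; elim: k => [|k IH]; first by rewrite expr0.
by rewrite exprS => /hP[].
Qed.

(** An ideal maximal among those avoiding the powers of g is prime; by maximality every
    x outside it becomes invertible in the localization of S / P at g. *)
Lemma maximal_avoiding_prime (I : set S) (g : S) : ideal I ->
  (forall k, ~ I (g ^+ k)) ->
  exists P, [/\ I `<=` P, prime_ideal P, ~ P g &
    forall x, ~ P x -> exists k, ideal_adjoin P x (g ^+ k)].
Proof.
move=> hI Ig.
have [|P [hP Pg] [IP Pmax]] := @noetherian K n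
    (fun J => ideal J /\ forall k, ~ J (g ^+ k)) I _ (conj hI Ig).
  by move=> J [].
have Padj x : ~ P x -> exists k, ideal_adjoin P x (g ^+ k).
  move=> Px; apply: contrapT => h; apply: Px.
  have hPx := ideal_adjoinP x hP.
  apply: (Pmax (ideal_adjoin P x)); last exact: ideal_adjoin_gen.
    by split=> // k hk; apply: h; exists k.
  exact: ideal_adjoin_sub.
exists P; split=> //; last by move=> Pg1; apply: (Pg 1%N).
split=> // [P1|x y Pxy]; first by apply: (Pg 0%N).
apply: contrapT => /not_orP[/Padj[k [a [b [Pa ek]]]] /Padj[l [a' [b' [Pa' el]]]]].
apply: (Pg (k + l)%N); rewrite exprD ek el.
have -> : (a + x * b) * (a' + y * b') =
    (a' + y * b') * a + (x * b) * a' + (b * b') * (x * y) by ring.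
by do 2?[apply: (idealD hP)]; apply: idealMl.
Qed.

Definition univ i (h : {poly K}) : S := (map_poly (@mpolyC n K) h).['X_i].

Lemma univM i : {morph univ i : p q / p * q}.
Proof. by move=> p q; rewrite /univ rmorphM hornerM. Qed.

Lemma univZ i c p : univ i (c *: p) = c *: univ i p.
Proof. by rewrite -mul_polyC univM {1}/univ map_polyC hornerC mul_mpolyC. Qed.

Lemma univ_sum i (T : Type) (r : seq T) (F : T -> {poly K}) :
  univ i (\sum_(j <- r) F j) = \sum_(j <- r) univ i (F j).
Proof. by rewrite /univ rmorph_sum horner_sum. Qed.

Lemma univXsubC i a : univ i ('X - a%:P) = 'X_i - a%:MP.
Proof.
by rewrite /univ rmorphB /= map_polyX map_polyC /= hornerD hornerN hornerX hornerC.
Qed.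

(** Over an algebraically closed field h is a product of linear factors, one of which
    lies in the prime ideal. *)
Lemma prime_univariate_root (P : set S) (h : {poly K}) i :
  prime_ideal P -> h != 0 -> P (univ i h) -> exists r, P ('X_i - r%:MP).
Proof.
move=> [hP P1 Pprime] h0; have [r hr] := closed_field_poly_normal h.
have lc0 : lead_coef h != 0 by rewrite lead_coef_eq0.
rewrite hr univZ -mul_mpolyC => /Pprime[|].
  move=> Pc; exfalso; apply: P1.
  have -> : 1 = ((lead_coef h)^-1)%:MP * (lead_coef h)%:MP :> S.
    by rewrite -mpolyCM mulVf.
  exact: idealMl.
elim: r {hr} => [|r s IH].
  by rewrite big_nil /univ rmorph1 hornerC => /P1.
rewrite big_cons univM => /Pprime[|/IH//].
by rewrite univXsubC => Pr; exists r.
Qed.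

(** Otherwise every X_i - a is a unit in the localization of S / P at g, with inverse
    u_a / g^k.  There are only countably many values for the pair of k and the degree of
    u_a, so infinitely many a share it, and enough of their u_a are linearly dependent;
    clearing denominators gives a nonzero univariate polynomial in X_i lying in P. *)
Lemma maximal_avoiding_coordinate (P : set S) (g : S) i :
  prime_ideal P -> ~ P g ->
  (forall x, ~ P x -> exists k, ideal_adjoin P x (g ^+ k)) ->
  exists a, P ('X_i - a%:MP).
Proof.
move=> Pprime Pg Padj; apply: contrapT => noroot; have [hP P1 PM] := Pprime.
have uP a : exists ku : nat * S, P (g ^+ ku.1 - ('X_i - a%:MP) * ku.2).
  have [|k [p [u [Pp e]]]] := Padj ('X_i - a%:MP).
    by move=> Pa; apply: noroot; exists a.
  by exists (k, u); rewrite /= e addrK.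
pose ku a := projT1 (cid (uP a)).
have kuP a : P (g ^+ (ku a).1 - ('X_i - a%:MP) * (ku a).2).
  exact: (projT2 (cid (uP a))).
have [N hN] := infinite_fiber (fun a => pickle ((ku a).1, msize (ku a).2)) K_uncountable.
have [s1 _ hs1] := hN 1%N; have := hs1 _ (mem_tnth ord0 s1).
set k := (ku _).1; set d := msize _ => eN.
have [s us hs] := hN #|{: 'X_{1..n < d}}|.+1.
have kud j : (ku (tnth s j)).1 = k /\ msize (ku (tnth s j)).2 = d.
  have := hs _ (mem_tnth j s); rewrite -eN => /(pcan_inj pickleK) [].
  by [].
have [c [j0 cj0] hc] := linear_dependence
  (fun j (m : 'X_{1..n < d}) => (ku (tnth s j)).2@_m) (ltnSn _).
have sum_cu : \sum_j c j *: (ku (tnth s j)).2 = 0.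
  apply/mpolyP => m; rewrite mcoeff0 raddf_sum /=.
  under eq_bigr => j _ do rewrite mcoeffZ.
  have [md|md] := ltnP (mdeg m) d; first exact: (hc (BMultinom md)).
  apply: big1 => j _; rewrite memN_msupp_eq0 ?mulr0 //.
  by apply: msize_mdeg_ge; case: (kud j) => _ ->.
(* The numerator of sum_j c_j / (X - s_j), whose value at s_j0 is c_j0 times a product
   of nonzero differences. *)
pose cof j := \prod_(l | l != j) ('X - (tnth s l)%:P) : {poly K}.
pose h := \sum_j c j *: cof j.
have h0 : h != 0.
  apply/eqP => /(congr1 (fun p => p.[tnth s j0])); rewrite horner0 horner_sum.
  rewrite (bigD1 j0) //= big1 => [|j jj0]; last first.
    rewrite hornerZ horner_prod (bigD1 j0) 1?eq_sym //= hornerXsubC subrr mul0r.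
    by rewrite mulr0.
  rewrite addr0 hornerZ horner_prod => /eqP; rewrite mulf_eq0 (negPf cj0) /=.
  rewrite prodf_seq_eq0 => /hasP[l _ /andP[lj0]]; rewrite hornerXsubC subr_eq0.
  by rewrite !(tnth_nth 0) nth_uniq ?size_tuple // => /eqP/val_inj e; rewrite e eqxx in lj0.
apply: noroot; apply: (prime_univariate_root Pprime h0).
have uh : univ i h = \sum_j c j *: univ i (cof j).
  by rewrite univ_sum; apply: eq_bigr => j _; rewrite univZ.
have ucof j : univ i (cof j) * ('X_i - (tnth s j)%:MP) =
    univ i (\prod_l ('X - (tnth s l)%:P)).
  by rewrite -univXsubC -univM [in RHS](bigD1 j) //= mulrC.
suff /PM[/(prime_exp Pprime)//|] : P (g ^+ k * univ i h) by [].
have -> : g ^+ k * univ i h = \sum_j (c j *: univ i (cof j)) *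
    (g ^+ k - ('X_i - (tnth s j)%:MP) * (ku (tnth s j)).2).
  under [RHS]eq_bigr => j _ do rewrite mulrBr -[X in _ - X]scalerAl mulrA ucof scalerAr.
  by rewrite sumrB -mulr_sumr sum_cu mulr0 subr0 -mulr_suml uh mulrC.
apply: ideal_sum => // j _; apply: idealMl => //.
by have := kuP (tnth s j); case: (kud j) => -> _.
Qed.

(** Modulo a prime P maximal among the ideals that contain I and avoid the powers of g,
    each variable is congruent to a scalar; these scalars are the coordinates of the
    point. *)
Theorem nullstellensatz (I : set S) (g : S) : ideal I ->
  (forall k, ~ I (g ^+ k)) ->
  exists2 a : 'I_n -> K, (forall p, I p -> p.@[a] = 0) & g.@[a] != 0.
Proof.
move=> hI Ig; have [P [IP Pprime Pg Padj]] := maximal_avoiding_prime hI Ig.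
have hX i := maximal_avoiding_coordinate i Pprime Pg Padj.
have [hP P1 _] := Pprime.
pose a i := projT1 (cid (hX i)).
have Pa p : P (p - p.@[a]%:MP).
  by apply: ideal_sub_eval => // i; exact: (projT2 (cid (hX i))).
exists a => [p /IP Pp|]; last first.
  by apply/eqP => ga; have := Pa g; rewrite ga mpolyC0 subr0.
apply: contrapT => /eqP pa; apply: P1.
have -> : 1 = (p.@[a])^-1%:MP * (p - (p - p.@[a]%:MP)).
  by rewrite subKr -mpolyCM mulVf.
by apply: idealMl => //; apply: idealB.
Qed.

End Nullstellensatz.

(** * The Koszul complex and systems of parameters *)

Section PairModule.
Variables (A : comNzRingType) (U V : lmodType A).

Lemma pairD (a c : U) (b d : V) : (a, b) + (c, d) = (a + c, b + d).
Proof. by []. Qed.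

Lemma pairZ (r : A) (a : U) (b : V) : r *: (a, b) = (r *: a, r *: b).
Proof. by []. Qed.

End PairModule.

Section Koszul.
Variables (A : comNzRingType) (y : nat -> A).

(** The Koszul complex of y_0, ..., y_(m-1) is the exterior algebra on e_0, ..., e_(m-1),
    built one generator at a time: the pair (a, b) stands for a + e_(m-1) /\ b.  Its
    differential kd is the derivation sending e_j to y_j, and ke j is e_j /\ _.  The
    grading is expressed by predicates rather than by types: kge i singles out the
    elements of degree at least i; kscal and kaug are the inclusion of degree 0 and the
    projection to it. *)
Fixpoint kz m : lmodType A := if m is m'.+1 then (kz m' * kz m')%type else A^o.

Lemma kz_caseP m (P : kz m.+1 -> Prop) :
  (forall a b : kz m, P (a, b)) -> forall z, P z.
Proof. by move=> h [a b]; apply: h. Qed.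

Fixpoint kd m : kz m -> kz m :=
  if m is m'.+1 then fun z => (kd z.1 + y m' *: z.2, - kd z.2) else fun=> 0.

Fixpoint ke m (j : nat) : kz m -> kz m :=
  if m is m'.+1 then fun z => if j == m' then (0, z.1) else (ke j z.1, - ke j z.2)
  else fun=> 0.

Fixpoint kge m (i : nat) : kz m -> Prop :=
  if m is m'.+1 then fun z => kge i z.1 /\ kge i.-1 z.2 else fun z => (0 < i)%N -> z = 0.

Fixpoint kin (I : set A) m : kz m -> Prop :=
  if m is m'.+1 then fun z => kin I z.1 /\ kin I z.2 else I.

Fixpoint kmap (f : A -> A) m : kz m -> kz m :=
  if m is m'.+1 then fun z => (kmap f z.1, kmap f z.2) else f.

Fixpoint kscal m (a : A) : kz m := if m is m'.+1 then (kscal m' a, 0) else a.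
Fixpoint kaug m : kz m -> A := if m is m'.+1 then fun z => kaug z.1 else id.

Lemma kdD m (u v : kz m) : kd (u + v) = kd u + kd v.
Proof.
elim: m u v => [|m IH] u v /=; first by rewrite addr0.
by rewrite !IH scalerDr opprD; congr pair; rewrite addrACA.
Qed.

Lemma kdZ m a (u : kz m) : kd (a *: u) = a *: kd u.
Proof.
elim: m u => [|m IH] u /=; first by rewrite scaler0.
by rewrite !IH; congr pair; rewrite ?scalerN // scalerDr !scalerA mulrC.
Qed.

Lemma kd0 m : kd (0 : kz m) = 0.
Proof. by have := kdZ 0 (0 : kz m); rewrite !scale0r. Qed.

Lemma kdN m (u : kz m) : kd (- u) = - kd u.
Proof. by rewrite -scaleN1r kdZ scaleN1r. Qed.

Lemma kd_sum m (T : Type) (r : seq T) (F : T -> kz m) :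
  kd (\sum_(j <- r) F j) = \sum_(j <- r) kd (F j).
Proof. by apply: (big_morph (@kd m)); [exact: kdD | exact: kd0]. Qed.

Lemma kdd m (z : kz m) : kd (kd z) = 0.
Proof.
elim: m z => [|m IH] z //=; rewrite kdD kdZ !IH kdN IH add0r scalerN subrr.
by rewrite !oppr0.
Qed.

Lemma keD m j (u v : kz m) : ke j (u + v) = ke j u + ke j v.
Proof.
elim: m u v => [|m IH] u v /=; first by rewrite addr0.
by case: ifP => _; rewrite pairD ?IH ?opprD ?addr0.
Qed.

Lemma keZ m j a (u : kz m) : ke j (a *: u) = a *: ke j u.
Proof.
elim: m u => [|m IH] u /=; first by rewrite scaler0.
by case: ifP => _; rewrite pairZ ?scaler0 // !IH scalerN.
Qed.

Lemma keN m j (u : kz m) : ke j (- u) = - ke j u.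
Proof. by rewrite -scaleN1r keZ scaleN1r. Qed.

(** Wedging with the j-th basis vector is a homotopy between multiplication by
    y_j and zero. *)
Lemma koszul_homotopy m j (z : kz m) : (j < m)%N ->
  kd (ke j z) + ke j (kd z) = y j *: z.
Proof.
elim: m z => [|m IH] //; apply: kz_caseP => a b; rewrite ltnS leq_eqVlt => /orP[/eqP->|jm] /=.
  rewrite eqxx /= kd0 pairD pairZ; congr pair; last exact: addKr.
  by rewrite add0r addr0.
have neq_jm : (j == m) = false by rewrite ltn_eqF.
rewrite neq_jm /= kdN opprK pairD pairZ /= keD keZ -!(IH _ jm).
congr pair; last by rewrite keN opprK.
by rewrite scalerN addrACA addNr addr0.
Qed.

Lemma kge0 m (z : kz m) : kge 0 z.
Proof. by elim: m z => [|m IH] z /=. Qed.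

Lemma kge_zero m i : kge i (0 : kz m).
Proof. by elim: m i => [|m IH] i /=. Qed.

Lemma kgeD m i (u v : kz m) : kge i u -> kge i v -> kge i (u + v).
Proof.
elim: m i u v => [|m IH] i u v /=.
  by move=> hu hv i0; rewrite hu // hv // addr0.
by move=> [u1 u2] [v1 v2]; split; apply: IH.
Qed.

Lemma kgeZ m i a (u : kz m) : kge i u -> kge i (a *: u).
Proof.
elim: m i u => [|m IH] i u /=; first by move=> hu i0; rewrite hu // scaler0.
by move=> [u1 u2]; split; apply: IH.
Qed.

Lemma kge_top m i (z : kz m) : (m < i)%N -> kge i z -> z = 0.
Proof.
elim: m i z => [|m IH] i z /=; first by move=> i0; apply.
by case: i => // i mi [h1 h2]; rewrite [z]surjective_pairing (IH _ _ _ h1) ?(IH _ _ _ h2) // ltnW.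
Qed.

Lemma kge_kd m i (z : kz m) : kge i.+1 z -> kge i (kd z).
Proof.
elim: m i z => [|m IH] i z //= [h1 h2]; split.
  by apply: kgeD; [exact: IH | exact: kgeZ].
case: i h2 {h1} => [_|i h2]; first exact: kge0.
by rewrite -scaleN1r; apply/kgeZ/IH.
Qed.

Lemma kge_ke m i j (z : kz m) : kge i z -> kge i.+1 (ke j z).
Proof.
elim: m i z => [|m IH] i z //= [h1 h2]; case: ifP => _ /=; first by split; [exact: kge_zero|].
split; first exact: IH.
by case: i h2 {h1} => [_|i h2]; [exact: kge0 | rewrite -scaleN1r; apply/kgeZ/IH].
Qed.

Lemma kinD I m (u v : kz m) : ideal I -> kin I u -> kin I v -> kin I (u + v).
Proof.
move=> hI; elim: m u v => [|m IH] u v /=; first exact: (idealD hI).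
by move=> [u1 u2] [v1 v2]; split; apply: IH.
Qed.

Lemma kinZ I m a (u : kz m) : ideal I -> kin I u -> kin I (a *: u).
Proof.
move=> hI; elim: m u => [|m IH] u /=; first exact: (idealMl hI).
by move=> [u1 u2]; split; apply: IH.
Qed.

Lemma kinN I m (u : kz m) : ideal I -> kin I u -> kin I (- u).
Proof. by move=> hI hu; rewrite -scaleN1r; apply: kinZ. Qed.

Lemma kin0 I m : ideal I -> kin I (0 : kz m).
Proof. by move=> hI; elim: m => [|m IH] //=; exact: (ideal0 hI). Qed.

Lemma kin_zero m (z : kz m) : kin [set 0] z -> z = 0.
Proof. by elim: m z => [|m IH] //= [a b] /= [/IH-> /IH->]. Qed.

Lemma kin_sub (I J : set A) m (z : kz m) : I `<=` J -> kin I z -> kin J z.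
Proof.
by move=> IJ; elim: m z => [|m IH] z /=; [exact: IJ | case=> h1 h2; split; apply: IH].
Qed.

Lemma kin_kd I m (z : kz m) : ideal I -> kin I z -> kin I (kd z).
Proof.
move=> hI; elim: m z => [|m IH] z /=; first by move=> _; apply: (ideal0 hI).
by move=> [h1 h2]; split; [apply: kinD => //; [exact: IH | exact: kinZ] | apply/kinN/IH].
Qed.

Lemma kin_ke I m j (z : kz m) : ideal I -> kin I z -> kin I (ke j z).
Proof.
move=> hI; elim: m z => [|m IH] z /=; first by move=> _; apply: (ideal0 hI).
move=> [h1 h2]; case: ifP => _ /=; first by split=> //; exact: kin0.
by split; [exact: IH | apply/kinN/IH].
Qed.

Lemma kaugN m (z : kz m) : kaug (- z) = - kaug z.
Proof. by elim: m z => [|m IH] z //=. Qed.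

Lemma kaugD m (u v : kz m) : kaug (u + v) = kaug u + kaug v.
Proof. by elim: m u v => [|m IH] u v //=. Qed.

Lemma kaugZ m a (u : kz m) : kaug (a *: u) = a * kaug u.
Proof. by elim: m u => [|m IH] u //=. Qed.

Lemma kaug_scal m a : kaug (kscal m a) = a.
Proof. by elim: m => [|m IH]. Qed.

Lemma kscalZ m a b : kscal m (a * b) = a *: kscal m b.
Proof. by elim: m => [|m IH] //=; rewrite IH pairZ scaler0. Qed.

Lemma kscalD m a b : kscal m (a + b) = kscal m a + kscal m b.
Proof. by elim: m => [|m IH] //=; rewrite IH pairD addr0. Qed.

Lemma kd_scal m a : kd (kscal m a) = 0.
Proof. by elim: m => [|m IH] //=; rewrite IH kd0 scaler0 addr0 oppr0. Qed.

Lemma kaug_kd m (z : kz m) : gen_ideal (mkseq y m) (kaug (kd z)).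
Proof.
elim: m z => [|m IH] z /=; first exact: (ideal0 (gen_ideal_ideal _)).
rewrite mkseqS gen_ideal_rcons kaugD kaugZ.
by exists (kaug (kd z.1)), (kaug z.2).
Qed.

Lemma gen_ideal_kd m u : gen_ideal (mkseq y m) u ->
  exists2 b : kz m, kge 1 b & kd b = kscal m u.
Proof.
elim: m u => [|m IH] u; first by move=> /gen_ideal_nil->; exists 0.
rewrite mkseqS gen_ideal_rcons.
move=> [v [a [/IH[b b1 hb] ->]]].
exists (b, kscal m a); first by split=> //; exact: kge0.
by rewrite /= hb kd_scal oppr0 kscalD kscalZ.
Qed.

(** Depth sensitivity of the Koszul complex.  Let x_0, ..., x_(m-1) be a regular
    sequence inside the ideal generated by y_0, ..., y_(m-1), and let I_k stand
    for the ideal generated by x_0, ..., x_(k-1).  Modulo I_k the Koszul homology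
    of y vanishes in degrees above k: for k = m for lack of anything in degrees
    above m, and downward from k + 1 to k because x_k kills the homology modulo
    I_k, so that a cycle times x_k bounds w with w a cycle modulo x_k. *)
Lemma koszul_acyclic m (I : nat -> set A) (x : 'I_m -> A) :
  (forall k, ideal (I k)) ->
  (forall (k : 'I_m) p, I k.+1 p -> exists r u, I k r /\ p = r + x k * u) ->
  (forall (k : 'I_m) r u, I k r -> I k.+1 (r + x k * u)) ->
  (forall (k : 'I_m) b, I k (x k * b) -> I k b) ->
  (forall k : 'I_m, gen_ideal (mkseq y m) (x k)) ->
  forall k, (k <= m)%N -> forall i (z : kz m), (k < i)%N -> kge i z ->
  kin (I k) (kd z) -> exists2 c, kge i.+1 c & kin (I k) (z - kd c).
Proof.
move=> hI Isplit Ijoin Ireg xy.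
have kinS (k : 'I_m) m' i (z : kz m') : kin (I k.+1) z -> kge i z ->
    exists r u, [/\ kin (I k) r, kge i u & z = r + x k *: u].
  elim: m' i z => [|m' IH] i z /=.
    move=> Iz; case: i => [_|i ->] //.
      by have [r [u [Ir ->]]] := Isplit k _ Iz; exists r, u.
    by exists 0, 0; split=> //; [exact: (ideal0 (hI _)) | rewrite scaler0 addr0].
  move=> [/IH h1 /IH h2] [/h1[r [u [hr hu e]]] /h2[r' [u' [hr' hu' e']]]].
  by exists (r, r'), (u, u'); split; rewrite // pairZ pairD -e -e' -surjective_pairing.
have kin_mono (k : 'I_m) m' (z : kz m') : kin (I k) z -> kin (I k.+1) z.
  by apply: kin_sub => r Ir; have := Ijoin k r 0 Ir; rewrite mulr0 addr0.
have kin_x (k : 'I_m) m' (z : kz m') : kin (I k.+1) (x k *: z).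
  elim: m' z => [|m' IH] z //=.
  by have := Ijoin k 0 z (ideal0 (hI _)); rewrite add0r.
have kin_reg (k : 'I_m) m' (z : kz m') : kin (I k) (x k *: z) -> kin (I k) z.
  elim: m' z => [|m' IH] z /=; first exact: Ireg.
  by case=> h1 h2; split; apply: IH.
move=> k km; have [d] := ubnP (m - k); elim: d k km => // d IH k km dk i z ki zi Idz.
move: km; rewrite leq_eqVlt => /orP[/eqP ekm|km].
  exists 0; first exact: kge_zero.
  rewrite kd0 subr0 (kge_top _ zi); last by rewrite -ekm.
  exact: kin0.
have [a xa] := xy (Ordinal km); pose x' := x (Ordinal km).
pose yl (j : 'I_(size (mkseq y m))) := (mkseq y m)`_j.
have ylE j : yl j = y j by rewrite /yl nth_mkseq // -[X in (_ < X)%N](size_mkseq y).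
pose h (u : kz m) := \sum_j a j *: ke j u.
have hh u : kd (h u) + h (kd u) = x' *: u.
  rewrite /h kd_sum -big_split /= /x' xa scaler_suml; apply: eq_bigr => j _.
  rewrite kdZ -scalerDr koszul_homotopy ?scalerA -?ylE //.
  by rewrite -[X in (_ < X)%N](size_mkseq y).
have hin u : kin (I k) u -> kin (I k) (h u).
  move=> Iu; rewrite /h; elim/big_ind: _ => [|u1 u2|j _].
  - exact: kin0.
  - exact: kinD.
  - by apply: kinZ => //; apply: kin_ke.
have hge u j : kge j u -> kge j.+1 (h u).
  move=> ju; rewrite /h; elim/big_ind: _ => [|u1 u2|l _].
  - exact: kge_zero.
  - exact: kgeD.
  - exact/kgeZ/kge_ke.
have Idw : kin (I k.+1) (kd (h z)).
  rewrite -(addrK (h (kd z)) (kd _)) hh; apply: kinD => //.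
    exact: (kin_x (Ordinal km)).
  by apply: kinN => //; apply: (kin_mono (Ordinal km)); apply: hin.
have [||||v hv Iwv] := IH k.+1 _ _ i.+1 (h z) _ _ Idw => //.
- by rewrite -ltnS; apply: leq_trans dk; rewrite subnS prednK // subn_gt0.
- exact: hge.
have wv_ge : kge i.+1 (h z - kd v).
  apply: kgeD; first exact: hge.
  by rewrite -scaleN1r; apply: kgeZ; apply: kge_kd.
have [r [u [Ir hu e]]] := kinS (Ordinal km) _ _ _ Iwv wv_ge.
exists u => //; apply: (kin_reg (Ordinal km)); rewrite scalerBr -/x' -hh -kdZ.
have -> : x' *: u = h z - kd v - r by rewrite e addrAC subrr add0r.
rewrite !kdD !kdN kdd subr0 opprB [X in X + _]addrC -addrA [kd r - _]addrC addNKr.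
by apply: kinD => //; [apply: hin | apply: kin_kd].
Qed.

Definition koszul_exact1 m : Prop :=
  forall z : kz m, kge 1 z -> kd z = 0 -> exists2 c, kge 2 c & z = kd c.

(** A relation putting y_m a into the ideal of y_0, ..., y_(m-1) is a cycle whose
    component at e_m is - a; the chain that it bounds puts a into that ideal. *)
Lemma koszul_exact1_regular m a : koszul_exact1 m.+1 ->
  gen_ideal (mkseq y m) (y m * a) -> gen_ideal (mkseq y m) a.
Proof.
move=> hy /gen_ideal_kd[b b1 hb].
have [||[c d] _ e] := hy (b, - kscal m a) => /=.
- by split=> //; exact: kge0.
- by rewrite hb kdN kd_scal !oppr0 kscalZ scalerN subrr.
have := congr1 snd e => /= /(congr1 (@kaug m)); rewrite !kaugN kaug_scal.
by move=> /oppr_inj->; apply: kaug_kd.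
Qed.

(** A cycle z of the smaller complex is a cycle (z, 0) of the larger one; the chain that
    it bounds shows z to be y_m times a cycle, up to a boundary.  Iterate. *)
Lemma koszul_exact1_divide m k (z : kz m) : koszul_exact1 m.+1 ->
  kge 1 z -> kd z = 0 ->
  exists c d, [/\ kge 2 c, kge 1 d, kd d = 0 & z = kd c + y m ^+ k *: d].
Proof.
move=> hy z1 dz; elim: k => [|k [c [d [c2 d1 dd e]]]].
  by exists 0, z; rewrite kd0 add0r expr0 scale1r; split=> //; exact: kge_zero.
have [||[c' d'] /= [c'2 d'1] [ed dd']] := hy (d, 0) => /=.
- by split=> //; exact: kge_zero.
- by rewrite dd kd0 scaler0 addr0 oppr0.
exists (c + y m ^+ k *: c'), d'; split=> //.
- by apply: kgeD => //; apply: kgeZ.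
- by apply/eqP; rewrite -oppr_eq0 -dd'.
- by rewrite e ed kdD kdZ scalerDr scalerA addrA -exprSr.
Qed.

End Koszul.

(** * Systems of parameters of a polynomial ring are regular sequences *)

Lemma meval_homog (A : comNzRingType) n d (p : {mpoly A[n]}) (r : A) a :
  p \is d.-homog -> p.@[fun i => r * a i] = r ^+ d * p.@[a].
Proof.
move=> /dhomogP hp; rewrite !mevalE mulr_sumr big_seq [RHS]big_seq.
apply: eq_bigr => m mp; rewrite mulrCA; congr (_ * _).
under eq_bigr => i _ do rewrite exprMn.
have -> : d = (\sum_i m i)%N by rewrite -mdegE; exact/esym/(hp m mp).
by rewrite big_split /= prodrXr.
Qed.

Section Truncation.
Variables (A : idomainType) (n : nat).
Local Notation S := {mpoly A[n]}.
Local Notation pi := (pihomog mdeg).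

Lemma pihomogM e d (q p : S) : q \is e.-homog ->
  pi d (q * p) = if (e <= d)%N then q * pi (d - e) p else 0.
Proof.
move=> qe.
have piq b : pi d (q * pi b p) = if (e + b == d)%N then q * pi b p else 0.
  have h : q * pi b p \is (e + b).-homog by apply: dhomogM => //; exact: pihomogP.
  by case: eqP => [<-|/eqP ne]; [exact: pihomog_dE | exact: pihomog_ne0 h].
have [k hk] : exists k, (msize p <= k)%N by exists (msize p).
rewrite {1}(pihomog_partitionE (mf := mdeg) (leq_trans hk (leq_maxl k d.+1))).
rewrite mulr_sumr raddf_sum /=; under eq_bigr => b _ do rewrite piq.
case: leqP => ed; last first.
  apply: big1 => b _; case: eqP => // ebd.
  by have := leq_addr b e; rewrite ebd leqNgt ed.
have lt : (d - e < maxn k d.+1)%N by rewrite leq_max ltnS leq_subr orbT.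
rewrite (bigD1 (Ordinal lt)) //= subnKC // eqxx big1 ?addr0 // => b bn.
case: eqP => // ebd; case/eqP: bn; apply: val_inj => /=.
by rewrite -(addKn e b) ebd.
Qed.

Definition trunc d (p : S) : S := \sum_(b < d) pi b p.

Lemma trunc_id d p : (msize p <= d)%N -> trunc d p = p.
Proof. by move=> h; rewrite {2}(pihomog_partitionE (mf := mdeg) h). Qed.

Lemma truncD d : {morph trunc d : p q / p + q}.
Proof. by move=> p q; rewrite /trunc -big_split; apply: eq_bigr => b _; rewrite pihomogD. Qed.

Lemma truncN d : {morph trunc d : p / - p}.
Proof. by move=> p; rewrite /trunc -sumrN; apply: eq_bigr => b _; rewrite pihomogN. Qed.

Lemma trunc0 d : trunc d 0 = 0.
Proof. by rewrite /trunc big1 // => b _; rewrite pihomog0. Qed.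

Lemma trunc_sum d (T : Type) (r : seq T) (F : T -> S) :
  trunc d (\sum_(j <- r) F j) = \sum_(j <- r) trunc d (F j).
Proof. by apply: (big_morph (trunc d)); [exact: truncD | exact: trunc0]. Qed.

Lemma truncM e d (q p : S) : q \is e.-homog -> trunc (e + d) (q * p) = q * trunc d p.
Proof.
move=> qe; rewrite /trunc big_split_ord /= big1 ?add0r => [|b _].
  rewrite mulr_sumr; apply: eq_bigr => b _.
  by rewrite (pihomogM _ _ qe) leq_addr addKn.
by rewrite (pihomogM _ _ qe) leqNgt ltn_ord.
Qed.

Lemma truncM0 e d (q p : S) : q \is e.-homog -> (d <= e)%N -> trunc d (q * p) = 0.
Proof.
move=> qe de; apply: big1 => b _; rewrite (pihomogM _ _ qe) leqNgt.
by rewrite (leq_trans (ltn_ord b) de).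
Qed.

Variable y : nat -> S.
Hypothesis y2 : forall j, y j \is 2.-homog.

Lemma kmap_trunc_kd m d (z : kz S m) :
  kmap (trunc (2 + d)) (kd y z) = kd y (kmap (trunc d) z).
Proof.
have kmapD m' b (u v : kz S m') :
    kmap (trunc b) (u + v) = kmap (trunc b) u + kmap (trunc b) v.
  by elim: m' u v => [|m' IH] u v /=; [exact: truncD | rewrite !IH pairD].
have kmapN m' b (u : kz S m') : kmap (trunc b) (- u) = - kmap (trunc b) u.
  by elim: m' u => [|m' IH] u /=; [exact: truncN | rewrite !IH].
have kmapy m' j (u : kz S m') : kmap (trunc (2 + d)) (y j *: u) = y j *: kmap (trunc d) u.
  by elim: m' u => [|m' IH] u /=; [exact: truncM | rewrite !IH].
elim: m z => [|m IH] z /=; first exact: trunc0.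
by rewrite kmapD kmapN kmapy !IH.
Qed.

Lemma kmap_trunc_ge m d i (z : kz S m) : kge i z -> kge i (kmap (trunc d) z).
Proof.
elim: m i z => [|m IH] i z /=; first by move=> h i0; rewrite h // trunc0.
by case=> h1 h2; split; apply: IH.
Qed.

Lemma kmap_trunc_id m (z : kz S m) :
  exists d0, forall d, (d0 <= d)%N -> kmap (trunc d) z = z.
Proof.
elim: m z => [|m IH] z /=; first by exists (msize (z : S)) => d; exact: trunc_id.
have [d1 h1] := IH z.1; have [d2 h2] := IH z.2.
exists (maxn d1 d2) => d; rewrite geq_max => /andP[hd1 hd2].
by rewrite h1 // h2 // -surjective_pairing.
Qed.

Lemma kmap_trunc_expr m j d k (z : kz S m) : (d <= 2 * k)%N ->
  kmap (trunc d) (y j ^+ k *: z) = 0.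
Proof.
move=> dk; have yk : y j ^+ k \is (2 * k).-homog by exact: dhomogMn.
by elim: m z => [|m IH] z /=; [exact: truncM0 yk dk | rewrite !IH].
Qed.

(** The Nakayama argument: truncating the identity z = d c + y_m^k d' below the
    degree of y_m^k leaves z equal to a boundary. *)
Lemma koszul_exact1_pred m : koszul_exact1 y m.+1 -> koszul_exact1 y m.
Proof.
move=> hy z z1 dz; have [d0 hd0] := kmap_trunc_id z.
have [c [d [c2 _ _ e]]] := koszul_exact1_divide d0.+1 hy z1 dz.
exists (kmap (trunc (2 * d0)) c); first exact: kmap_trunc_ge.
rewrite -kmap_trunc_kd; have kmapD b (u v : kz S m) :
    kmap (trunc b) (u + v) = kmap (trunc b) u + kmap (trunc b) v.
  by elim: (m) u v => [|m' IH] u v /=; [exact: truncD | rewrite !IH pairD].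
(* The degree of y_m^(d0 + 1) is 2 + 2 d0. *)
have le : (d0 <= 2 + 2 * d0)%N by lia.
rewrite -{1}(hd0 _ le) {1}e kmapD kmap_trunc_expr ?addr0 //; lia.
Qed.

Lemma koszul_exact1_regular_sequence N :
  koszul_exact1 y N -> regular_sequence (mkseq y N).
Proof.
move=> hN i b; rewrite size_mkseq => iN.
have hi : koszul_exact1 y i.+1.
  elim: (N) iN hN => // N' IH; rewrite ltnS leq_eqVlt => /orP[/eqP->//|h].
  by move/koszul_exact1_pred; apply: IH.
rewrite nth_mkseq // /mkseq -map_take take_iota (minn_idPl (ltnW iN)).
exact: koszul_exact1_regular.
Qed.

End Truncation.

Section SystemOfParameters.
Variables (K : closedFieldType) (n : nat).
Hypothesis K_uncountable : ~ countable [set: K].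
Local Notation S := {mpoly K[n]}.

(** The ideal generated by the e-th powers of the first k variables. *)
Definition power_ideal e k : set S :=
  [set p | forall m, p@_m != 0 -> exists2 j : 'I_n, (j < k)%N & (e <= m j)%N].

Lemma power_idealP e k : ideal (power_ideal e k).
Proof.
split=> [m|x y hx hy m|a x hx m]; first by rewrite mcoeff0 eqxx.
  rewrite mcoeffD => h; have [x0|/hx//] := eqVneq x@_m 0.
  by apply: hy; rewrite x0 add0r in h.
rewrite -mcoeff_msupp => /msuppM_le /allpairsP[[m1 m2] /= [_ m2x ->]].
have [|j jk ej] := hx m2; first by rewrite -mcoeff_msupp.
by exists j => //; rewrite mnmDE; apply: leq_trans ej (leq_addl _ _).
Qed.

Lemma power_ideal_regular e (k : 'I_n) b :
  power_ideal e k ('X_k ^+ e * b) -> power_ideal e k b.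
Proof.
move=> h m bm; have := h (U_(k) *+ e + m)%MM.
rewrite mpolyXn [X in X@_ _]mulrC mcoeffMX => /(_ bm) [j jk ej]; exists j => //.
move: ej; rewrite mnmDE mulmnE mnm1E eq_sym; suff -> : (j == k) = false by rewrite mul0n add0n.
by rewrite -val_eqE ltn_eqF.
Qed.

Lemma power_ideal_split e (k : 'I_n) p : power_ideal e k.+1 p ->
  exists r u, power_ideal e k r /\ p = r + 'X_k ^+ e * u.
Proof.
move=> hp; pose c (m : 'X_{1..n}) := [exists j : 'I_n, (j < k)%N && (e <= m j)%N].
exists (\sum_(m <- msupp p | c m) p@_m *: 'X_[m]).
exists (\sum_(m <- msupp p | ~~ c m) p@_m *: 'X_[m - U_(k) *+ e]); split.
  apply: ideal_sum => [|m /existsP[j /andP[jk ej]]]; first exact: power_idealP.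
  rewrite -mul_mpolyC; apply: (idealMl (power_idealP _ _)) => m'.
  by rewrite mcoeffX; case: (m =P m') => [<- _|_]; [exists j | rewrite eqxx].
rewrite {1}[p]mpolyE (bigID c) /=; congr (_ + _); rewrite mulr_sumr.
rewrite big_seq_cond [RHS]big_seq_cond; apply: eq_bigr => m /andP[mp cm].
rewrite -scalerAr; congr (_ *: _); rewrite mpolyXn -mpolyXD addmC submK //.
have [|j jk ej] := hp m; first by rewrite -mcoeff_msupp.
have ek : (e <= m k)%N.
  move: jk; rewrite ltnS leq_eqVlt => /orP[/eqP/val_inj<-//|jk].
  by case/negP: cm; apply/existsP; exists j; rewrite jk.
by apply/mnm_lepP => i; rewrite mulmnE mnm1E; case: eqP => [<-|]; rewrite ?mul1n ?mul0n.
Qed.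

(** Each variable vanishes at every common zero, so the Nullstellensatz puts a power
    of it into the ideal; the largest exponent serves all variables. *)
Lemma power_mem (s : seq S) :
  (forall a : 'I_n -> K, (forall p, p \in s -> p.@[a] = 0) -> forall i, a i = 0) ->
  exists e, forall i : 'I_n, gen_ideal s ('X_i ^+ e).
Proof.
move=> hs; have hI := gen_ideal_ideal s.
have hex (i : 'I_n) : exists e, gen_ideal s ('X_i ^+ e).
  apply: contrapT => no; have [k Ik|a ha] := nullstellensatz K_uncountable hI (g := 'X_i).
    by apply: no; exists k.
  rewrite mevalXU => /eqP; apply; apply: hs => p ps; apply: ha.
  by rewrite -(nth_index 0 ps); apply: gen_ideal_nth; rewrite index_mem.
pose e i := projT1 (cid (hex i)).
exists (\max_i e i)%N => i; rewrite -(subnK (leq_bigmax i)) exprD.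
by apply: idealMl => //; exact: (projT2 (cid (hex i))).
Qed.

(** Some power of each variable lies in the ideal generated by s, and such powers form a
    regular sequence.  By depth sensitivity the Koszul complex of s is then acyclic in
    positive degrees, which for forms of positive degree implies regularity. *)
Theorem parameters_regular (s : seq S) : size s = n ->
  (forall p, p \in s -> p \is 2.-homog) ->
  (forall a : 'I_n -> K, (forall p, p \in s -> p.@[a] = 0) -> forall i, a i = 0) ->
  regular_sequence s.
Proof.
move=> sn s2 hs; have [e he] := power_mem hs.
pose y j := s`_j; have es : s = mkseq y n.
  by rewrite -[LHS](mkseq_nth 0) sn.
have y2 j : y j \is 2.-homog.
  have [js|js] := ltnP j (size s); first by apply: s2; exact: mem_nth.
  by rewrite /y nth_default //; exact: dhomog0.
rewrite es; apply: koszul_exact1_regular_sequence => // z z1 dz.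
have [||||||||c c2 hc] := @koszul_acyclic _ y n (power_ideal e)
  (fun k => 'X_k ^+ e) _ _ _ _ _ 0%N _ 1%N z _ z1 _ => //.
- exact: power_idealP.
- exact: power_ideal_split.
- move=> k r u kr m; rewrite mcoeffD => h.
  have [r0|/kr[j jk ej]] := eqVneq r@_m 0; last by exists j => //; exact: ltnW.
  move: h; rewrite r0 add0r -mcoeff_msupp mpolyXn => /msuppM_le /allpairsP[[m1 m2] /= [h1 _ ->]].
  exists k => //; move: h1; rewrite msuppX inE => /eqP->.
  by rewrite mnmDE mulmnE mnm1E eqxx mul1n leq_addr.
- exact: power_ideal_regular.
- by move=> k; rewrite -es.
- by rewrite dz; apply: kin0; exact: power_idealP.
exists c => //; apply/eqP; rewrite -subr_eq0; apply/eqP.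
apply: kin_zero; apply: kin_sub hc => p h /=.
by apply/mpolyP => m; rewrite mcoeff0; apply/eqP; apply: contrapT => /negP /h [].
Qed.

(** Otherwise s padded with zeros would be a system of parameters, hence regular, and the
    zero polynomial would be a nonzerodivisor modulo the proper ideal generated by s. *)
Lemma common_zero (s : seq S) : (size s < n)%N ->
  (forall p, p \in s -> p \is 2.-homog) ->
  exists2 a : 'I_n -> K, (forall p, p \in s -> p.@[a] = 0) & exists i, a i != 0.
Proof.
move=> sn s2; apply: contrapT => no.
pose s' := s ++ nseq (n - size s) 0.
have sz : size s' = n by rewrite size_cat size_nseq subnKC // ltnW.
have s'2 p : p \in s' -> p \is 2.-homog.
  by rewrite mem_cat => /orP[/s2//|/nseqP[-> _]]; exact: dhomog0.
have s'0 a : (forall p, p \in s' -> p.@[a] = 0) -> forall i : 'I_n, a i = 0.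
  move=> ha i; apply/eqP; apply: contrapT => /negP ai; apply: no; exists a; last by exists i.
  by move=> p ps; apply: ha; rewrite mem_cat ps.
have := parameters_regular sz s'2 s'0 (i := size s) (b := 1).
rewrite sz take_size_cat // nth_cat ltnn subnn nth_nseq subn_gt0 sn mul0r.
move=> /(_ isT (ideal0 (gen_ideal_ideal _))) [a e1].
have := congr1 (meval (fun=> 0)) e1; rewrite meval1 rmorph_sum /= big1 => [/eqP|j _].
  by rewrite oner_eq0.
rewrite mevalM (_ : (s`_j).@[_] = 0) ?mulr0 //.
have := meval_homog 0 (fun=> 0) (s2 _ (mem_nth 0 (ltn_ord j))).
by rewrite mulr0 expr0n mul0r.
Qed.

End SystemOfParameters.

(** * Algebraic independence modulo an ideal *)

Section AlgebraicIndependence.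
Variables (K : fieldType) (n : nat).
Local Notation S := {mpoly K[n]}.

Definition alg_indep (I : set S) r (f : r.-tuple S) : Prop :=
  forall P : {mpoly K[r]}, I (P \mPo f) -> P = 0.

Lemma alg_indep_sub (I J : set S) r (f : r.-tuple S) :
  I `<=` J -> alg_indep J f -> alg_indep I f.
Proof. by move=> IJ hf P /IJ/hf. Qed.

Lemma alg_indep_nil (I : set S) (f : 0.-tuple S) :
  ideal I -> ~ I 1 -> alg_indep I f.
Proof.
move=> hI I1 P; rewrite [P]nvar0_mpolyC comp_mpolyC => Ic.
apply/eqP; rewrite mpolyC_eq0; apply: contrapT => /negP c0; apply: I1.
have -> : 1 = ((P@_0%MM)^-1)%:MP * (P@_0%MM)%:MP :> S by rewrite -mpolyCM mulVf.
exact: idealMl.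
Qed.

Lemma mwiden_max_coeff r (p : {mpoly K[r]}) (m : 'X_{1..r.+1}) :
  m ord_max != 0%N -> (mwiden p)@_m = 0.
Proof.
move=> mr; rewrite (mwidenE (leqnn _)) raddf_sum /= big1 // => k _.
rewrite mcoeffZ mcoeffX; case: eqP => [e|]; rewrite ?mulr0 //.
by rewrite -e mnmwiden_ordmax eqxx in mr.
Qed.

Lemma mpoly_split_last r (P : {mpoly K[r.+1]}) :
  exists P0 P1, P = mwiden P0 + 'X_ord_max * P1.
Proof.
elim/mpolyind: P => [|c m p _ _ [P0 [P1 ->]]].
  by exists 0, 0; rewrite mwiden0 mulr0 addr0.
have [m0|m0] := eqVneq (m ord_max) 0%N.
  pose m' := [multinom m (widen_ord (leqnSn r) i) | i < r].
  have -> : m = mnmwiden m'.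
    apply/mnmP => i; have [j ->|->] := unliftP ord_max i; last by rewrite mnmwiden_ordmax.
    have -> : lift ord_max j = widen_ord (leqnSn r) j by apply: val_inj; rewrite /= /bump leqNgt ltn_ord.
    by rewrite mnmwiden_widen mnmE.
  exists (c *: 'X_[m'] + P0), P1; by rewrite mwidenD mwidenZ mwidenX addrA.
exists P0, (c *: 'X_[m - U_(ord_max)] + P1).
rewrite mulrDr [RHS]addrCA; congr (_ + _); rewrite -scalerAr -mpolyXD addmC submK //.
by rewrite lep1mP.
Qed.

Lemma comp_mpoly_mwiden r (p : {mpoly K[r]}) (f : r.-tuple S) g :
  mwiden p \mPo [tuple of rcons f g] = p \mPo f.
Proof.
elim/mpoly_alg_ind: p => [c|i|p q hp hq|p q hp hq].
- by rewrite mwidenC !comp_mpolyC.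
- by rewrite mwidenX mnmwiden1 !comp_mpolyXU /= nth_rcons size_tuple ltn_ord.
- by rewrite mwidenD !comp_mpolyD hp hq.
- by rewrite mwidenM !rmorphM /= hp hq.
Qed.

(** Splitting off the last variable, P = P0 + X P1, the first summand vanishes
    modulo I and g, and then g cancels from the second. *)
Lemma alg_indep_rcons (I : set S) r (f : r.-tuple S) g : ideal I ->
  (forall h, I (g * h) -> I h) -> alg_indep (ideal_adjoin I g) f ->
  alg_indep I [tuple of rcons f g].
Proof.
move=> hI hg hf P.
have [d hd] : exists d, forall m, P@_m != 0 -> (m ord_max < d)%N.
  exists (msize P) => m; rewrite -mcoeff_msupp => /msize_mdeg_lt; apply: leq_ltn_trans.
  by rewrite mdegE (bigD1 ord_max) //= leq_addr.
elim: d P hd => [|d IH] P hd IP.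
  apply/mpolyP => m; rewrite mcoeff0; apply/eqP; apply: contrapT => /negP /hd.
  by rewrite ltn0.
have [P0 [P1 eP]] := mpoly_split_last P.
have eI : P \mPo [tuple of rcons f g] = P0 \mPo f + g * (P1 \mPo [tuple of rcons f g]).
  rewrite eP comp_mpolyD rmorphM /= comp_mpoly_mwiden comp_mpolyXU /=.
  by rewrite nth_rcons size_tuple ltnn eqxx.
have P00 : P0 = 0.
  apply: hf; exists (P \mPo [tuple of rcons f g]), (- (P1 \mPo [tuple of rcons f g])).
  by split=> //; rewrite eI mulrN addrK.
rewrite eI P00 comp_mpoly0 add0r in IP.
rewrite eP P00 mwiden0 add0r (IH P1) ?mulr0 //; last exact: hg.
move=> m hm; rewrite -ltnS; have := hd (U_(ord_max) + m)%MM.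
rewrite mnmDE mnm1E eqxx add1n; apply; rewrite eP mcoeffD mwiden_max_coeff.
  by rewrite add0r mulrC mcoeffMX.
by rewrite mnmDE mnm1E eqxx.
Qed.

Lemma msize_prod_leq r (f : 'I_r -> S) (a : 'I_r -> nat) d :
  (forall i, (msize (f i) <= d.+1)%N) ->
  (msize (\prod_i f i ^+ a i) <= (d * \sum_i a i).+1)%N.
Proof.
move=> hf; have mulP (p q : S) b c : (msize p <= b.+1 -> msize q <= c.+1 ->
    msize (p * q) <= (b + c).+1)%N.
  move=> hp hq; have [->|p0] := eqVneq p 0; first by rewrite mul0r msize0.
  have [->|q0] := eqVneq q 0; first by rewrite mulr0 msize0.
  by rewrite msizeM //; move: (msize p) (msize q) hp hq => x z; lia.
rewrite big_distrr /=; elim/big_rec2: _ => [|i b p _ hp]; first by rewrite msize1.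
apply: (mulP) => //; elim: (a i) => [|k IH]; first by rewrite expr0 msize1.
by rewrite exprS mulnS; apply: (mulP).
Qed.

(** The products of powers below k of r > n polynomials of degree at most d lie in
    a space of dimension of order k^n, but there are k^r of them. *)
Theorem alg_dependent r (f : r.-tuple S) : (n < r)%N ->
  exists2 P : {mpoly K[r]}, P != 0 & P \mPo f = 0.
Proof.
move=> ltnr; pose d := \max_i msize (tnth f i).
have fd i : (msize (tnth f i) <= d.+1)%N by rewrite leqW // /d (leq_bigmax i).
pose c := (d * r).+1; pose k := (c ^ n).+1; pose e := (d * (r * k))%N.
pose I := {ffun 'I_r -> 'I_k}; pose J := {ffun 'I_n -> 'I_e.+1}.
pose mon (a : I) := [multinom (a i : nat) | i < r].
have mon_inj : injective mon.
  move=> a b /mnmP eab; apply/ffunP => i; apply: val_inj.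
  by have := eab i; rewrite !mnmE.
(* k^r >= k^(n + 1) > c^n k^n >= (e + 1)^n, the number of monomials of degree at most e
   in each variable. *)
have ltJI : (#|J| < #|I|)%N.
  rewrite !card_ffun !card_ord.
  apply: (@leq_trans (k ^ n.+1)); last by rewrite leq_pexp2l.
  rewrite expnS.
  have h : (e.+1 ^ n <= c ^ n * k ^ n)%N.
    have le_ck : (e.+1 <= c * k)%N by rewrite /c /e; nia.
    by rewrite -expnMn; elim: (n) => // l IH; rewrite !expnS leq_mul.
  by apply: leq_ltn_trans h _; rewrite ltn_pmul2r ?expn_gt0.
have [x [i0 xi0] hx] := linear_dependence
  (fun (i : 'I_#|I|) (b : J) => ('X_[mon (enum_val i)] \mPo f)@_[multinom (b j : nat) | j < n]) ltJI.
exists (\sum_i x i *: 'X_[mon (enum_val i)]).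
  apply/eqP => /mpolyP/(_ (mon (enum_val i0))); rewrite mcoeff0 raddf_sum /=.
  rewrite (bigD1 i0) //= mcoeffZ mcoeffX eqxx mulr1 big1 ?addr0; first exact/eqP.
  move=> i ii0; rewrite mcoeffZ mcoeffX; case: eqP => [/mon_inj/enum_val_inj e'|].
    by rewrite e' eqxx in ii0.
  by rewrite mulr0.
have -> : (\sum_i x i *: 'X_[mon (enum_val i)]) \mPo f =
    \sum_i x i *: ('X_[mon (enum_val i)] \mPo f).
  by rewrite raddf_sum /=; apply: eq_bigr => i _; rewrite comp_mpolyZ.
apply/mpolyP => m; rewrite mcoeff0 raddf_sum /=.
have [/forallP hm|/forallPn[j hj]] := boolP [forall j, (m j <= e)%N].
  rewrite -[RHS](hx [ffun j => inord (m j)]); apply: eq_bigr => i _.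
  rewrite mcoeffZ; congr (_ * _@_ _); apply/mnmP => j.
  by rewrite mnmE ffunE inordK // ltnS.
apply: big1 => i _; rewrite mcoeffZ memN_msupp_eq0 ?mulr0 //.
apply: msize_mdeg_ge; rewrite comp_mpolyX.
apply: leq_trans (msize_prod_leq _ fd) _.
apply: (@leq_trans (m j)); last by rewrite mdegE (bigD1 j) //= leq_addr.
move: hj; rewrite -ltnNge; apply: leq_trans; rewrite ltnS /e leq_mul2l; apply/orP; right.
apply: (@leq_trans (\sum_(l < r) k)); last by rewrite sum_nat_const card_ord.
by apply: leq_sum => l _; rewrite mnmE ltnW.
Qed.

End AlgebraicIndependence.

Lemma comp_mpolyA (K : fieldType) n k r (P : {mpoly K[r]}) (f : r.-tuple {mpoly K[n]})
    (G : n.-tuple {mpoly K[k]}) :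
  (P \mPo f) \mPo G = P \mPo [tuple tnth f i \mPo G | i < r].
Proof.
elim/mpoly_alg_ind: P => [a|i|p q hp hq|p q hp hq].
- by rewrite !comp_mpolyC.
- by rewrite !comp_mpolyXU -!tnth_nth tnth_mktuple.
- by rewrite !comp_mpolyD hp hq.
- by rewrite !rmorphM /= hp hq.
Qed.

(** Functions on a variety parametrized by k variables pull back to polynomials in k
    variables. *)
Lemma alg_indep_kernel (K : fieldType) n k r (G : n.-tuple {mpoly K[k]})
    (f : r.-tuple {mpoly K[n]}) :
  alg_indep [set p | p \mPo G = 0] f -> (r <= k)%N.
Proof.
move=> hf; rewrite leqNgt; apply/negP => lt.
have [P P0 hP] := alg_dependent [tuple tnth f i \mPo G | i < r] lt.
by case/eqP: P0; apply: hf; rewrite /= comp_mpolyA.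
Qed.

(** A regular sequence can be appended to any family that is independent modulo the
    ideal it generates. *)
Lemma regular_alg_indep (K : fieldType) n (s : seq {mpoly K[n]}) r
    (f : r.-tuple {mpoly K[n]}) :
  regular_sequence s -> alg_indep (gen_ideal s) f -> (r + size s <= n)%N.
Proof.
move=> reg hf.
suff [f' hf'] : exists f' : (r + size s).-tuple {mpoly K[n]}, alg_indep [set 0] f'.
  apply: (@alg_indep_kernel K n n _ [tuple 'X_i | i < n] f').
  by apply: alg_indep_sub hf' => p /=; rewrite comp_mpoly_id.
suff H k : (k <= size s)%N -> exists f' : (r + k).-tuple {mpoly K[n]},
    alg_indep (gen_ideal (take (size s - k) s)) f'.
  have [f' hf'] := H _ (leqnn _); exists f'; apply: alg_indep_sub hf' => _ ->.
  exact: (ideal0 (gen_ideal_ideal _)).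
elim: k => [|k IH] ks.
  by rewrite addn0 subn0 take_size; exists f.
have [f' hf'] := IH (ltnW ks); rewrite addnS.
have lt : (size s - k.+1 < size s)%N by lia.
exists [tuple of rcons f' s`_(size s - k.+1)]; apply: alg_indep_rcons.
- exact: gen_ideal_ideal.
- by move=> h; apply: reg.
- by rewrite -gen_ideal_rcons -take_nth // subnSK.
Qed.

(** * Closed subsets of projective space and their dimension *)

Section Projective.
Variables (K : closedFieldType) (E : vectType K).
Hypothesis K_uncountable : ~ countable [set: K].
Local Notation SymE := {mpoly K[\dim {:E}]}.
Local Notation crd v := (fun i => coord (vbasis {:E}) i v).
Implicit Types (p q : SymE) (u v : E) (x : pspace E) (Z Y : set (pspace E)).

Lemma meval_eq0 n (p : {mpoly K[n]}) : (forall a, p.@[a] = 0) -> p = 0.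
Proof.
move=> hp; apply/eqP; apply: contrapT => /negP p0.
have I0 : ideal [set 0 : {mpoly K[n]}].
  by split=> //= [x y -> ->|a x ->]; rewrite ?addr0 ?mulr0.
have [|a _] := nullstellensatz K_uncountable I0 (g := p).
  by move=> k /= /eqP; rewrite expf_eq0 (negPf p0) andbF.
by rewrite hp eqxx.
Qed.

Lemma crd_surj (a : 'I_(\dim {:E}) -> K) : exists v, forall i, crd v i = a i.
Proof.
exists (\sum_i a i *: (vbasis {:E})`_i) => i.
exact: (coord_sum_free a i (basis_free (vbasisP _))).
Qed.

Lemma peval_eq0 p : (forall v, peval p v = 0) -> p = 0.
Proof.
move=> hp; apply: meval_eq0 => a; have [v hv] := crd_surj a.
by rewrite -(hp v); apply: meval_eq => i; rewrite hv.
Qed.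

Lemma pevalD p q v : peval (p + q) v = peval p v + peval q v.
Proof. exact: mevalD. Qed.

Lemma pevalB p q v : peval (p - q) v = peval p v - peval q v.
Proof. exact: mevalB. Qed.

Lemma pevalM p q v : peval (p * q) v = peval p v * peval q v.
Proof. exact: mevalM. Qed.

Lemma pevalZ a p v : peval (a *: p) v = a * peval p v.
Proof. exact: mevalZ. Qed.

Lemma pevalX p k v : peval (p ^+ k) v = peval p v ^+ k.
Proof. exact: rmorphXn. Qed.

Lemma peval_sum (I : Type) (r : seq I) (F : I -> SymE) v :
  peval (\sum_(i <- r) F i) v = \sum_(i <- r) peval (F i) v.
Proof. exact: raddf_sum. Qed.

Lemma peval_homog d p r v : p \is d.-homog -> peval p (r *: v) = r ^+ d * peval p v.
Proof.
by move=> pd; rewrite /peval -(meval_homog _ _ pd); apply: meval_eq => i; rewrite linearZ.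
Qed.

Lemma peval0 d p : p \is d.+1.-homog -> peval p 0 = 0.
Proof. by move=> pd; rewrite -(scale0r 0) (peval_homog _ _ pd) expr0n mul0r. Qed.

Definition lform (l : E -> K) : SymE := \sum_(i < \dim {:E}) l (vbasis {:E})`_i *: 'X_i.

Lemma lform_homog l : lform l \is 1.-homog.
Proof.
by apply: rpred_sum => i _; apply: rpredZ; rewrite dhomogX /= mdeg1.
Qed.

Lemma peval_lform (l : E -> K) v : (forall a u w, l (a *: u + w) = a * l u + l w) ->
  peval (lform l) v = l v.
Proof.
move=> hl; rewrite /peval /lform raddf_sum /= {2}(coord_vbasis (memvf v)).
have l0 : l 0 = 0 by have := hl (-1) 0 0; rewrite scaler0 addr0 mulN1r addNr.
rewrite (big_morph l (id1 := 0) (op1 := +%R)) // => [|u w]; last first.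
  by rewrite -{1}[u]scale1r hl mul1r.
apply: eq_bigr => i _; rewrite mevalZ mevalXU -[_ *: _ in RHS]addr0 hl l0 addr0.
by rewrite mulrC.
Qed.

Lemma peval_linear p a u v : p \is 1.-homog ->
  peval p (a *: u + v) = a * peval p u + peval p v.
Proof.
move=> p1; have ep w : peval p w = \sum_(m <- msupp p) p@_m *
    \sum_(i | m == U_(i)%MM) crd w i.
  rewrite /peval mevalE; apply: eq_big_seq => m mp; congr (_ * _).
  have /dhomogP/(_ m mp)/eqP/mdeg1P[j /eqP->] := p1.
  rewrite (bigD1 j) //= mnm1E eqxx expr1 big1 ?mulr1 => [|i ij].
    by rewrite (eq_bigl (pred1 j)) ?big_pred1_eq // => i; rewrite /= eq_mnm1 eq_sym.
  by rewrite mnm1E eq_sym (negPf ij) expr0.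
rewrite !ep mulr_sumr -big_split; apply: eq_bigr => m _ /=.
rewrite [X in _ = X + _]mulrCA -mulrDr; congr (_ * _); rewrite mulr_sumr -big_split /=.
by apply: eq_bigr => i _; rewrite linearP.
Qed.

Lemma exists_lform v : v != 0 -> exists2 q, q \is 1.-homog & peval q v != 0.
Proof.
move=> v0; have [i vi] : exists i, crd v i != 0.
  apply: contrapT => h; case/eqP: v0; rewrite (coord_vbasis (memvf v)) big1 // => i _.
  have [->|vi] := eqVneq (crd v i) 0; first by rewrite scale0r.
  by case: h; exists i.
by exists 'X_i; [rewrite dhomogX /= mdeg1 | rewrite /peval mevalXU].
Qed.

Lemma poly_nonroot (h : {poly K}) : h != 0 -> exists r, h.[r] != 0.
Proof. by move=> h0; have /closed_nonrootP[r] := h0; exists r. Qed.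

Lemma poly_eq0 (h : {poly K}) : (forall r, h.[r] = 0) -> h = 0.
Proof.
move=> hr; apply/eqP; apply: contrapT => /negP/poly_nonroot[r].
by rewrite hr eqxx.
Qed.

(** If the form q found for the tail vanishes at v, replace it by q + r q' with q' not
    vanishing at v; only finitely many r are bad. *)
Lemma exists_lform_seq (s : seq E) : (forall v, v \in s -> v != 0) ->
  exists2 q, q \is 1.-homog & forall v, v \in s -> peval q v != 0.
Proof.
elim: s => [|v s IH] hs; first by exists 0 => //; exact: dhomog0.
have [|q q1 hq] := IH; first by move=> u us; apply: hs; rewrite inE us orbT.
have [q' q'1 hq'] := exists_lform (hs v (mem_head _ _)).
have [qv|qv] := eqVneq (peval q v) 0; last first.
  by exists q => // u; rewrite inE => /orP[/eqP->//|]; exact: hq.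
pose h : {poly K} := 'X * \prod_(u <- s) ((peval q u)%:P + (peval q' u) *: 'X).
have [|r] := @poly_nonroot h.
  rewrite mulf_neq0 ?polyX_eq0 // prodf_seq_neq0; apply/allP => u us /=.
  apply/eqP => /(congr1 (fun h => h.[0])); rewrite !hornerE => /eqP.
  by rewrite (negPf (hq u us)).
rewrite hornerM hornerX horner_prod mulf_eq0 negb_or prodf_seq_neq0 => /andP[r0 /allP hr].
exists (q + r *: q') => [|u]; first by rewrite rpredD // rpredZ.
rewrite inE pevalD pevalZ => /orP[/eqP->|us]; first by rewrite qv add0r mulf_neq0.
by have := hr u us; rewrite /= !hornerE mulrC.
Qed.

Lemma dim_vline1 v : v != 0 -> \dim <[v]> == 1%N.
Proof. by move=> v0; rewrite dim_vline v0. Qed.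

Definition ppoint v (v0 : v != 0) : pspace E := exist _ <[v]>%VS (dim_vline1 v0).

Lemma pspaceP x : exists v (v0 : v != 0), x = ppoint v0.
Proof.
case: x => U dU; have v0 : vpick U != 0.
  by rewrite vpick0; apply: contraTneq dU => ->; rewrite dimv0.
exists (vpick U), v0; apply: val_inj => /=; apply/esym/eqP.
by rewrite eqEdim -memvE memv_pick dim_vline v0 (eqP dU).
Qed.

Lemma pspace_eq x v (v0 : v != 0) : sval x = <[v]>%VS -> x = ppoint v0.
Proof. by move=> e; apply: val_inj. Qed.

Lemma vanishesP p v (v0 : v != 0) :
  vanishes p (ppoint v0) <-> forall r, peval p (r *: v) = 0.
Proof.
split=> [h r|h u /vlineP[r ->]//]; apply: h => /=.
exact: (memvZ _ (memv_line v)).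
Qed.

Lemma vanishes_homog d p v (v0 : v != 0) : p \is d.-homog -> peval p v = 0 ->
  vanishes p (ppoint v0).
Proof. by move=> pd pv; apply/vanishesP => r; rewrite (peval_homog _ _ pd) pv mulr0. Qed.

Lemma vanishes_peval p v (v0 : v != 0) : vanishes p (ppoint v0) -> peval p v = 0.
Proof. by move/vanishesP/(_ 1); rewrite scale1r. Qed.

(** The homogeneous components of p are read off from its restrictions to lines through
    the origin. *)
Lemma line_poly p v : exists h : {poly K}, (forall r, h.[r] = peval p (r *: v)) /\
  forall d, h`_d = peval (pihomog mdeg d p) v.
Proof.
exists (\poly_(d < msize p) peval (pihomog mdeg d p) v); split=> [r|d].
  rewrite horner_poly [in RHS](pihomog_partitionE (mf := mdeg) (leqnn (msize p))) peval_sum.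
  by apply: eq_bigr => d _; rewrite (peval_homog _ _ (pihomogP _ _ _)) mulrC.
rewrite coef_poly; case: ltnP => // hd.
have -> : pihomog mdeg d p = 0; last by rewrite /peval meval0.
rewrite pihomogE big_seq_cond big1 // => m /andP[/msize_mdeg_lt mp /eqP md].
by move: mp; rewrite md ltnNge hd.
Qed.

Lemma homog_peval d p : (forall r v, peval p (r *: v) = r ^+ d * peval p v) ->
  p \is d.-homog.
Proof.
move=> hp; suff -> : p = pihomog mdeg d p by exact: pihomogP.
apply/eqP; rewrite -subr_eq0; apply/eqP/peval_eq0 => v.
have [h [hr hd]] := line_poly p v; rewrite pevalB -hd.
have -> : h = (peval p v) *: 'X^d.
  by apply/eqP; rewrite -subr_eq0; apply/eqP/poly_eq0 => r;
    rewrite !hornerE hr hp mulrC subrr.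
by rewrite coefZ coefXn eqxx mulr1 subrr.
Qed.

Lemma vanishes_pihomog p x d : vanishes p x -> vanishes (pihomog mdeg d p) x.
Proof.
have [v [v0 ->]] := pspaceP x; move/vanishesP => h.
apply: vanishes_homog (pihomogP _ _ _) _.
have [g [gr gd]] := line_poly p v; rewrite -gd (_ : g = 0) ?coef0 //.
by apply: poly_eq0 => r; rewrite gr.
Qed.

Lemma vanishes_partition p x :
  (forall d, vanishes (pihomog mdeg d p) x) -> vanishes p x.
Proof.
move=> h v vx; rewrite (pihomog_partitionE (mf := mdeg) (leqnn (msize p))) peval_sum.
by apply: big1 => d _; apply: h.
Qed.

Lemma vanishesM p q x : vanishes (p * q) x -> vanishes p x \/ vanishes q x.
Proof.
have [v [v0 ->]] := pspaceP x; move/vanishesP => h.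
have [f [fr _]] := line_poly p v; have [g [gr _]] := line_poly q v.
have : f * g = 0 by apply: poly_eq0 => r; rewrite hornerM fr gr -pevalM.
by move/eqP; rewrite mulf_eq0 => /orP[]/eqP e; [left|right];
  apply/vanishesP => r; rewrite -?fr -?gr e horner0.
Qed.

Lemma vanishing_idealP Z : ideal (vanishing_ideal Z).
Proof.
split=> [x _ v _|p q hp hq x Zx v vx|a p hp x Zx v vx].
- exact: meval0.
- by rewrite pevalD (hp x Zx) // (hq x Zx) // addr0.
- by rewrite pevalM (hp x Zx) // mulr0.
Qed.

Lemma vanishing_ideal_sub Y Z : Y `<=` Z -> vanishing_ideal Z `<=` vanishing_ideal Y.
Proof. by move=> YZ p hp x /YZ/hp. Qed.

Lemma vanishing_ideal_at0 Z p : Z !=set0 -> vanishing_ideal Z p -> peval p 0 = 0.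
Proof. by move=> [x Zx] /(_ x Zx) h; apply: h; exact: mem0v. Qed.

Lemma zclosed_zeros (S : set SymE) : zclosed (zeros S).
Proof.
exists [set q | exists p d, S p /\ q = pihomog mdeg d p].
  by move=> _ [p [d [_ ->]]]; apply: homogE (pihomogP _ _ _).
rewrite eqEsubset; split=> x hx.
  by move=> _ [p [d [Sp ->]]]; apply: vanishes_pihomog; exact: hx.
by move=> p Sp; apply: vanishes_partition => d; apply: hx; exists p, d.
Qed.

Lemma zclosedE Z : zclosed Z -> Z = zeros (vanishing_ideal Z).
Proof.
move=> [S _ ->]; rewrite eqEsubset; split=> x hx p hp; first exact: hp.
by apply: hx => y hy; exact: hy.
Qed.

Lemma zclosureE Z : zclosure Z = zeros (vanishing_ideal Z).
Proof.
rewrite eqEsubset; split=> x hx.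
  by apply: hx => [|y Zy p hp]; [exact: zclosed_zeros | exact: hp].
move=> _ [S _ ->] ZS p Sp; apply: hx => y Zy.
exact: ZS.
Qed.

Lemma zclosed_zclosure Z : zclosed (zclosure Z).
Proof. by rewrite zclosureE; exact: zclosed_zeros. Qed.

Lemma sub_zclosure Z : Z `<=` zclosure Z.
Proof. by move=> x Zx B _; exact. Qed.

Lemma zclosure_min Z B : zclosed B -> Z `<=` B -> zclosure Z `<=` B.
Proof. by move=> hB ZB x; apply. Qed.

Lemma vanishing_ideal_zclosure Z : vanishing_ideal (zclosure Z) = vanishing_ideal Z.
Proof.
rewrite eqEsubset; split; first exact: (vanishing_ideal_sub (@sub_zclosure Z)).
by move=> p hp x; rewrite zclosureE; apply.
Qed.

Lemma zclosedI (A B : set (pspace E)) : zclosed A -> zclosed B -> zclosed (A `&` B).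
Proof.
move=> /zclosedE-> /zclosedE->.
set S := vanishing_ideal A; set T := vanishing_ideal B.
suff -> : zeros S `&` zeros T = zeros (S `|` T) by exact: zclosed_zeros.
rewrite eqEsubset; split=> x; first by case=> h1 h2 p [/h1|/h2].
by move=> h; split=> p hp; apply: h; [left|right].
Qed.

Lemma zirreducible_zclosure Z : Z !=set0 ->
  (forall p q, (forall x, Z x -> vanishes p x \/ vanishes q x) ->
     vanishing_ideal Z p \/ vanishing_ideal Z q) -> zirreducible (zclosure Z).
Proof.
move=> Z0 hZ; split; first exact: zclosed_zclosure.
  by have [x Zx] := Z0; exists x; apply: sub_zclosure.
move=> _ _ [S _ ->] [T _ ->] hAB; apply: contrapT => /not_orP[nS nT].
have [p Sp np] : exists2 p, S p & ~ vanishing_ideal Z p.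
  apply: contrapT => h; apply: nS; apply: zclosure_min; first exact: zclosed_zeros.
  move=> x Zx p Sp; apply: contrapT => np; apply: h; exists p => // hp.
  by apply: np; exact: hp.
have [q Tq nq] : exists2 q, T q & ~ vanishing_ideal Z q.
  apply: contrapT => h; apply: nT; apply: zclosure_min; first exact: zclosed_zeros.
  move=> x Zx q Tq; apply: contrapT => nq; apply: h; exists q => // hq.
  by apply: nq; exact: hq.
have [x /sub_zclosure/hAB[hS|hT]|//|//] := hZ p q _; [left|right].
  exact: hS.
exact: hT.
Qed.

Lemma zirreducible_point x : zirreducible (zclosure [set x]).
Proof.
apply: zirreducible_zclosure; first by exists x.
by move=> p q /(_ x erefl)[h|h]; [left|right] => _ ->.
Qed.

Lemma zirreducible_prime Y p q : zirreducible Y ->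
  vanishing_ideal Y (p * q) -> vanishing_ideal Y p \/ vanishing_ideal Y q.
Proof.
move=> [_ _ hY] hpq.
have [|h|h] := hY _ _ (zclosed_zeros [set p]) (zclosed_zeros [set q]).
- by move=> x /hpq/vanishesM[h|h]; [left|right] => _ ->.
- by left=> x /h; apply.
- by right=> x /h; apply.
Qed.

(** Each step of a chain Y_0 < ... < Y_m contributes a polynomial vanishing on
    Y_(i-1) but not on Y_i, hence a nonzerodivisor on Y_i; a linear form that does not
    vanish at a point of Y_0 starts the family. *)
Lemma irr_chain_alg_indep Z m (Y : nat -> set (pspace E)) : irr_chain Z m Y ->
  exists f : m.+1.-tuple SymE, alg_indep (vanishing_ideal (Y m)) f.
Proof.
elim: m => [|m IH] [hirr hincr].
  have [irr0 _] := hirr 0%N isT; have [_ [x Yx] _] := irr0.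
  have [v [v0 ex]] := pspaceP x; have [q q1 qv] := exists_lform v0.
  exists [tuple of rcons [tuple] q]; apply: alg_indep_rcons.
  - exact: vanishing_idealP.
  - move=> h /(zirreducible_prime irr0)[/(_ x Yx)|//].
    by rewrite ex => /vanishes_peval e; rewrite e eqxx in qv.
  - apply: alg_indep_nil; first exact/ideal_adjoinP/vanishing_idealP.
    move=> [a [b [ha e]]]; have := congr1 (fun p => peval p 0) e.
    rewrite pevalD pevalM (peval0 q1) mul0r addr0 (vanishing_ideal_at0 _ ha); last by exists x.
    by rewrite /peval meval1 => /eqP; rewrite oner_eq0.
have [|f hf] := IH.
  by split=> i im; [exact/hirr/leqW | exact/hincr/leqW].
have [irr1 _] := hirr m.+1 (leqnn _); have [irr0 _] := hirr m (leqnSn _).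
have [sub nsub] := hincr m (leqnn _).
have [g hg ng] : exists2 g, vanishing_ideal (Y m) g & ~ vanishing_ideal (Y m.+1) g.
  apply: contrapT => h; apply: nsub; have [c0 _ _] := irr0; have [c1 _ _] := irr1.
  rewrite (zclosedE c0) (zclosedE c1) => x hx p hp; apply: hx.
  by apply: contrapT => np; apply: h; exists p.
exists [tuple of rcons f g]; apply: alg_indep_rcons.
- exact: vanishing_idealP.
- by move=> h /(zirreducible_prime irr1)[].
- apply: alg_indep_sub hf => _ [a [b [ha ->]]].
  apply: (idealD (vanishing_idealP _)); first exact: vanishing_ideal_sub ha.
  exact: (idealMr _ (vanishing_idealP _)).
Qed.

(** One point on each irreducible component of Z, found by noetherian induction: if Z
    is reducible, it is the union of two smaller closed sets. *)
Lemma finite_component_points Z : zclosed Z ->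
  exists2 s : seq E, (forall v, v \in s -> v != 0) &
    forall Y, zirreducible Y -> Y `<=` Z ->
    exists Y' v (v0 : v != 0),
      [/\ zirreducible Y', Y `<=` Y', Y' `<=` Z, v \in s & Y' (ppoint v0)].
Proof.
pose C Z := exists2 s : seq E, (forall v, v \in s -> v != 0) &
    forall Y, zirreducible Y -> Y `<=` Z ->
    exists Y' v (v0 : v != 0),
      [/\ zirreducible Y', Y `<=` Y', Y' `<=` Z, v \in s & Y' (ppoint v0)].
rewrite -/(C Z) => cZ; apply: contrapT => nC.
have [||_ [Z' [cZ' nC' ->]] [_ hmax]] := @noetherian K _
    (fun J => exists Z, [/\ zclosed Z, ~ C Z & J = vanishing_ideal Z]) (vanishing_ideal Z).
- by move=> _ [Z' [_ _ ->]]; exact: vanishing_idealP.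
- by exists Z.
have [Z0|Z0] := pselect (Z' !=set0); last first.
  apply: nC'; exists [::] => // Y [_ [x Yx] _] YZ; exfalso; apply: Z0.
  by exists x; apply: YZ.
have [irr|] := pselect (zirreducible Z').
  have [x Zx] := Z0; have [v [v0 ex]] := pspaceP x.
  apply: nC'; exists [:: v] => [u|Y hY YZ]; first by rewrite inE => /eqP->.
  by exists Z', v, v0; split=> //; rewrite ?inE // -ex.
apply: contra_notP => _; split=> // A B cA cB hAB; apply: contrapT => /not_orP[nA nB].
have sub D : zclosed D -> ~ (Z' `<=` D) -> C (Z' `&` D).
  move=> cD nD; apply: contrapT => nC''; apply: nD.
  have cZD := zclosedI cZ' cD.
  have h : vanishing_ideal (Z' `&` D) `<=` vanishing_ideal Z'.
    by apply: hmax; [exists (Z' `&` D) | apply: vanishing_ideal_sub => x []].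
  rewrite {1}(zclosedE cZ') => x hx.
  suff : (Z' `&` D) x by case.
  by rewrite (zclosedE cZD) => p /h; exact: hx.
have [s s0 hs] := sub A cA nA; have [t t0 ht] := sub B cB nB.
apply: nC'; exists (s ++ t) => [v|Y hY YZ].
  by rewrite mem_cat => /orP[/s0|/t0].
have [_ _ /(_ A B cA cB) hY'] := hY.
have [|YA|YB] := hY'; first by move=> x /YZ/hAB.
  have [|Y' [v [v0 [h1 h2 h3 h4 h5]]]] := hs Y hY; first by move=> x Yx; split; [exact: YZ | exact: YA].
  exists Y', v, v0; split=> //; first by move=> x /h3[].
  by rewrite mem_cat h4.
have [|Y' [v [v0 [h1 h2 h3 h4 h5]]]] := ht Y hY; first by move=> x Yx; split; [exact: YZ | exact: YB].
exists Y', v, v0; split=> //; first by move=> x /h3[].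
by rewrite mem_cat h4 orbT.
Qed.

(** Krull dimension bounds the number of hyperplanes needed to cut Z to the empty
    set: a hyperplane avoiding one point of each component of Z drops the length
    of the longest chain. *)
Lemma hyperplanes_cut d Z : zclosed Z -> ~ (exists Y : nat -> set (pspace E), irr_chain Z d Y) ->
  exists ls : seq SymE, [/\ size ls = d, forall q, q \in ls -> q \is 1.-homog &
    forall x, Z x -> ~ (forall q, q \in ls -> vanishes q x)].
Proof.
elim: d Z => [|d IH] Z cZ nch.
  exists [::]; split=> // x Zx _; apply: nch.
  exists (fun=> zclosure [set x]); split=> // i _; split; first exact: zirreducible_point.
  by apply: zclosure_min => // _ ->.
have [s s0 hs] := finite_component_points cZ.
have [q q1 hq] := exists_lform_seq s0.
have [||ls [sz h1 hZ]] := IH (Z `&` zeros [set q]).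
- by apply: zclosedI => //; exact: zclosed_zeros.
- move=> [Y [hirr hincr]]; apply: nch.
  have [irrd Yd] := hirr d (leqnn d).
  have [|Y' [v [v0 [irr' YY' Y'Z vs Y'v]]]] := hs (Y d) irrd; first by move=> x /Yd[].
  exists (fun i => if (i <= d)%N then Y i else Y'); split=> i.
    by rewrite leq_eqVlt => /orP[/eqP->|]; rewrite ?ltnn // ltnS => id; rewrite id;
      have [hi hZi] := hirr i id; split=> // x /hZi[].
  rewrite ltnS => id; rewrite id; move: id; rewrite leq_eqVlt => /orP[/eqP->|id]; last first.
    by rewrite id; exact: hincr.
  rewrite ltnn; split=> // /(_ _ Y'v)/Yd[_ /(_ q erefl)/vanishes_peval e].
  by have := hq v vs; rewrite e eqxx.
exists (q :: ls); split=> [|p|x Zx h]; first by rewrite /= sz.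
  by rewrite inE => /orP[/eqP->|/h1].
apply: (hZ x); last by move=> p pl; apply: h; rewrite inE pl orbT.
by split=> // _ ->; apply: h; exact: mem_head.
Qed.

End Projective.

(** * Invariance under linear isomorphisms *)

Section Pullback.
Variables (K : closedFieldType) (E1 E2 : vectType K).
Hypothesis K_uncountable : ~ countable [set: K].
Local Notation Sym1 := {mpoly K[\dim {:E1}]}.
Local Notation Sym2 := {mpoly K[\dim {:E2}]}.

Definition pull (f : E1 -> E2) (p : Sym2) : Sym1 :=
  p \mPo [tuple lform (fun v => coord (vbasis {:E2}) i (f v)) | i < \dim {:E2}].

Variable f : {linear E1 -> E2}.

Lemma peval_pull p v : peval (pull f p) v = peval p (f v).
Proof.
rewrite /peval comp_mpoly_meval; apply: meval_eq => i; rewrite tnth_mktuple.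
rewrite -[LHS]/(peval _ v) peval_lform // => a u w; rewrite !linearP.
by [].
Qed.

Lemma pullD p q : pull f (p + q) = pull f p + pull f q.
Proof. exact: comp_mpolyD. Qed.

Lemma pullM p q : pull f (p * q) = pull f p * pull f q.
Proof. exact: rmorphM. Qed.

Lemma pullXn p k : pull f (p ^+ k) = pull f p ^+ k.
Proof. exact: rmorphXn. Qed.

Lemma pull_sum (I : Type) (r : seq I) (F : I -> Sym2) :
  pull f (\sum_(i <- r) F i) = \sum_(i <- r) pull f (F i).
Proof. exact: raddf_sum. Qed.

Lemma pull_homog d p : p \is d.-homog -> pull f p \is d.-homog.
Proof.
move=> pd; apply: (homog_peval K_uncountable) => r v.
by rewrite !peval_pull linearZ (peval_homog _ _ pd).
Qed.

Lemma gen_ideal_pull (s : seq Sym2) p :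
  gen_ideal s p -> gen_ideal (map (pull f) s) (pull f p).
Proof.
move=> [a ->]; rewrite pull_sum.
apply: (ideal_sum _ (gen_ideal_ideal _)) => i _; rewrite pullM.
apply: (idealMl (gen_ideal_ideal _)).
by rewrite -(nth_map 0 0 (pull f)) //; apply: gen_ideal_nth; rewrite size_map.
Qed.

End Pullback.

Section Isomorphism.
Variables (K : closedFieldType).
Hypothesis K_uncountable : ~ countable [set: K].

Section OneDirection.
Variables (E1 E2 : vectType K) (f : {linear E1 -> E2}) (g : {linear E2 -> E1}).
Hypothesis fK : cancel f g.

Lemma dim_iso : cancel g f -> \dim {:E1} = \dim {:E2}.
Proof.
move=> gK; have inj : lker (linfun f) == 0%VS.
  by apply/lker0P => u v; rewrite !lfunE => /(can_inj fK).
rewrite -(limg_dim_eq (f := linfun f)) ?(eqP inj) ?capv0 //; congr (\dim _).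
apply/vspaceP => v; rewrite memvf -[v]gK -(lfunE f).
by apply: memv_img; exact: memvf.
Qed.

Lemma iso_neq0 v : v != 0 -> f v != 0.
Proof. by apply: contraNneq => fv; rewrite -(fK v) fv linear0. Qed.

Lemma dim_pimage (x : pspace E1) : \dim (linfun f @: sval x)%VS == 1%N.
Proof.
have inj : lker (linfun f) == 0%VS.
  by apply/lker0P => u v; rewrite !lfunE => /(can_inj fK).
by rewrite limg_dim_eq ?(eqP inj) ?capv0 //; exact: (svalP x).
Qed.

Definition pimage (x : pspace E1) : pspace E2 :=
  exist (fun U : {vspace E2} => \dim U == 1%N) _ (dim_pimage x).

Lemma pimageE v (v0 : v != 0) (w0 : f v != 0) : pimage (ppoint v0) = ppoint w0.
Proof. by apply: val_inj; rewrite /= limg_line lfunE. Qed.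

Lemma vanishes_pimage p x : vanishes (pull f p) x <-> vanishes p (pimage x).
Proof.
have [v [v0 ->]] := pspaceP x; rewrite (pimageE v0 (iso_neq0 v0)).
by split=> /vanishesP h; apply/vanishesP => r; have := h r;
  rewrite peval_pull // linearZ.
Qed.

Lemma zclosed_preimage B : zclosed B -> zclosed (pimage @^-1` B).
Proof.
move=> [S _ ->]; suff -> : pimage @^-1` zeros S = zeros (pull f @` S).
  exact: zclosed_zeros.
rewrite eqEsubset; split=> x hx; first by move=> _ [p Sp <-]; apply/vanishes_pimage/hx.
by move=> p Sp; apply/vanishes_pimage/hx; exists p.
Qed.

End OneDirection.

Section BothDirections.
Variables (E1 E2 : vectType K) (f : {linear E1 -> E2}) (g : {linear E2 -> E1}).
Hypotheses (fK : cancel f g) (gK : cancel g f).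

Lemma pimageK : cancel (pimage fK) (pimage gK).
Proof.
move=> x; have [v [v0 ->]] := pspaceP x.
have gfv0 : g (f v) != 0 by rewrite fK.
rewrite (pimageE fK v0 (iso_neq0 fK v0)) (pimageE gK _ gfv0).
by apply: val_inj => /=; rewrite fK.
Qed.

Lemma pullK p : pull f (pull g p) = p.
Proof.
apply/eqP; rewrite -subr_eq0; apply/eqP/(peval_eq0 K_uncountable) => v.
by rewrite pevalB !peval_pull // fK subrr.
Qed.

End BothDirections.

Section Transport.
Variables (E1 E2 : vectType K) (f : {linear E1 -> E2}) (g : {linear E2 -> E1}).
Hypotheses (fK : cancel f g) (gK : cancel g f).

Lemma zirreducible_preimage B : zirreducible B -> zirreducible (pimage fK @^-1` B).
Proof.
move=> [cB [y By] hB]; split; first exact: zclosed_preimage.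
  by exists (pimage gK y); rewrite /preimage /= (pimageK gK fK).
move=> A1 A2 c1 c2 h.
have [||x Bx|h'|h'] := hB (pimage gK @^-1` A1) (pimage gK @^-1` A2).
- exact: zclosed_preimage.
- exact: zclosed_preimage.
- by apply: h; rewrite /preimage /= (pimageK gK fK).
- by left=> x /h'; rewrite /preimage /= (pimageK fK gK).
- by right=> x /h'; rewrite /preimage /= (pimageK fK gK).
Qed.

Lemma irr_chain_preimage B m Y :
  irr_chain B m Y -> irr_chain (pimage fK @^-1` B) m (fun i => pimage fK @^-1` Y i).
Proof.
move=> [hirr hincr]; split=> i im.
  have [hi hiB] := hirr i im; split; first exact: zirreducible_preimage.
  by move=> x; exact: hiB.
have [sub nsub] := hincr i im; split=> [x|h]; first exact: sub.
apply: nsub => y Yy; have := h (pimage gK y); rewrite /preimage /= (pimageK gK fK).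
exact.
Qed.

End Transport.

Lemma set_complete_intersection_preimage (E1 E2 : vectType K)
  (f : {linear E1 -> E2}) (g : {linear E2 -> E1})
  (fK : cancel f g) (gK : cancel g f) c B :
  set_complete_intersection c B -> set_complete_intersection c (pimage fK @^-1` B).
Proof.
have dimE := dim_iso fK gK.
case=> [[-> ->]|[cB [d [[Y chY] nch] dimd] [gs [hom vi]]]]; [left|right].
  by rewrite preimage_set0.
split; first exact: zclosed_preimage.
  exists d; last by rewrite dimE.
  split; first by exists (fun i => pimage fK @^-1` Y i); apply: irr_chain_preimage.
  move=> [Y' chY']; apply: nch; exists (fun i => pimage gK @^-1` Y' i).
  have := irr_chain_preimage gK fK chY'; congr irr_chain.
  by rewrite eqEsubset; split=> x; rewrite /preimage /= (pimageK gK fK).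
exists (map_tuple (pull f) gs); split=> [i|].
  by rewrite tnth_map; have /homogP[e he] := hom i; apply/homogP; exists e; apply: pull_homog.
have viE p : vanishing_ideal (pimage fK @^-1` B) p <-> vanishing_ideal B (pull g p).
  split=> h x hx.
    by apply/(vanishes_pimage gK)/h; rewrite /preimage /= (pimageK gK fK).
  by rewrite -(pullK fK p); apply/(vanishes_pimage fK)/h.
rewrite eqEsubset; split=> p.
  move=> /viE; rewrite vi => -[k hk]; exists k.
  by rewrite -(pullK fK (p ^+ k)) pullXn; apply: gen_ideal_pull.
move=> [k hk]; apply/viE; rewrite vi; exists k; rewrite -pullXn.
have := gen_ideal_pull g hk; rewrite -map_comp.
by congr gen_ideal; rewrite (eq_map (pullK gK)) map_id.
Qed.

End Isomorphism.

(** * Polynomials along curves *)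

Section Curves.
Variables (K : closedFieldType) (E : vectType K).
Hypothesis K_uncountable : ~ countable [set: K].
Local Notation SymE := {mpoly K[\dim {:E}]}.

(** Taylor expansion along a parabola, which is what the affine chart of the variety
    makes of a line of W. *)
Lemma peval_curve (p : SymE) (u v z : E) : exists h : {poly K}, forall s,
  peval p (u + s *: v + s ^+ 2 *: z) = peval p u + s * pdiff p u v + s ^+ 2 * h.[s].
Proof.
elim/mpoly_alg_ind: p => [a|i|p q [f hf] [g hg]|p q [f hf] [g hg]].
- exists 0 => s; rewrite horner0 mulr0 addr0 /peval !mevalC /pdiff big1 ?mulr0 ?addr0 // => i _.
  by rewrite mderivC /peval meval0 mul0r.
- exists (coord (vbasis {:E}) i z)%:P => s; rewrite hornerC /peval !mevalXU !linearD !linearZ /=.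
  congr (_ + _ * _ + _); rewrite /pdiff (bigD1 i) //= mderivX mnm1E eqxx scale1r big1 => [|j ji].
    rewrite addr0 (_ : (U_(i) - U_(i))%MM = 0%MM) ?mpolyX0 /peval ?meval1 ?mul1r //.
    by apply/mnmP => k; rewrite mnmBE subnn mnm0E.
  by rewrite mderivX mnm1E eq_sym (negPf ji) scale0r /peval meval0 mul0r.
- exists (f + g) => s; rewrite !pevalD hf hg hornerD.
  have -> : pdiff (p + q) u v = pdiff p u v + pdiff q u v.
    by rewrite /pdiff -big_split; apply: eq_bigr => i _; rewrite mderivD pevalD mulrDl.
  by ring.
- have -> : pdiff (p * q) u v = pdiff p u v * peval q u + peval p u * pdiff q u v.
    rewrite /pdiff mulr_suml mulr_sumr -big_split; apply: eq_bigr => i _.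
    by rewrite /= mderivM pevalD !pevalM; ring.
  exists ((pdiff p u v * pdiff q u v)%:P + (peval p u)%:P * g + (peval q u)%:P * f
    + 'X * ((pdiff p u v)%:P * g + (pdiff q u v)%:P * f) + 'X^2 * f * g) => s.
  by rewrite pevalM hf hg !hornerE; ring.
Qed.

Lemma poly_eq0_off0 (h : {poly K}) : (forall s, s != 0 -> h.[s] = 0) -> h = 0.
Proof.
move=> h0; have : 'X * h = 0.
  apply: poly_eq0 => s; rewrite hornerM hornerX.
  by have [->|/h0->] := eqVneq s 0; rewrite ?mul0r ?mulr0.
by move/eqP; rewrite mulf_eq0 polyX_eq0 => /eqP.
Qed.

Lemma peval_curve_poly (p : SymE) (u v z : E) : exists h : {poly K}, forall s,
  h.[s] = peval p (u + s *: v + s ^+ 2 *: z).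
Proof.
have [h hs] := peval_curve p u v z.
exists ((peval p u)%:P + 'X * (pdiff p u v)%:P + 'X^2 * h) => s.
by rewrite hs !hornerE.
Qed.

Lemma peval_line_poly (p : SymE) (u v : E) : exists h : {poly K}, forall s,
  h.[s] = peval p (u + s *: v).
Proof.
have [h hs] := peval_curve_poly p u v 0.
by exists h => s; rewrite hs scaler0 addr0.
Qed.

(** A polynomial in s that vanishes for s <> 0 also vanishes at s = 0. *)
Lemma peval_curve_limit (p : SymE) (u v z : E) :
  (forall s, s != 0 -> peval p (u + s *: v + s ^+ 2 *: z) = 0) -> peval p u = 0.
Proof.
have [h hs] := peval_curve_poly p u v z => h0.
have : h.[0] = 0 by rewrite (@poly_eq0_off0 h) ?horner0 // => s /h0; rewrite hs.
by rewrite hs scale0r addr0 expr0n scale0r addr0.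
Qed.

Lemma peval_line_limit (p : SymE) (u v : E) :
  (forall s, s != 0 -> peval p (u + s *: v) = 0) -> peval p u = 0.
Proof.
move=> h; apply: (@peval_curve_limit p u v 0) => s /h.
by rewrite scaler0 addr0.
Qed.

Lemma pdiff_unique (p : SymE) (u v z : E) (a d : K) (h : {poly K}) :
  (forall s, peval p (u + s *: v + s ^+ 2 *: z) = a + s * d + s ^+ 2 * h.[s]) ->
  pdiff p u v = d.
Proof.
move=> hp; have [g hg] := peval_curve p u v z.
have : (peval p u)%:P + 'X * (pdiff p u v)%:P + 'X^2 * g = a%:P + 'X * d%:P + 'X^2 * h.
  apply/eqP; rewrite -subr_eq0; apply/eqP/poly_eq0 => s.
  by rewrite !hornerE; have := hg s; rewrite hp => ->; rewrite subrr.
move/(congr1 (fun h : {poly K} => h`_1)).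
by rewrite !coefD !coefXM !coefXnM !coefC /= !add0r !addr0.
Qed.

Lemma pdiffP (p : SymE) (u : E) a v w :
  pdiff p u (a *: v + w) = a * pdiff p u v + pdiff p u w.
Proof.
rewrite /pdiff mulr_sumr -big_split; apply: eq_bigr => i _.
by rewrite linearP /= mulrDr mulrCA.
Qed.

(** By linearity it suffices to treat a product of two coordinates. *)
Lemma peval_quadric (p : SymE) (u v : E) s : p \is 2.-homog ->
  peval p (u + s *: v) = peval p u + s * pdiff p u v + s ^+ 2 * peval p v.
Proof.
move=> /dhomogP p2.
suff {p p2} mon m : mdeg m = 2 -> peval 'X_[m] (u + s *: v) =
    peval 'X_[m] u + s * pdiff 'X_[m] u v + s ^+ 2 * peval 'X_[m] v.
  have pE w : peval p w = \sum_(m <- msupp p) p@_m * peval 'X_[m] w.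
    by rewrite {1}[p]mpolyE peval_sum; apply: eq_bigr => m _; rewrite pevalZ.
  have dE : pdiff p u v = \sum_(m <- msupp p) p@_m * pdiff 'X_[m] u v.
    rewrite /pdiff; under [RHS]eq_bigr => m _ do rewrite mulr_sumr.
    rewrite [RHS]exchange_big; apply: eq_bigr => i _.
    rewrite {1}[p]mpolyE raddf_sum peval_sum mulr_suml; apply: eq_bigr => m _.
    by rewrite /= mderivZ pevalZ mulrA.
  rewrite !pE dE !mulr_sumr -!big_split big_seq [RHS]big_seq; apply: eq_bigr => m mp.
  by rewrite /= mon ?p2 //; ring.
move=> m2; have [i mi] : exists i, m i != 0%N.
  apply: contrapT => h; move: m2; rewrite mdegE big1 // => i _.
  by apply/eqP; apply: contrapT => /negP mi; apply: h; exists i.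
have /eqP/mdeg1P[j /eqP mj] : mdeg (m - U_(i)) = 1%N.
  have := mdegD U_(i) (m - U_(i)); rewrite addmC submK ?lep1mP // m2 mdeg1; lia.
have -> : 'X_[m] = 'X_i * 'X_j :> SymE by rewrite -mpolyXD -mj addmC submK // lep1mP.
have X_curve k w s' : peval ('X_k : SymE) (w + s' *: v) =
    peval 'X_k w + s' * peval 'X_k v.
  by rewrite /peval !mevalXU linearD linearZ.
have -> : pdiff ('X_i * 'X_j) u v =
    peval 'X_i u * peval 'X_j v + peval 'X_i v * peval 'X_j u.
  apply: (@pdiff_unique _ _ _ 0 (peval 'X_i u * peval 'X_j u) _ (peval 'X_i v * peval 'X_j v)%:P) => s'.
  by rewrite scaler0 addr0 hornerC pevalM !X_curve; ring.
by rewrite !pevalM !X_curve; ring.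
Qed.

End Curves.

(** * The Euler-symmetric variety of a system of quadrics *)

Section Euler.
Variables (K : closedFieldType) (W : vectType K).
Hypothesis K_uncountable : ~ countable [set: K].
Local Notation n := (\dim {:W}).
Local Notation SymW := {mpoly K[n]}.
Variables (c : nat) (Q : c.-tuple SymW).
Hypothesis Q_homog : forall i, tnth Q i \is 2.-homog.
Hypothesis Q_free : forall a : 'I_c -> K, \sum_i a i *: tnth Q i = 0 -> forall i, a i = 0.

Local Notation E := (VF W c).
Local Notation SymE := {mpoly K[\dim {:E}]}.
Local Notation P := (K^o * W)%type.
Local Notation M := (euler_symmetric Q).

Definition cone : set W := [set w | forall i, peval (tnth Q i) w = 0].

Definition tcoord : SymE := lform (fun v : E => v.1.1).
Definition zcoord (i : 'I_c) : SymE := lform (fun v : E => v.2 0 i).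
Definition base_form : SymW -> SymE := pull (fun v : E => v.1.2).
(** t z_i - Q_i(x), the homogenization of the equation z_i = Q_i(x) of the graph of Q
    that forms the affine chart. *)
Definition graph_form (i : 'I_c) : SymE := tcoord * zcoord i - base_form (tnth Q i).
Definition graph_forms : c.-tuple SymE := [tuple graph_form i | i < c].

(** The affine chart t = 1 of the variety. *)
Definition aff (w : W) : E := veronese_map Q 1 w.

Lemma dimVF : \dim {:E} = (n + c).+1.
Proof.
rewrite !dimvf; have -> : dim E = ((1 + dim W) + 1 * c)%N by [].
by rewrite mul1n.
Qed.

Lemma dimP : \dim {: P} = n.+1.
Proof. by rewrite !dimvf. Qed.

Lemma peval_tcoord v : peval tcoord v = v.1.1.
Proof. by rewrite peval_lform. Qed.

Lemma peval_zcoord i v : peval (zcoord i) v = v.2 0 i.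
Proof. by rewrite peval_lform // => a u w; rewrite !mxE. Qed.

Lemma peval_base_form p v : peval (base_form p) v = peval p v.1.2.
Proof. exact: (@peval_pull _ _ _ (snd \o fst : {linear E -> W})). Qed.

Lemma base_form_homog d p : p \is d.-homog -> base_form p \is d.-homog.
Proof. exact: (@pull_homog _ _ _ K_uncountable (snd \o fst : {linear E -> W})). Qed.

Lemma peval_graph_form i v : peval (graph_form i) v = v.1.1 * v.2 0 i - peval (tnth Q i) v.1.2.
Proof. by rewrite pevalB pevalM peval_tcoord peval_zcoord peval_base_form. Qed.

Lemma graph_form_homog i : graph_form i \is 2.-homog.
Proof.
rewrite rpredB ?base_form_homog //.
exact: (dhomogM (lform_homog _) (lform_homog _)).
Qed.

Lemma peval_Q_scale i r w : peval (tnth Q i) (r *: w) = r ^+ 2 * peval (tnth Q i) w.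
Proof. exact: peval_homog. Qed.

Lemma aff_neq0 w : aff w != 0.
Proof.
by apply/eqP => /(congr1 (fun v : E => v.1.1)) /= /eqP; rewrite expr1n oner_eq0.
Qed.

Lemma scale_aff r w : r *: aff w = (r, r *: w, \row_i (r * peval (tnth Q i) w)).
Proof.
rewrite /aff /veronese_map expr1n scale1r; congr (_, _, _); first exact: mulr1.
by apply/rowP => i; rewrite !mxE.
Qed.

Lemma veronese_mapE t w : t != 0 -> veronese_map Q t w = t ^+ 2 *: aff (t^-1 *: w).
Proof.
move=> t0; rewrite /aff /veronese_map; congr (_, _, _).
- by rewrite /= expr1n [RHS]mulr1.
- by rewrite scale1r scalerA expr2 mulfK.
- by apply/rowP => i; rewrite !mxE peval_Q_scale mulrA -exprMn mulfV // expr1n mul1r.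
Qed.

(** Points with t = 0 are limits of points with t <> 0, so that the affine chart
    suffices to test the vanishing on the whole variety. *)
Lemma vanishing_ideal_euler p :
  vanishing_ideal M p <-> forall r w, peval p (r *: aff w) = 0.
Proof.
rewrite vanishing_ideal_zclosure; split=> [h r w|h y [t [w ey]]].
  have := h (ppoint (aff_neq0 w)); move=> /(_ _)/vanishesP; apply.
  by exists 1, w.
have v0 : veronese_map Q t w != 0.
  have : \dim (sval y) == 1%N by exact: (svalP y).
  by rewrite ey dim_vline; case: (_ != 0).
rewrite (pspace_eq v0 ey); apply/vanishesP => r.
have hs s : s != 0 -> peval p (r *: veronese_map Q s w) = 0.
  by move=> s0; rewrite veronese_mapE // scalerA.
have [t0|/hs//] := eqVneq t 0.
apply: (@peval_curve_limit _ _ p _ (0, r *: w, 0) (r, 0, 0)) => s s0.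
rewrite -[RHS](hs s s0) t0 /veronese_map; congr peval; congr (_, _, _) => /=.
- by rewrite expr0n /= !scaler0 !add0r; exact: mulrC.
- by rewrite scale0r !scaler0 add0r addr0 !scalerA mulrC.
- by rewrite !scaler0 !addr0.
Qed.

Lemma graph_form_vanishes i : vanishing_ideal M (graph_form i).
Proof.
apply/vanishing_ideal_euler => r w; rewrite scale_aff peval_graph_form /= mxE.
by rewrite peval_Q_scale mulrA -expr2 subrr.
Qed.

Lemma graph_forms_vanish : gen_ideal graph_forms `<=` vanishing_ideal M.
Proof.
apply: gen_ideal_min => [|i]; first exact: vanishing_idealP.
rewrite size_tuple => ic; have -> : graph_forms`_i = graph_form (Ordinal ic).
  by rewrite -(tnth_nth _ _ (Ordinal ic)) tnth_mktuple.
exact: graph_form_vanishes.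
Qed.

Lemma zclosed_euler : zclosed M.
Proof. exact: zclosed_zclosure. Qed.

Lemma tcoord_nonzerodivisor p : vanishing_ideal M (tcoord * p) -> vanishing_ideal M p.
Proof.
move=> /vanishing_ideal_euler h; apply/vanishing_ideal_euler => r w.
have hne s : s != 0 -> peval p (s *: aff w) = 0.
  move=> s0; have := h s w; rewrite pevalM peval_tcoord scale_aff /= -scale_aff => /eqP.
  by rewrite mulf_eq0 (negPf s0) => /eqP.
have [->|/hne//] := eqVneq r 0.
by apply: (@peval_line_limit _ _ p _ (aff w)) => s s0; rewrite scale0r add0r hne.
Qed.

Definition zvec (k : 'I_c) : E := (0, 0, delta_mx 0 k).

Lemma aff_sum w : aff w = (1, w, 0) + \sum_k peval (tnth Q k) w *: zvec k.
Proof.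
have -> : \sum_k peval (tnth Q k) w *: zvec k = (0, 0, \row_k peval (tnth Q k) w).
  rewrite [X in (_, X)]row_sum_delta.
  rewrite (big_morph (fun z : 'rV_c => ((0, 0, z) : E)) (id1 := 0) (op1 := +%R)) //.
    by apply: eq_bigr => k _; rewrite mxE /zvec; congr (_, _, _); rewrite ?scaler0.
  by move=> x y; congr (_, _, _); rewrite ?addr0.
by rewrite /aff /veronese_map expr1n scale1r; congr (_, _, _); rewrite ?addr0 ?add0r.
Qed.

(** The pullback of functions along the affine chart. *)
Definition chart (p : SymE) : SymW :=
  p \mPo [tuple (coord (vbasis {:E}) i (1, 0, 0))%:MP
    + lform (fun w => coord (vbasis {:E}) i (0, w, 0))
    + \sum_k coord (vbasis {:E}) i (zvec k) *: tnth Q k | i < \dim {:E}].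

Lemma peval_chart p w : peval (chart p) w = peval p (aff w).
Proof.
rewrite /peval comp_mpoly_meval; apply: meval_eq => i; rewrite tnth_mktuple.
rewrite -[LHS]/(peval _ w). rewrite !pevalD peval_lform => [|a u u']; last first.
  rewrite -linearP; congr (coord _ _ _).
  by congr (_, _, _); rewrite /= ?scaler0 ?addr0.
rewrite peval_sum; have -> : peval (coord (vbasis {:E}) i (1, 0, 0))%:MP w = coord (vbasis {:E}) i (1, 0, 0).
  exact: mevalC.
rewrite aff_sum linearD linear_sum -linearD; congr (coord _ _ _ + _).
  by congr (_, _, _); rewrite ?addr0 ?add0r.
by apply: eq_bigr => k _; rewrite pevalZ linearZ /= mulrC.
Qed.

(** The parametrization (r, w) |-> r (1, w, Q(w)) of the affine cone, in coordinates. *)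
Definition cone_chart : (\dim {:E}).-tuple {mpoly K[\dim {: P}]} :=
  [tuple lform (fun u : P => u.1) * pull (fun u : P => u.2) (chart 'X_i) | i < \dim {:E}].

Lemma meval_cone_chart (p : SymE) (u : P) :
  peval (p \mPo cone_chart) u = peval p (u.1 *: aff u.2).
Proof.
rewrite /peval comp_mpoly_meval; apply: meval_eq => i; rewrite tnth_mktuple.
rewrite -[LHS]/(peval _ u) pevalM peval_lform // linearZ /=; congr (_ * _).
by rewrite (@peval_pull _ _ _ (snd : {linear P -> W})) peval_chart /peval mevalXU.
Qed.

(** The affine cone over the variety is parametrized by the n + 1 coordinates of a pair
    (r, w). *)
Lemma euler_alg_indep r (f : r.-tuple SymE) :
  alg_indep (vanishing_ideal M) f -> (r <= n.+1)%N.
Proof.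
move=> hf; rewrite -dimP; apply: (@alg_indep_kernel _ _ _ _ cone_chart f).
apply: alg_indep_sub hf => p /= hp; apply/vanishing_ideal_euler => r' w.
by rewrite -(meval_cone_chart p (r', w)) hp /peval meval0.
Qed.

(** The closures of these sets, which lie over a complete flag of W, form a chain of
    length n. *)
Definition flag_chart i : set (pspace E) :=
  [set y | exists w, (forall j : 'I_n, (i <= j)%N -> coord (vbasis {:W}) j w = 0) /\
                     y = ppoint (aff_neq0 w)].

(** Two points of the chart lie on a curve parametrized by a line, and a product of two
    polynomials that do not vanish identically on it is nonzero somewhere on it. *)
Lemma flag_chart_irreducible i : zirreducible (zclosure (flag_chart i)).
Proof.
apply: zirreducible_zclosure.
  by exists (ppoint (aff_neq0 0)), 0; split=> // j _; rewrite linear0.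
have test p : ~ vanishing_ideal (flag_chart i) p -> exists w d,
    (forall j : 'I_n, (i <= j)%N -> coord (vbasis {:W}) j w = 0) /\
    peval (pihomog mdeg d p) (aff w) != 0.
  move=> np; apply: contrapT => h; apply: np => _ [w [hw ->]].
  apply: vanishes_partition => d; apply: vanishes_homog (pihomogP _ _ _) _.
  apply/eqP; apply: contrapT => /negP hd; apply: h; by exists w, d.
move=> p q hpq; apply: contrapT => /not_orP[/test[w [d [hw pw]]] /test[w' [e [hw' qw']]]].
have curve r : exists h : {poly K}, forall s,
    h.[s] = peval r (aff (w + s *: (w' - w))).
  have [h hs] := peval_line_poly (chart r) w (w' - w).
  by exists h => s; rewrite hs peval_chart.
have [f fs] := curve (pihomog mdeg d p); have [g gs] := curve (pihomog mdeg e q).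
have f0 : f != 0.
  by apply: contraNneq pw => f0; have := fs 0; rewrite f0 horner0 scale0r addr0 => <-.
have g0 : g != 0.
  by apply: contraNneq qw' => g0; have := gs 1; rewrite g0 horner0 scale1r addrC subrK => <-.
have [s] := poly_nonroot (mulf_neq0 f0 g0).
rewrite hornerM mulf_eq0 negb_or fs gs => /andP[fs0 gs0].
have [|h|h] := hpq (ppoint (aff_neq0 (w + s *: (w' - w)))).
- exists (w + s *: (w' - w)); split=> // j ij.
  by rewrite linearD linearZ linearB /= hw // hw' // subrr mulr0 addr0.
- by have /vanishes_peval/eqP := vanishes_pihomog d h; rewrite (negPf fs0).
- by have /vanishes_peval/eqP := vanishes_pihomog e h; rewrite (negPf gs0).
Qed.

Theorem euler_has_dim : has_dim M n.
Proof.
split; last first.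
  move=> [Y chY]; have [f hf] := irr_chain_alg_indep chY.
  have [/(_ _ (leqnn _))[_ YM] _] := chY.
  have := euler_alg_indep (alg_indep_sub (vanishing_ideal_sub YM) hf).
  by rewrite ltnn.
exists (fun i => zclosure (flag_chart i)); split=> i lin.
  split; first exact: flag_chart_irreducible.
  apply: zclosure_min; first exact: zclosed_euler.
  by move=> _ [w [_ ->]]; apply: sub_zclosure; exists 1, w.
split=> [|sub].
  apply: zclosure_min; first exact: zclosed_zclosure.
  move=> _ [w [hw ->]]; apply: sub_zclosure; exists w; split=> // j /ltnW; exact: hw.
pose b := (vbasis {:W})`_i; pose p := base_form 'X_(Ordinal lin).
have bE j : coord (vbasis {:W}) j b = (i == j)%:R.
  exact: (coord_free (Ordinal lin) j (basis_free (vbasisP _))).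
have hp : vanishing_ideal (flag_chart i) p.
  move=> _ [w [hw ->]]; apply: (@vanishes_homog _ _ 1).
    by apply: base_form_homog; rewrite dhomogX /= mdeg1.
  by rewrite peval_base_form /= scale1r /peval mevalXU hw.
have /sub : zclosure (flag_chart i.+1) (ppoint (aff_neq0 b)).
  apply: sub_zclosure; exists b; split=> // j; rewrite bE => ij.
  by rewrite (_ : (i == j) = false) // ltn_eqF.
rewrite zclosureE => /(_ p hp)/vanishes_peval.
by rewrite peval_base_form /= scale1r /peval mevalXU bE eqxx => /eqP; rewrite oner_eq0.
Qed.

(** The condition through which the implications pass: the base locus has codimension at
    least c. *)
Definition transversal_forms (ls : seq SymW) : Prop :=
  [/\ (size ls + c)%N = n, forall q, q \in ls -> q \is 1.-homog &
      forall w, cone w -> (forall q, q \in ls -> peval q w = 0) -> w = 0].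

(** Squaring brings linear forms to the degree of the quadrics and keeps their zeros. *)
Definition squares (E' : vectType K) (ls : seq {mpoly K[\dim {:E'}]}) :=
  map (fun q => q ^+ 2) ls.

Lemma squares_homog (E' : vectType K) (ls : seq {mpoly K[\dim {:E'}]}) :
  (forall q, q \in ls -> q \is 1.-homog) ->
  forall q, q \in squares ls -> q \is 2.-homog.
Proof. by move=> h _ /mapP[q /h q1 ->]; exact: (dhomogMn 2 q1). Qed.

Lemma squares_eq0 (E' : vectType K) (ls : seq {mpoly K[\dim {:E'}]}) v :
  (forall p, p \in squares ls -> peval p v = 0) -> forall q, q \in ls -> peval q v = 0.
Proof.
move=> h q ql; have := h _ (map_f _ ql); rewrite pevalX => /eqP.
by rewrite expf_eq0 => /eqP.
Qed.

Lemma parameters_regular_peval (E' : vectType K) (s : seq {mpoly K[\dim {:E'}]}) :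
  size s = \dim {:E'} -> (forall p, p \in s -> p \is 2.-homog) ->
  (forall v, (forall p, p \in s -> peval p v = 0) -> v = 0) -> regular_sequence s.
Proof.
move=> sz s2 s0; apply: parameters_regular => // a ha i.
have [v hv] := crd_surj a; have v0 : v = 0.
  by apply: s0 => p /ha <-; apply: meval_eq.
by rewrite -hv v0 linear0.
Qed.

Lemma regular_sequence_cat (s t : seq SymW) :
  regular_sequence (s ++ t) -> regular_sequence s.
Proof.
move=> h i b si; have := h i b; rewrite size_cat nth_cat take_cat si.
by apply; rewrite ltn_addr.
Qed.

(** Q completed by the squares of the transversal forms is a system of parameters. *)
Theorem transversal_regular ls : transversal_forms ls -> regular_sequence Q.
Proof.
move=> [sz l1 l0]; apply: (@regular_sequence_cat _ (squares ls)).
apply: parameters_regular_peval.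
- by rewrite size_cat size_map size_tuple addnC.
- move=> p; rewrite mem_cat => /orP[/tnthP[i ->//]|]; exact: squares_homog.
- move=> w hw; apply: l0 => [i|]; first by apply: hw; rewrite mem_cat mem_tnth.
  by apply: squares_eq0 => p pl; apply: hw; rewrite mem_cat pl orbT.
Qed.

(** In the localization at t the graph forms t z_i - Q_i(x) eliminate the z_i. *)
Lemma eliminate_zcoord (p : SymE) : exists k (h : {mpoly K[\dim {: P}]}),
  gen_ideal graph_forms (tcoord ^+ k * p - pull (fst : E -> P) h).
Proof.
have hJ := gen_ideal_ideal graph_forms.
pose C p := exists k (h : {mpoly K[\dim {: P}]}),
  gen_ideal graph_forms (tcoord ^+ k * p - pull (fst : E -> P) h).
have pfst h v : peval (pull (fst : E -> P) h) v = peval h v.1.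
  exact: (@peval_pull _ _ _ (fst : {linear E -> P})).
have tP : tcoord = pull (fst : E -> P) (lform (fun u : P => u.1)).
  apply/eqP; rewrite -subr_eq0; apply/eqP/(peval_eq0 K_uncountable) => v.
  by rewrite pevalB pfst peval_tcoord peval_lform // subrr.
have C0 h : C (pull (fst : E -> P) h).
  by exists 0%N, h; rewrite expr0 mul1r subrr; exact: ideal0.
have CD q r : C q -> C r -> C (q + r).
  move=> [k [h hq]] [l [g hr]].
  exists (k + l)%N, ((lform (fun u : P => u.1)) ^+ l * h + (lform (fun u : P => u.1)) ^+ k * g).
  rewrite pullD !pullM !pullXn -tP.
  have -> : tcoord ^+ (k + l) * (q + r) -
      (tcoord ^+ l * pull fst h + tcoord ^+ k * pull fst g) =
      tcoord ^+ l * (tcoord ^+ k * q - pull (fst : E -> P) h) +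
      tcoord ^+ k * (tcoord ^+ l * r - pull (fst : E -> P) g).
    by rewrite exprD; ring.
  by apply: (idealD hJ); apply: (idealMl hJ).
have CM q r : C q -> C r -> C (q * r).
  move=> [k [h hq]] [l [g hr]]; exists (k + l)%N, (h * g); rewrite pullM.
  have -> : tcoord ^+ (k + l) * (q * r) - pull (fst : E -> P) h * pull (fst : E -> P) g =
      (tcoord ^+ l * r) * (tcoord ^+ k * q - pull (fst : E -> P) h) +
      pull (fst : E -> P) h * (tcoord ^+ l * r - pull (fst : E -> P) g).
    by rewrite exprD; ring.
  by apply: (idealD hJ); apply: (idealMl hJ).
have CC a : C a%:MP.
  have -> : a%:MP = pull (fst : E -> P) a%:MP by rewrite /pull comp_mpolyC.
  exact: C0.
have CZ k : C (zcoord k).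
  exists 1%N, (pull (snd : P -> W) (tnth Q k)).
  have -> : tcoord ^+ 1 * zcoord k - pull (fst : E -> P) (pull (snd : P -> W) (tnth Q k)) = graph_forms`_k.
    rewrite -tnth_nth tnth_mktuple /graph_form expr1; congr (_ - _).
    apply/eqP; rewrite -subr_eq0; apply/eqP/(peval_eq0 K_uncountable) => v.
    by rewrite pevalB pfst (@peval_pull _ _ _ (snd : {linear P -> W})) peval_base_form subrr.
  by apply: gen_ideal_nth; rewrite size_tuple.
elim/mpoly_alg_ind: p => // i.
pose l (u : P) : K := coord (vbasis {:E}) i (u, 0).
have lP a u w : l (a *: u + w) = a * l u + l w.
  rewrite /l -linearP; congr (coord _ _ _).
  by congr (_, _); rewrite /= ?scaler0 ?addr0.
have -> : 'X_i = pull (fst : E -> P) (lform l) +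
    \sum_k (coord (vbasis {:E}) i (zvec k))%:MP * zcoord k.
  apply/eqP; rewrite -subr_eq0; apply/eqP/(peval_eq0 K_uncountable) => v.
  rewrite pevalB pevalD pfst peval_lform // peval_sum /l {1}/peval mevalXU.
  have {1}-> : v = (v.1, 0) + \sum_k v.2 0 k *: zvec k; last first.
    apply/eqP; rewrite linearD linear_sum subr_eq0; apply/eqP; congr (_ + _).
    by apply: eq_bigr => k _; rewrite pevalM peval_zcoord linearZ /= mulrC /peval mevalC.
  have -> : \sum_k v.2 0 k *: zvec k = (0, v.2) :> E.
    rewrite [X in (_, X)]row_sum_delta.
    rewrite (big_morph (fun z : 'rV_c => ((0, z) : E)) (id1 := 0) (op1 := +%R)) //.
      by apply: eq_bigr => k _; rewrite /zvec; congr (_, _); rewrite ?scaler0.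
    by move=> x y; congr (_, _); rewrite ?addr0.
  by rewrite [LHS]surjective_pairing; congr (_, _); rewrite ?addr0 ?add0r.
apply: (CD) => //; elim/big_ind: _ => // [|k _]; last exact: CM.
by have := CC 0; rewrite mpolyC0.
Qed.

(** The graph forms, t^2, and the squares of the transversal linear forms and of the last
    coordinates form a system of parameters of the homogeneous coordinate ring of
    P(V_F); hence t is a nonzerodivisor modulo the graph forms. *)
Lemma tcoord_regular ls p : transversal_forms ls ->
  gen_ideal graph_forms (tcoord * p) -> gen_ideal graph_forms p.
Proof.
move=> [sz l1 l0] hp; pose ms := map base_form ls; pose zs := [seq zcoord i | i <- enum 'I_c].
have ms1 q : q \in ms -> q \is 1.-homog.
  by move=> /mapP[r /l1 r1 ->]; exact: base_form_homog.
have zs1 q : q \in zs -> q \is 1.-homog by move=> /mapP[r _ ->]; exact: lform_homog.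
have : regular_sequence (graph_forms ++ squares (tcoord :: ms ++ zs)).
  apply: parameters_regular_peval.
  - have sz_zs : size zs = c by rewrite size_map size_enum_ord.
    rewrite size_cat size_tuple size_map /= size_cat sz_zs size_map dimVF; lia.
  - move=> q; rewrite mem_cat => /orP[/tnthP[i ->]|].
      by rewrite tnth_mktuple; exact: graph_form_homog.
    apply: squares_homog => r; rewrite inE mem_cat => /or3P[/eqP->|/ms1//|/zs1//].
    exact: lform_homog.
  - move=> v hv.
    have sq q : q \in tcoord :: ms ++ zs -> peval q v = 0.
      by apply: squares_eq0 => r hr; apply: hv; rewrite mem_cat hr orbT.
    have t0 : v.1.1 = 0 by rewrite -peval_tcoord; apply: sq; rewrite mem_head.
    have z0 : v.2 = 0.
      apply/rowP => i; rewrite mxE -peval_zcoord; apply: sq.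
      by rewrite inE mem_cat (map_f zcoord (mem_enum _ i)) !orbT.
    have w0 : v.1.2 = 0.
      apply: l0 => [i|q ql].
        have : peval (graph_form i) v = 0.
          by apply: hv; rewrite mem_cat -(tnth_mktuple graph_form i) mem_tnth.
        by rewrite peval_graph_form t0 mul0r sub0r => /eqP; rewrite oppr_eq0 => /eqP.
      by rewrite -peval_base_form; apply: sq; rewrite inE mem_cat map_f ?orbT.
    by rewrite [v]surjective_pairing [v.1]surjective_pairing t0 z0 w0.
move=> /(_ c p); rewrite size_cat size_tuple take_size_cat ?size_tuple //.
rewrite nth_cat size_tuple ltnn subnn addnS ltnS leq_addr => /(_ isT); apply.
by rewrite /= expr2 -mulrA; apply: (idealMl (gen_ideal_ideal _)).
Qed.

(** Up to a power of t a polynomial p in the ideal is congruent, modulo the graph forms,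
    to a polynomial in t and x alone; this one vanishes because t and x are free on the
    chart, and then the power of t cancels. *)
Theorem transversal_euler_ideal ls : transversal_forms ls ->
  vanishing_ideal M = gen_ideal graph_forms.
Proof.
move=> hls; rewrite eqEsubset; split; last exact: graph_forms_vanish.
move=> p hp; have [k [h hk]] := eliminate_zcoord p.
have pfst v : peval (pull (fst : E -> P) h) v = peval h v.1.
  exact: (@peval_pull _ _ _ (fst : {linear E -> P})).
have hM : vanishing_ideal M (pull (fst : E -> P) h).
  move/graph_forms_vanish: hk => /(idealN (vanishing_idealP _)); rewrite opprB => h1.
  have := idealD (vanishing_idealP _) h1 (idealMl (vanishing_idealP _) (tcoord ^+ k) hp).
  by rewrite subrK.
have h0 : h = 0.
  apply: (peval_eq0 K_uncountable) => u.
  have hne v : v.1 != 0 -> peval h v = 0.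
    move=> t0; have /vanishing_ideal_euler/(_ v.1 (v.1^-1 *: v.2)) := hM.
    rewrite pfst scale_aff /= scalerA mulfV // scale1r => <-; congr peval.
    exact: surjective_pairing.
  have [t0|/hne//] := eqVneq u.1 0.
  apply: (@peval_line_limit _ _ h u (1, 0)) => s s0; apply: hne => /=.
  by rewrite t0 add0r (_ : s *: (1 : K^o) = s) //; exact: mulr1.
rewrite h0 /pull comp_mpoly0 subr0 in hk.
elim: k hk => [|k IH]; first by rewrite expr0 mul1r.
by rewrite exprS -mulrA => /(tcoord_regular hls).
Qed.

Theorem transversal_complete_intersection ls : transversal_forms ls ->
  complete_intersection c M.
Proof.
move=> hls; split; first exact: zclosed_euler.
  by exists n; [exact: euler_has_dim | exact: dimVF].
by exists graph_forms; apply: transversal_euler_ideal hls.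
Qed.

Definition ord_ge k (p : SymE) : Prop := {in msupp p, forall m, (k <= mdeg m)%N}.

Lemma ord_geM k l (p q : SymE) : ord_ge k p -> ord_ge l q -> ord_ge (k + l) (p * q).
Proof.
move=> hp hq m /msuppM_le /allpairsP[[m1 m2] /= [h1 h2 ->]].
by rewrite mdegD leq_add ?hp ?hq.
Qed.

Lemma ord_ge_sum k (I : Type) (r : seq I) (F : I -> SymE) :
  (forall i, ord_ge k (F i)) -> ord_ge k (\sum_(i <- r) F i).
Proof.
move=> hF; elim/big_ind: _ => [m|x y hx hy m /msuppD_le|//]; first by rewrite msupp0.
by rewrite mem_cat => /orP[/hx|/hy].
Qed.

Lemma trunc_ord_ge k d p : ord_ge k p -> (d <= k)%N -> trunc d p = 0.
Proof.
move=> hp dk; apply: big1 => b _; rewrite pihomogE big_seq_cond big1 // => m /andP[mp /eqP mb].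
by have := leq_trans (leq_trans (ltn_ord b) dk) (hp m mp); rewrite mb ltnn.
Qed.

Lemma mcoeff_pihomog d (p : SymE) m : (pihomog mdeg d p)@_m = if mdeg m == d then p@_m else 0.
Proof.
elim/mpolyind: p => [|a m' p _ _ IH]; first by rewrite pihomog0 mcoeff0 if_same.
rewrite pihomogD linearZ /= pihomogX !mcoeffD IH !mcoeffZ.
case: (mdeg m' =P d) => md'; rewrite ?mcoeffX ?mcoeff0; case: (m' =P m) => [<-|_].
- by rewrite md' eqxx.
- by case: ifP => _; rewrite !mulr0 ?add0r.
- by rewrite (introF eqP md') mulr0 add0r.
- by case: ifP => _; rewrite !mulr0 ?add0r.
Qed.

Lemma pihomog2M (a g : SymE) : ord_ge 2 g ->
  pihomog mdeg 2 (a * g) = a@_0 *: pihomog mdeg 2 g.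
Proof.
move=> hg; have a1 : ord_ge 1 (a - (a@_0)%:MP).
  move=> m; rewrite mcoeff_msupp mcoeffB mcoeffC; case: (m =P 0%MM) => [->|/eqP m0 _].
    by rewrite mulr1 subrr eqxx.
  by rewrite lt0n mdeg_eq0.
rewrite -{1}(subrK (a@_0)%:MP a) mulrDl pihomogD mul_mpolyC linearZ /=.
rewrite [X in X + _](_ : _ = 0) ?add0r // pihomogE big_seq_cond big1 // => m.
by move=> /andP[/(ord_geM a1 hg) + /eqP m2]; rewrite m2.
Qed.

(** No hyperplane contains the variety, because the Q_i are linearly independent. *)
Lemma euler_nondegenerate p : vanishing_ideal M p -> ord_ge 2 p.
Proof.
move=> hp; suff [p0 p1] : pihomog mdeg 0 p = 0 /\ pihomog mdeg 1 p = 0.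
  move=> m; rewrite mcoeff_msupp leqNgt; apply: contraNN; rewrite ltnS leq_eqVlt ltnS leqn0.
  case/orP=> /eqP md.
    by have := mcoeff_pihomog 1 p m; rewrite p1 mcoeff0 md eqxx => <-.
  by have := mcoeff_pihomog 0 p m; rewrite p0 mcoeff0 md eqxx => <-.
have ha d w : peval (pihomog mdeg d p) (aff w) = 0.
  apply: (@vanishes_peval _ _ _ _ (aff_neq0 w)); apply: vanishes_pihomog; apply: hp.
  by apply: sub_zclosure; exists 1, w.
split; apply: (peval_eq0 K_uncountable) => v.
  have const u : peval (pihomog mdeg 0 p) u = peval (pihomog mdeg 0 p) 0.
    by rewrite -(scale0r u) (peval_homog _ _ (pihomogP _ _ _)) expr0 mul1r.
  by rewrite const -(const (aff 0)).
set q := pihomog mdeg 1 p; have q1 : q \is 1.-homog by exact: pihomogP.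
have qD u w : peval q (u + w) = peval q u + peval q w.
  by rewrite -{1}[u]scale1r peval_linear // mul1r.
have qZ a u : peval q (a *: u) = a * peval q u.
  by rewrite (peval_homog _ _ q1) expr1.
have q0 : peval q 0 = 0 by rewrite -(scale0r 0) qZ mul0r.
have qsum w : peval q (\sum_k peval (tnth Q k) w *: zvec k) =
    \sum_k peval (tnth Q k) w * peval q (zvec k).
  by rewrite (big_morph _ qD q0); apply: eq_bigr => k _; rewrite qZ.
have e1 w : peval q (1, 0, 0) = 0 /\ (peval q (0, w, 0) = 0 /\
    \sum_k peval (tnth Q k) w * peval q (zvec k) = 0).
  pose h : {poly K} := (peval q (1, 0, 0))%:P + 'X * (peval q (0, w, 0))%:P +
    'X^2 * (\sum_k peval (tnth Q k) w * peval q (zvec k))%:P.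
  have h0 : h = 0.
    apply: poly_eq0 => s; rewrite /h !hornerE -[RHS](ha 1%N (s *: w)) -/q aff_sum qD qsum.
    rewrite (_ : (1, s *: w, 0) = (1, 0, 0) + s *: (0, w, 0) :> E); last first.
      by congr (_, _, _); rewrite /= ?scaler0 ?addr0 ?add0r.
    rewrite qD qZ; congr (_ + _); rewrite mulr_sumr; apply: eq_bigr => k _.
    by rewrite peval_Q_scale mulrA.
  have c0 := congr1 (fun h : {poly K} => h`_0) h0.
  have c1 := congr1 (fun h : {poly K} => h`_1) h0.
  have c2 := congr1 (fun h : {poly K} => h`_2) h0.
  move: c0 c1 c2; rewrite /h !coefD !coefXM !coefXnM !coefC /= !addr0 !add0r.
  by move=> -> -> ->.
have qz k : peval q (zvec k) = 0.
  apply: (Q_free (a := fun k => peval q (zvec k))).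
  apply: (peval_eq0 K_uncountable) => w; rewrite peval_sum.
  have [_ [_ e]] := e1 w; rewrite -[RHS]e; apply: eq_bigr => j _.
  by rewrite pevalZ mulrC.
have -> : v = v.1.1 *: (1, 0, 0) + ((0, v.1.2, 0) + \sum_k v.2 0 k *: zvec k).
  have -> : \sum_k v.2 0 k *: zvec k = (0, 0, v.2) :> E.
    rewrite [X in (_, X)]row_sum_delta.
    rewrite (big_morph (fun z : 'rV_c => ((0, 0, z) : E)) (id1 := 0) (op1 := +%R)) //.
      by apply: eq_bigr => k _; rewrite /zvec; congr (_, _, _); rewrite ?scaler0.
    by move=> x y; congr (_, _, _); rewrite ?addr0.
  rewrite [LHS]surjective_pairing [v.1]surjective_pairing.
  congr (_, _, _); rewrite /= ?scaler0 ?addr0 ?add0r //.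
  by rewrite (_ : v.1.1 *: (1 : K^o) = v.1.1) //; exact: mulr1.
rewrite !qD qZ (big_morph _ qD q0) big1 => [|k _]; last by rewrite qZ qz mulr0.
by have [-> [-> _]] := e1 v.1.2; rewrite mulr0 !addr0.
Qed.

Lemma graph_forms_free (a : 'I_c -> K) :
  \sum_i a i *: graph_form i = 0 -> forall i, a i = 0.
Proof.
move=> h i; have := congr1 (fun p : SymE => peval p ((1, 0, delta_mx 0 i) : E)) h.
rewrite peval_sum (bigD1 i) //= big1 => [|j ji].
  rewrite addr0 pevalZ peval_graph_form /= mxE !eqxx (peval0 (Q_homog i)) subr0 !mulr1 => ->.
  exact: meval0.
by rewrite pevalZ peval_graph_form /= mxE eqxx (negPf ji) (peval0 (Q_homog j)) subr0 !mulr0.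
Qed.

Lemma gen_idealP (A : comNzRingType) k (g : k.-tuple A) p :
  gen_ideal g p -> exists a : 'I_k -> A, p = \sum_j a j * tnth g j.
Proof.
move: p; apply: (@gen_ideal_min _ _ [set p | exists a : 'I_k -> A, p = \sum_j a j * tnth g j]) => [|i].
  split=> [|x y [a ->] [b ->]|u x [a ->]].
  - by exists (fun=> 0); rewrite big1 // => j _; rewrite mul0r.
  - by exists (fun j => a j + b j); rewrite -big_split; apply: eq_bigr => j _; rewrite mulrDl.
  - by exists (fun j => u * a j); rewrite mulr_sumr; apply: eq_bigr => j _; rewrite mulrA.
rewrite size_tuple => ik; exists (fun j => (j == Ordinal ik)%:R).
rewrite (bigD1 (Ordinal ik)) //= eqxx mul1r (tnth_nth 0) /= big1 ?addr0 //.
by move=> j /negPf->; rewrite mul0r.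
Qed.

(** The c graph forms are linearly independent and the ideal starts in degree 2, so the
    graph forms and the quadratic parts of any c generators span the same space; by
    Nakayama's lemma the graph forms generate as well. *)
Theorem euler_ideal_graph_forms (g : c.-tuple SymE) :
  vanishing_ideal M = gen_ideal g -> vanishing_ideal M = gen_ideal graph_forms.
Proof.
move=> eM; rewrite eqEsubset; split; last exact: graph_forms_vanish.
have g2 j : ord_ge 2 (tnth g j).
  apply: euler_nondegenerate; rewrite eM (tnth_nth 0); apply: gen_ideal_nth.
  by rewrite size_tuple.
have aP i : exists a : 'I_c -> SymE, graph_form i = \sum_j a j * tnth g j.
  by apply: gen_idealP; rewrite -eM; exact: graph_form_vanishes.
pose a i := projT1 (cid (aP i)).
have ea i : graph_form i = \sum_j a i j * tnth g j by exact: (projT2 (cid (aP i))).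
(* A0 expresses the graph forms through the quadratic parts of the generators. *)
pose A0 := \matrix_(i, j) (a i j)@_0 : 'M[K]_c.
have A0_unit : A0 \in unitmx.
  rewrite -row_free_unit; apply: inj_row_free => v vA.
  apply/rowP => i; rewrite mxE; apply: (graph_forms_free (a := fun i => v 0 i)).
  have e2 k : graph_form k = \sum_j A0 k j *: pihomog mdeg 2 (tnth g j).
    rewrite -[LHS](pihomog_dE (graph_form_homog k)) ea raddf_sum; apply: eq_bigr => j _.
    by rewrite /= pihomog2M // mxE.
  under eq_bigr => k _ do rewrite e2 scaler_sumr.
  rewrite exchange_big big1 // => j _ /=; under eq_bigr => k _ do rewrite scalerA.
  by rewrite -scaler_suml; have /rowP/(_ j) := vA; rewrite !mxE => ->; rewrite scale0r.
(* Modulo the graph forms g = N g, where the entries of N have no constant term. *)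
pose B := invmx A0.
pose N j l := (j == l)%:R - \sum_i B j i *: a i l : SymE.
have N1 j l : ord_ge 1 (N j l).
  move=> m; rewrite lt0n mdeg_eq0 mcoeff_msupp; apply: contraNN => /eqP->.
  have := mulVmx A0_unit => /matrixP/(_ j l); rewrite !mxE => e.
  rewrite mcoeffB raddf_sum /= -mpolyC_nat mcoeffC eqxx mulr1 -e subr_eq0.
  by apply/eqP/eq_bigr => i _; rewrite mcoeffZ mxE.
have eg j : tnth g j = \sum_i B j i *: graph_form i + \sum_l N j l * tnth g l.
  under [X in _ = _ + X]eq_bigr => l _ do rewrite mulrBl.
  have ej : \sum_l (j == l)%:R * tnth g l = tnth g j.
    rewrite (bigD1 j) //= eqxx mul1r big1 ?addr0 // => l.
    by rewrite eq_sym => /negPf->; rewrite mul0r.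
  rewrite sumrB ej.
  rewrite addrCA [X in _ + X](_ : _ = 0) ?addr0 //; apply/eqP; rewrite subr_eq0; apply/eqP.
  under [RHS]eq_bigr => l _ do rewrite mulr_suml.
  rewrite exchange_big; apply: eq_bigr => i _; rewrite ea scaler_sumr.
  by apply: eq_bigr => l _; rewrite scalerAl.
have step k p : gen_ideal g p -> exists b m : 'I_c -> SymE, (forall j, ord_ge k (m j)) /\
    p = \sum_i b i * graph_form i + \sum_j m j * tnth g j.
  move=> /gen_idealP[u0 ->]; elim: k => [|k [b [m [hm ->]]]].
    exists (fun=> 0), u0; split=> //; rewrite [X in _ = X + _]big1 ?add0r // => i _.
    by rewrite mul0r.
  exists (fun i => b i + \sum_j B j i *: m j), (fun l => \sum_j m j * N j l).
  split=> [l|]; first by apply: ord_ge_sum => j; rewrite -addn1; apply: ord_geM.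
  under [X in _ = X + _]eq_bigr => i _ do rewrite mulrDl.
  rewrite big_split /= -addrA; congr (_ + _).
  under eq_bigr => j _ do rewrite eg mulrDr mulr_sumr mulr_sumr.
  rewrite big_split /= exchange_big /= [X in _ + X]exchange_big /=; congr (_ + _).
    by apply: eq_bigr => i _; rewrite mulr_suml; apply: eq_bigr => j _; rewrite -scalerAr scalerAl.
  by apply: eq_bigr => l _; rewrite mulr_suml; apply: eq_bigr => j _; rewrite mulrA.
move=> p; rewrite eM => hp; have [d hd] : exists d, (msize p <= 2 + d)%N by exists (msize p); exact: leq_addl.
have [b [m [hm ep]]] := step (2 + d)%N p hp.
rewrite -(trunc_id hd) ep truncD !trunc_sum.
rewrite [X in _ + X]big1 ?addr0 => [|j _]; last first.
  by apply: trunc_ord_ge (leqnn _); rewrite -[(2 + _)%N]addn0; apply: ord_geM.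
apply: (ideal_sum _ (gen_ideal_ideal _)) => i _; rewrite mulrC (truncM _ _ (graph_form_homog i)).
rewrite mulrC; apply: (idealMl (gen_ideal_ideal _)).
by rewrite -(tnth_mktuple graph_form i) (tnth_nth 0); apply: gen_ideal_nth; rewrite size_tuple.
Qed.

Definition cone_ideal : set SymW := [set p | forall w, cone w -> peval p w = 0].

(** If the graph forms generate the ideal of the variety then its section by t = 0 is the join of
    the base locus with the projective space of the dual of F^2; hence a family of
    independent functions on the base locus, the c coordinates of that dual space and
    t are independent on the variety. *)
Lemma cone_alg_indep r (f : r.-tuple SymW) :
  vanishing_ideal M = gen_ideal graph_forms -> alg_indep cone_ideal f -> (r + c <= n)%N.
Proof.
move=> eM hf.
pose I k : set SymE := [set p | forall v : E, v.1.1 = 0 -> cone v.1.2 ->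
  (forall i : 'I_c, (k <= i)%N -> v.2 0 i = 0) -> peval p v = 0].
have hI k : ideal (I k).
  split=> [v _ _ _|p q hp hq v v1 v2 v3|a p hp v v1 v2 v3]; first exact: meval0.
    by rewrite pevalD hp // hq // addr0.
  by rewrite pevalM hp // mulr0.
suff H k : (k <= c)%N -> exists F : (r + k).-tuple SymE, alg_indep (I k) F.
  have [F hF] := H c (leqnn c); rewrite -ltnS.
  apply: (@euler_alg_indep _ [tuple of rcons F tcoord]); apply: alg_indep_rcons.
  - exact: vanishing_idealP.
  - exact: tcoord_nonzerodivisor.
  - apply: alg_indep_sub hF => _ [a [b [ha ->]]].
    have tI : I c tcoord by move=> v v1 _ _; rewrite peval_tcoord.
    apply: (idealD (hI c)); last exact: (idealMr _ (hI c)).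
    move: ha; rewrite eM; apply: gen_ideal_min => // i; rewrite size_tuple => ic.
    rewrite -(tnth_nth _ _ (Ordinal ic)) tnth_mktuple => v v1 v2 _.
    by rewrite peval_graph_form v1 mul0r v2 subr0.
elim: k => [|k IH] kc.
  have [F hF] : exists F : r.-tuple SymE, alg_indep (I 0%N) F; last first.
    by move: F hF; rewrite addn0 => F hF; exists F.
  exists [tuple base_form (tnth f i) | i < r] => p hp; apply: hf => w hw.
  have := hp (0, w, 0) erefl hw; rewrite -comp_mpolyA -/(base_form _) peval_base_form.
  by apply=> i _; rewrite mxE.
have [F hF] := IH (ltnW kc); rewrite addnS.
exists [tuple of rcons F (zcoord (Ordinal kc))]; apply: alg_indep_rcons => //.
  move=> h zh v v1 v2 v3.
  have hne (v' : E) : v'.1 = v.1 -> (forall i : 'I_c, (k < i)%N -> v'.2 0 i = 0) ->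
      v'.2 0 (Ordinal kc) != 0 -> peval h v' = 0.
    move=> e hv' z0; have := zh v'; rewrite pevalM peval_zcoord e => /(_ v1 v2 hv') /eqP.
    by rewrite mulf_eq0 (negPf z0) => /eqP.
  have [z0|z0] := eqVneq (v.2 0 (Ordinal kc)) 0; last exact: hne.
  apply: (@peval_line_limit _ _ h v (zvec (Ordinal kc))) => s s0; apply: hne.
  - by rewrite [v.1]surjective_pairing; congr (_, _); rewrite /= scaler0 addr0.
  - move=> i ki; rewrite /= !mxE v3 // add0r (_ : i == Ordinal kc = false) ?mulr0 //.
    by rewrite -val_eqE gtn_eqF.
  - by rewrite /= !mxE z0 add0r !eqxx mulr1.
apply: alg_indep_sub hF => _ [a [b [ha ->]]]; apply: (idealD (hI k)).
  by move=> v v1 v2 v3; apply: ha => // i /ltnW; exact: v3.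
apply: (idealMr _ (hI k)) => v v1 v2 v3; rewrite peval_zcoord.
exact: v3.
Qed.

Lemma base_locusE w (w0 : w != 0) : base_locus Q (ppoint w0) <-> cone w.
Proof.
by split=> h i; [exact: vanishes_peval (h i) | exact: vanishes_homog (Q_homog i) (h i)].
Qed.

Lemma zclosed_base_locus : zclosed (base_locus Q).
Proof.
suff -> : base_locus Q = zeros [set tnth Q i | i in [set: 'I_c]] by exact: zclosed_zeros.
rewrite eqEsubset; split=> x hx; first by move=> _ [i _ <-].
by move=> i; apply: hx; exists i.
Qed.

Lemma cone_ideal_gen : gen_ideal Q `<=` cone_ideal.
Proof.
apply: gen_ideal_min => [|i].
  split=> [w _|p q hp hq w hw|a p hp w hw]; first exact: meval0.
    by rewrite pevalD hp // hq // addr0.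
  by rewrite pevalM hp // mulr0.
by rewrite size_tuple => ic w hw; rewrite -(tnth_nth _ _ (Ordinal ic)) hw.
Qed.

Lemma cone_ideal_base_locus Y : Y `<=` base_locus Q -> cone_ideal `<=` vanishing_ideal Y.
Proof.
move=> YB p hp x Yx; have [w [w0 ex]] := pspaceP x.
rewrite ex; apply/vanishesP => r; apply: hp => i.
have /(_ i) : base_locus Q x by exact: YB.
by rewrite ex => /vanishesP.
Qed.

Lemma base_locus_chain m Y : irr_chain (base_locus Q) m Y ->
  exists f : m.+1.-tuple SymW, alg_indep cone_ideal f.
Proof.
move=> chY; have [f hf] := irr_chain_alg_indep chY; exists f.
apply: alg_indep_sub hf; apply: cone_ideal_base_locus.
by have [/(_ _ (leqnn m))[]] := chY.
Qed.

Lemma cone_ideal_proper : alg_indep cone_ideal [tuple].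
Proof.
have hI : ideal cone_ideal.
  split=> [w _|p q hp hq w hw|a p hp w hw]; first exact: meval0.
    by rewrite pevalD hp // hq // addr0.
  by rewrite pevalM hp // mulr0.
apply: alg_indep_nil => // /(_ 0) h; have : peval (1 : SymW) 0 = 0.
  by apply: h => i; exact: peval0 (Q_homog i).
by rewrite /peval meval1 => /eqP; rewrite oner_eq0.
Qed.

Lemma no_chain_transversal : (c <= n)%N ->
  ~ (exists Y, irr_chain (base_locus Q) (n - c) Y) -> exists ls, transversal_forms ls.
Proof.
move=> cn nch.
have [ls [sz l1 l0]] := hyperplanes_cut zclosed_base_locus nch.
exists ls; split=> // [|w hw lw]; first by rewrite sz subnK.
apply/eqP; apply: contrapT => /negP w0; apply: (l0 (ppoint w0)).
  exact/base_locusE.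
by move=> q ql; apply: vanishes_homog (l1 q ql) (lw q ql).
Qed.

Theorem euler_ideal_transversal :
  vanishing_ideal M = gen_ideal graph_forms -> exists ls, transversal_forms ls.
Proof.
move=> eM; have cn := cone_alg_indep eM cone_ideal_proper.
apply: no_chain_transversal => // -[Y /base_locus_chain[f /(cone_alg_indep eM)]].
by rewrite -ltnS addSn subnK // ltnn.
Qed.

Theorem set_complete_intersection_transversal :
  set_complete_intersection c (base_locus Q) -> exists ls, transversal_forms ls.
Proof.
case=> [[cn B0]|[_ [d [_ nch] dimd] _]].
  apply: no_chain_transversal; first by rewrite cn.
  rewrite B0 => -[Y [/(_ 0%N (leq0n _))[[_ [x Yx] _] YB] _]].
  exact: (YB x Yx).
apply: no_chain_transversal; first by rewrite dimd leqW // leq_addl.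
by rewrite dimd -addSn addnK.
Qed.

(** For a regular sequence, independent functions on the base locus extend by
    Q_1, ..., Q_c to independent elements of the coordinate ring of W, while fewer
    than n - c hyperplanes cannot cut the base locus to the empty set. *)
Theorem regular_set_complete_intersection :
  regular_sequence Q -> set_complete_intersection c (base_locus Q).
Proof.
move=> reg.
have bound r (f : r.-tuple SymW) : alg_indep cone_ideal f -> (r + c <= n)%N.
  move=> /(alg_indep_sub cone_ideal_gen)/(regular_alg_indep reg).
  by rewrite size_tuple.
have nch m : (n <= m + c)%N -> ~ (exists Y, irr_chain (base_locus Q) m Y).
  move=> nm [Y /base_locus_chain[f /bound]]; rewrite addSn => /leq_trans/(_ nm).
  by rewrite ltnn.
have := bound _ _ cone_ideal_proper; rewrite add0n leq_eqVlt => /orP[/eqP cn|cn].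
  left; split=> //; rewrite -subset0 => x Bx; apply: (nch 0%N); first by rewrite cn.
  exists (fun=> zclosure [set x]); split=> // i _; split; first exact: zirreducible_point.
  by apply: zclosure_min => [|_ ->//]; exact: zclosed_base_locus.
right; pose d := (n - c).-1; have dn : n = (d + c).+1 by rewrite /d; lia.
have ch : exists Y, irr_chain (base_locus Q) d Y.
  apply: contrapT => /(hyperplanes_cut zclosed_base_locus)[ls [sz l1 l0]].
  have [||a ha [i ai]] := common_zero K_uncountable (s := Q ++ squares ls).
  - by rewrite size_cat size_tuple size_map sz [X in (_ < X)%N]dn addnC.
  - move=> p; rewrite mem_cat => /orP[/tnthP[i ->//]|]; exact: squares_homog.
  have [w hw] := crd_surj a.
  have {}ha p : p \in Q ++ squares ls -> peval p w = 0.
    by move=> /ha <-; apply: meval_eq.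
  have w0 : w != 0 by apply: contraNneq ai => w0; rewrite -hw w0 linear0.
  apply: (l0 (ppoint w0)).
    by apply/base_locusE => j; apply: ha; rewrite mem_cat mem_tnth.
  move=> q ql; apply: vanishes_homog (l1 q ql) _.
  by apply: (squares_eq0 (ls := ls)) ql => p pl; apply: ha; rewrite mem_cat pl orbT.
have [x Bx] : base_locus Q !=set0.
  have [Y [/(_ 0%N (leq0n _))[[_ [x Yx] _] YB] _]] := ch.
  by exists x; exact: YB.
split; first exact: zclosed_base_locus.
  by exists d => //; split=> //; apply: nch; rewrite addSn -dn.
exists Q; split=> [i|]; first exact: homogE (Q_homog i).
rewrite eqEsubset; split=> p; last first.
  move=> [k /cone_ideal_gen hk]; apply: (cone_ideal_base_locus (@subset_refl _ _)).
  by move=> w /hk; rewrite pevalX => /eqP; rewrite expf_eq0 => /andP[_ /eqP].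
move=> hp; apply: contrapT => nrad.
have [|k hk|a ha] := nullstellensatz K_uncountable (I := gen_ideal Q) (g := p).
- exact: gen_ideal_ideal.
- by apply: nrad; exists k.
have [w hw] := crd_surj a; rewrite -(meval_eq _ (v1 := fun i => coord (vbasis {:W}) i w)) //.
rewrite -/(peval p w) => /eqP; apply.
have cw : cone w.
  move=> i; have <- : (tnth Q i).@[a] = 0; last exact: meval_eq.
  by apply: ha; rewrite (tnth_nth 0); apply: gen_ideal_nth; rewrite size_tuple.
have [->|w0] := eqVneq w 0; first by apply: (vanishing_ideal_at0 _ hp); exists x.
by apply: (@vanishes_peval _ _ p w w0); apply: hp; apply/base_locusE.
Qed.

End Euler.

(** * Tangent spaces and lines through a general point *)

Lemma scaler_swap (A : comNzRingType) (L : lmodType A) (a b : A) (v : L) :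
  a *: (b *: v) = b *: (a *: v).
Proof. by rewrite !scalerA mulrC. Qed.

Lemma scaler_regroup (A : nzRingType) (L : lmodType A) (r a b e : A) (u v : L) :
  r *: (a *: u + b *: (e *: u + v)) = (r * (a + b * e)) *: u + (r * b) *: v.
Proof. by rewrite !scalerDr !scalerA addrA -scalerDl mulrDr !mulrA. Qed.

Section Lines.
Variables (K : closedFieldType) (W : vectType K).
Hypothesis K_uncountable : ~ countable [set: K].
Local Notation n := (\dim {:W}).
Local Notation SymW := {mpoly K[n]}.
Variables (c : nat) (Q : c.-tuple SymW).
Hypothesis Q_homog : forall i, tnth Q i \is 2.-homog.

Local Notation E := (VF W c).
Local Notation SymE := {mpoly K[\dim {:E}]}.
Local Notation P := (K^o * W)%type.
Local Notation M := (euler_symmetric Q).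
Local Notation aff := (aff Q).

(** tau(1, w0) is the point aff w0 of the cone and tau(0, w) is the derivative of aff at
    w0 along w, so that tau parametrizes the affine cone over the tangent space. *)
Definition tau (w0 : W) (u : P) : E :=
  (u, \row_i (pdiff (tnth Q i) w0 u.2 - u.1 * peval (tnth Q i) w0)).

Lemma tau_linear w0 : linear (tau w0).
Proof.
move=> a u v; congr (_, _); apply/rowP => i; rewrite !mxE /= pdiffP.
by rewrite (_ : a *: u.1 = a * u.1) //; ring.
Qed.

HB.instance Definition _ w0 := GRing.isLinear.Build K P E *:%R (tau w0) (tau_linear w0).

Definition tangent_cone w0 : {vspace E} := limg (linfun (tau w0)).

Lemma mem_tangent_cone w0 v : v \in tangent_cone w0 <->
  forall i, v.2 0 i = pdiff (tnth Q i) w0 v.1.2 - v.1.1 * peval (tnth Q i) w0.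
Proof.
split=> [/memv_imgP[u _ ->] i|h]; first by rewrite lfunE /= mxE.
have -> : v = linfun (tau w0) v.1; last exact: memv_img (memvf _).
rewrite lfunE [LHS]surjective_pairing; congr (_, _); apply/rowP => i.
by rewrite h mxE.
Qed.

Lemma dim_tangent_cone w0 : \dim (tangent_cone w0) = n.+1.
Proof.
rewrite limg_dim_eq; first by rewrite !dimvf.
apply/eqP; rewrite -subv0; apply/subvP => u /memv_capP[_]; rewrite memv_ker lfunE => /eqP.
by move=> /(congr1 fst) /= ->; exact: mem0v.
Qed.

Lemma pdiff_Q_self i w0 : pdiff (tnth Q i) w0 w0 = 2%:R * peval (tnth Q i) w0.
Proof.
have e := peval_quadric K_uncountable w0 w0 1 (Q_homog i).
have w2 : w0 + 1 *: w0 = 2%:R *: w0 by rewrite scale1r scaler_nat mulr2n.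
rewrite w2 (peval_homog _ _ (Q_homog i)) mul1r expr1n mul1r in e.
apply: (addrI (peval (tnth Q i) w0)); apply: (addIr (peval (tnth Q i) w0)).
by rewrite -e; ring.
Qed.

Lemma tau_aff w0 : tau w0 (1, w0) = aff w0.
Proof.
rewrite /aff /veronese_map /tau expr1n scale1r; congr (_, _); apply/rowP => i.
by rewrite !mxE /= pdiff_Q_self; ring.
Qed.

Lemma tau_split w0 (u : P) :
  tau w0 u = u.1 *: aff w0 + tau w0 (0, u.2 - u.1 *: w0).
Proof.
rewrite -tau_aff -linearP; congr tau; rewrite [LHS]surjective_pairing; congr (_, _) => /=.
  by rewrite addr0; apply/esym; exact: mulr1.
by rewrite addrC subrK.
Qed.

Lemma aff_line w0 w s : aff (w0 + s *: w) =
  aff w0 + s *: tau w0 (0, w) + s ^+ 2 *: (0, 0, \row_i peval (tnth Q i) w).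
Proof.
rewrite /aff /veronese_map /tau !expr1n !scale1r; congr (_, _, _) => /=.
- by rewrite !scaler0 !addr0.
- by rewrite scaler0 addr0.
apply/rowP => i; rewrite !mxE (peval_quadric K_uncountable) //=.
by rewrite mul0r subr0.
Qed.

Lemma pdiff_limit (p : SymE) (u v : E) :
  (forall s, s != 0 -> pdiff p (s *: u) v = 0) -> forall s, pdiff p (s *: u) v = 0.
Proof.
move=> h s; have [->|/h//] := eqVneq s 0.
have hi i : exists g : {poly K}, forall s, g.[s] = peval p^`M(i) (s *: u).
  have [g hg] := peval_line_poly p^`M(i) 0 u.
  by exists g => r; rewrite hg add0r.
pose g i := projT1 (cid (hi i)).
have gE i r : (g i).[r] = peval p^`M(i) (r *: u) by exact: (projT2 (cid (hi i))).
pose G := \sum_i g i * (coord (vbasis {:E}) i v)%:P.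
have GE r : G.[r] = pdiff p (r *: u) v.
  by rewrite horner_sum; apply: eq_bigr => i _; rewrite hornerM hornerC gE.
by rewrite -GE (@poly_eq0_off0 _ G) ?horner0 // => r /h; rewrite GE.
Qed.

Lemma pdiff_graph_form i w0 v : pdiff (graph_form Q i) (aff w0) v =
  v.2 0 i + v.1.1 * peval (tnth Q i) w0 - pdiff (tnth Q i) w0 v.1.2.
Proof.
apply: (@pdiff_unique _ _ _ _ _ 0 0 _ (v.1.1 * v.2 0 i - peval (tnth Q i) v.1.2)%:P) => s.
rewrite scaler0 addr0 hornerC peval_graph_form /= !mxE expr1n scale1r.
rewrite (peval_quadric K_uncountable) // (_ : s *: v.1.1 = s * v.1.1) //.
by ring.
Qed.

(** The differentials of the graph forms bound the tangent space from above; curves in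
    the variety bound it from below. *)
Lemma affine_tangentP w0 (x : pspace E) v : sval x = <[aff w0]>%VS ->
  v \in tangent_cone w0 <->
  forall p u, vanishing_ideal M p -> u \in sval x -> pdiff p u v = 0.
Proof.
move=> ex; split=> [/memv_imgP[u _ ->]|h]; last first.
  apply/mem_tangent_cone => i.
  have := h (graph_form Q i) (aff w0) (graph_form_vanishes Q_homog i).
  rewrite ex memv_line => /(_ isT); rewrite pdiff_graph_form => /eqP.
  by rewrite subr_eq0 => /eqP <-; rewrite addrK.
move=> p u' /(vanishing_ideal_euler Q_homog) hp; rewrite ex => /vlineP[r ->].
rewrite lfunE /= tau_split pdiffP.
have -> : pdiff p (r *: aff w0) (aff w0) = 0.
  apply: (@pdiff_unique _ _ _ _ _ 0 0 _ 0) => s.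
  by rewrite scaler0 addr0 -scalerDl hp horner0 !mulr0 !addr0.
rewrite mulr0 add0r; move: r; apply: pdiff_limit => r r0.
apply: (mulfI r0); rewrite mulr0 -[LHS]addr0.
have e0 : pdiff p (r *: aff w0) 0 = 0.
  by rewrite /pdiff big1 // => i _; rewrite linear0 mulr0.
rewrite -[X in _ + X = _]e0 -pdiffP addr0.
apply: (@pdiff_unique _ _ _ _ _ (r *: (0, 0, \row_i peval (tnth Q i) (u.2 - u.1 *: w0))) 0 _ 0) => s.
rewrite horner0 !mulr0 !addr0 -[RHS](hp r (w0 + s *: (u.2 - u.1 *: w0))) aff_line !scalerDr.
by congr peval; congr (_ + _ + _); exact: scaler_swap.
Qed.

Lemma affine_tangent_eq w0 (x : pspace E) T : sval x = <[aff w0]>%VS ->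
  affine_tangent M x T <-> T = tangent_cone w0.
Proof.
move=> ex; split=> [h|-> v]; last exact: affine_tangentP.
by apply/vspaceP => v; apply/idP/idP => [/h/(affine_tangentP _ ex)|/(affine_tangentP _ ex)/h].
Qed.

(** The graph forms take the values - Q_i(w) at aff w0 + tau(0, w). *)
Lemma line_sub_cone w0 w : (forall y : pspace E,
    sval y = <[(aff w0 + tau w0 (0, w))%R]>%VS -> M y) -> cone Q w.
Proof.
move=> hM i; have v0 : aff w0 + tau w0 (0, w) != 0.
  apply/eqP => /(congr1 (fun v : E => v.1.1)) /= /eqP.
  by rewrite expr1n addr0 oner_eq0.
have My := hM (ppoint v0) erefl.
have := graph_form_vanishes Q_homog i My => /vanishes_peval.
rewrite peval_graph_form /= !mxE /= expr1n scale1r addr0 mul1r.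
have := peval_quadric K_uncountable w0 w 1 (Q_homog i); rewrite scale1r => ->.
by rewrite !mul1r expr1n mul1r mul0r subr0 opprD addrA subrr add0r => /eqP; rewrite oppr_eq0 => /eqP.
Qed.

(** If Q(w) = 0 then s |-> aff (w0 + s w) is a straight line. *)
Lemma cone_line_sub w0 w a b p : cone Q w -> vanishing_ideal M p ->
  peval p (a *: aff w0 + b *: tau w0 (0, w)) = 0.
Proof.
move=> cw /(vanishing_ideal_euler Q_homog) hp.
have hne a' : a' != 0 -> peval p (a' *: aff w0 + b *: tau w0 (0, w)) = 0.
  move=> a0; rewrite -[RHS](hp a' (w0 + (a'^-1 * b) *: w)) aff_line; congr peval.
  have -> : \row_i peval (tnth Q i) w = 0 by apply/rowP => i; rewrite !mxE cw.
  rewrite (_ : (0, 0, 0) = 0 :> E) // scaler0 addr0 scalerDr scalerA mulrA mulfV //.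
  by rewrite mul1r.
have [->|/hne//] := eqVneq a 0; rewrite scale0r add0r.
apply: (@peval_line_limit _ _ p _ (aff w0)) => s /hne.
by rewrite addrC.
Qed.

Section AtPoint.
Variables (w0 : W) (x : pspace E).
Hypothesis ex : sval x = <[aff w0]>%VS.
Local Notation T := (tangent_cone w0).
Local Notation D := (tangent_space x T).

(** The formula kills aff w0 and inverts w |-> tau(0, w). *)
Definition tangent_coord (d : D) : W := (vsval d).1.2 - (vsval d).1.1 *: w0.

Lemma tangent_coord_linear : linear tangent_coord.
Proof.
move=> a u v; rewrite /tangent_coord linearP /= scalerDl scalerBr opprD.
by rewrite addrACA scalerA.
Qed.

HB.instance Definition _ :=
  GRing.isLinear.Build K D W *:%R tangent_coord tangent_coord_linear.

Lemma vsval_tangent (d : D) :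
  vsval d = (vsval d).1.1 *: aff w0 + tau w0 (0, tangent_coord d).
Proof.
have : vsval d \in T by apply: (subvP (diffvSl _ _)); exact: subvsP.
case/memv_imgP => u _; rewrite lfunE /= => e.
by rewrite /tangent_coord e -tau_split.
Qed.

Lemma tangent_notin_point (d : D) : vsval d \in sval x -> d = 0.
Proof.
move=> dx; apply: val_inj; rewrite linear0; apply/eqP; rewrite -memv0.
rewrite -(capv_diff T (sval x)); apply/memv_capP; split=> //; exact: subvsP.
Qed.

Lemma mem_aff : aff w0 \in sval x.
Proof. by rewrite ex memv_line. Qed.

Lemma mem_point u : u \in sval x -> exists a, u = a *: aff w0.
Proof. by rewrite ex => /vlineP. Qed.

Lemma tangent_coord_inj : lker (linfun tangent_coord) == 0%VS.
Proof.
apply/lker0P => d d'; rewrite !lfunE => /eqP; rewrite -subr_eq0 -linearB => /eqP e.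
apply/eqP; rewrite -subr_eq0; apply/eqP/tangent_notin_point.
by rewrite vsval_tangent e (linear0 (tau w0)) addr0 memvZ ?mem_aff.
Qed.

Lemma dim_tangent_space : \dim {: D} = n.
Proof.
have aT : (sval x <= T)%VS.
  rewrite ex -memvE; apply/memv_imgP; exists (1, w0); first exact: memvf.
  by rewrite lfunE /= tau_aff.
have := dimv_cap_compl T (sval x); rewrite dim_tangent_cone.
rewrite (capv_idPr aT) (eqP (svalP x)) add1n => -[<-].
by rewrite !dimvf.
Qed.

Definition tangent_iso : {linear D -> W} := linfun tangent_coord.
Definition tangent_inv : {linear W -> D} := ((linfun tangent_coord)^-1)%VF.

Lemma tangent_isoE d : tangent_iso d = tangent_coord d.
Proof. exact: lfunE. Qed.

Lemma tangent_isoK : cancel tangent_iso tangent_inv.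
Proof. exact/lker0_lfunK/tangent_coord_inj. Qed.

Lemma tangent_invK : cancel tangent_inv tangent_iso.
Proof.
move=> w; apply: limg_lfunVK; suff -> : limg (linfun tangent_coord) = fullv by exact: memvf.
apply/eqP; rewrite eqEdim subvf limg_dim_eq ?(eqP tangent_coord_inj) ?capv0 //.
exact/eq_leq/esym/dim_tangent_space.
Qed.

(** The line through x in the direction of tau(0, w) lies on the variety iff Q(w) = 0. *)
Theorem variety_of_lines_base_locus :
  variety_of_lines M (x := x) (T := T) = pimage tangent_isoK @^-1` base_locus Q.
Proof.
rewrite eqEsubset; split=> Dl; have [d [d0 ->]] := pspaceP Dl;
  rewrite /preimage /= (pimageE tangent_isoK d0 (iso_neq0 tangent_isoK d0)).
  move=> [U [_ xU UM eU]]; apply/(base_locusE Q_homog); rewrite tangent_isoE.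
  apply: (@line_sub_cone w0) => y ey; apply: UM; rewrite ey -memvE eU.
  have -> : aff w0 + tau w0 (0, tangent_coord d) =
      (1 - (vsval d).1.1) *: aff w0 + vsval d.
    by rewrite [X in _ = _ + X]vsval_tangent addrA scalerBl scale1r subrK.
  apply: memv_add; first by rewrite memvZ ?mem_aff.
  by rewrite /= limg_line lfunE /= memv_line.
move=> /(base_locusE Q_homog) ; rewrite tangent_isoE => cw.
exists (sval x + <[vsval d]>)%VS; split.
- rewrite /is_line dimv_disjoint_sum.
    have dx : \dim (sval x) = 1%N by exact: (eqP (svalP x)).
    have vd0 : vsval d != 0.
      by apply: contraNneq d0 => e; apply/eqP/tangent_notin_point; rewrite e mem0v.
    by rewrite dx dim_vline vd0.
  apply/eqP; rewrite -subv0; apply/subvP => v /memv_capP[vx /vlineP[k ev]].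
  rewrite memv0 ev; have [->|k0] := eqVneq k 0; first by rewrite scale0r.
  case/eqP: d0; apply: tangent_notin_point.
  by rewrite -[vsval d](scalerK k0) -ev memvZ.
- exact: addvSl.
- move=> y yU; have [v [v0 ey]] := pspaceP y.
  have : v \in (sval x + <[vsval d]>)%VS by rewrite memvE; move: yU; rewrite ey.
  case/memv_addP => u /mem_point[a ->] [u' /vlineP[b ->] ev].
  rewrite (zclosedE (zclosed_euler Q)) => p hp; rewrite ey; apply/vanishesP => r.
  rewrite ev vsval_tangent.
  have -> : r *: (a *: aff w0 + b *: ((vsval d).1.1 *: aff w0 + tau w0 (0, tangent_coord d))) =
      (r * (a + b * (vsval d).1.1)) *: aff w0 + (r * b) *: tau w0 (0, tangent_coord d).
    exact: scaler_regroup.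
  exact: cone_line_sub.
- by rewrite /tangent_direction /= limg_line lfunE.
Qed.

End AtPoint.

Lemma set_complete_intersection_lines w0 (x : pspace E) : sval x = <[aff w0]>%VS ->
  set_complete_intersection c (variety_of_lines M (x := x) (T := tangent_cone w0)) <->
  set_complete_intersection c (base_locus Q).
Proof.
move=> ex; rewrite (variety_of_lines_base_locus ex); split=> h.
  have := set_complete_intersection_preimage K_uncountable
    (tangent_invK ex) (tangent_isoK ex) h.
  congr set_complete_intersection; rewrite eqEsubset.
  by split=> y; rewrite /preimage /= (pimageK (tangent_invK ex) (tangent_isoK ex)).
exact: (set_complete_intersection_preimage K_uncountable (tangent_isoK ex) (tangent_invK ex) h).
Qed.

Definition chart_complement : set (pspace E) := [set x | vanishes (tcoord W c) x].

Lemma chart_point x : M x -> ~ chart_complement x -> exists w0, sval x = <[aff w0]>%VS.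
Proof.
have [v [v0 ->]] := pspaceP x => Mx nx.
have t0 : v.1.1 != 0.
  apply/eqP => t0; apply: nx; apply: vanishes_homog (lform_homog _) _.
  by rewrite peval_tcoord.
exists ((v.1.1)^-1 *: v.1.2) => /=.
have ev : v = v.1.1 *: aff ((v.1.1)^-1 *: v.1.2).
  rewrite scale_aff scalerA mulfV // scale1r [LHS]surjective_pairing.
  rewrite [v.1 in LHS]surjective_pairing; congr (_, _, _); apply/rowP => i; rewrite mxE.
  have /vanishes_peval := graph_form_vanishes Q_homog i Mx.
  rewrite peval_graph_form => /eqP; rewrite subr_eq0 => /eqP e.
  rewrite (peval_homog _ _ (Q_homog i)) -e; apply: (mulfI t0).
  by field.
apply/eqP; rewrite eqEdim -memvE !dim_vline v0 aff_neq0 andbT.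
by rewrite {1}ev memvZ ?memv_line.
Qed.

(** The points off the hyperplane t = 0 are dense, and the lines through any of them
    form a copy of the base locus. *)
Theorem general_lines_base_locus :
  for_general_point M (fun x => exists T, smooth_point M x T /\
     set_complete_intersection c (variety_of_lines M (x := x) (T := T))) <->
  set_complete_intersection c (base_locus Q).
Proof.
split=> [[A [_ dense hA]]|hB].
  have [x [[Mx nAx] nx]] : exists x, (M `\` A) x /\ ~ chart_complement x.
    apply: contrapT => h; have Mt : M `<=` chart_complement.
      apply: subset_trans dense _; apply: zclosure_min.
        have -> : chart_complement = zeros [set tcoord W c]; last exact: zclosed_zeros.
        by rewrite eqEsubset; split=> x hx; [move=> _ -> | exact: hx].
      by move=> x hx; apply: contrapT => nx; apply: h; exists x.
    have : M (ppoint (aff_neq0 Q 0)) by apply: sub_zclosure; exists 1, 0.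
    by move=> /Mt/vanishes_peval; rewrite peval_tcoord /= expr1n => /eqP; rewrite oner_eq0.
  have [w0 ex] := chart_point Mx nx.
  have [T [[_ /(affine_tangent_eq _ ex) -> _] hT]] := hA x (conj Mx nAx).
  exact/(set_complete_intersection_lines ex).
exists chart_complement; split.
- have -> : chart_complement = zeros [set tcoord W c]; last exact: zclosed_zeros.
  by rewrite eqEsubset; split=> x hx; [move=> _ -> | exact: hx].
- rewrite {1}(zclosedE (zclosed_euler Q)) [zclosure _]zclosureE => x hx p hp; apply: hx.
  apply/(vanishing_ideal_euler Q_homog) => r w.
  apply: (iffLR (vanishesP p (aff_neq0 Q w)) _ r); apply: hp; split.
    by apply: sub_zclosure; exists 1, w.
  by move=> /vanishes_peval; rewrite peval_tcoord /= expr1n => /eqP; rewrite oner_eq0.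
- move=> x [Mx nx]; have [w0 ex] := chart_point Mx nx.
  exists (tangent_cone w0); split; last exact/(set_complete_intersection_lines ex).
  split=> //; first exact/(affine_tangent_eq _ ex).
  by rewrite dim_tangent_cone; apply: euler_has_dim.
Qed.

End Lines.

(** * The equivalence of the four conditions *)

Section Quadrics.
Variables (K : closedFieldType) (W : vectType K).
Variables (F : nat -> set {mpoly K[\dim {:W}]}) (c : nat).
Variable Q : c.-tuple {mpoly K[\dim {:W}]}.
Hypothesis (hF : symbol_system2 F) (hQ : is_basis (F 2%N) Q).

Lemma symbol_quadrics i : tnth Q i \is 2.-homog.
Proof.
apply: (symbol_homog hF); case: hQ => -> _; exists (fun j => (j == i)%:R).
by rewrite (bigD1 i) //= eqxx scale1r big1 ?addr0 // => j /negPf->; rewrite scale0r.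
Qed.

End Quadrics.

Theorem theorem1p3 (R : realType) (W : vectType R[i])
    (F : nat -> set {mpoly R[i][\dim {:W}]}) (c : nat)
    (Q : c.-tuple {mpoly R[i][\dim {:W}]})
    (hF : symbol_system2 F) (hQ : is_basis (F 2%N) Q) :
  [<-> complete_intersection c (euler_symmetric Q);
       set_complete_intersection c (base_locus Q);
       for_general_point (euler_symmetric Q) (fun x =>
         exists T, smooth_point (euler_symmetric Q) x T /\
           set_complete_intersection c
             (variety_of_lines (euler_symmetric Q) (x := x) (T := T)));
       regular_sequence Q].
Proof.
have unc := @complex_uncountable R.
have Q2 := symbol_quadrics hF hQ; have Qfree := hQ.2.
tfae.
- move=> [_ _ [g eM]].
  have [ls tr] := euler_ideal_transversal Q2 (euler_ideal_graph_forms unc Q2 Qfree eM).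
  exact: (regular_set_complete_intersection unc Q2 (transversal_regular unc Q2 tr)).
- by move/(general_lines_base_locus unc Q2).
- move/(general_lines_base_locus unc Q2).
  move=> /(set_complete_intersection_transversal Q2)[ls tr].
  exact: (transversal_regular unc Q2 tr).
- move=> /(regular_set_complete_intersection unc Q2).
  move=> /(set_complete_intersection_transversal Q2)[ls tr].
  exact: (transversal_complete_intersection unc Q2 tr).
Qed.
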